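(* Let $2\leq k\leq 9$ and let $\overline{p}_k(n)$ denote the number of $k$-regular overpartitions of $n$. Set $\overline{N}_2=75$, $\overline{N}_3=17$, $\overline{N}_4=33$, $\overline{N}_5=30$, $\overline{N}_6=10$, $\overline{N}_7=24$, $\overline{N}_8=27$, $\overline{N}_9=10$. Then for all integers $n\geq \overline{N}_k$, \[ \overline{p}_k(n+1)\overline{p}_k(n)^2-2\overline{p}_k(n-1)\overline{p}_k(n+1)^2+\overline{p}_k(n-1)\overline{p}_k(n)\overline{p}_k(n+2)>0. \]
   Context: An overpartition of $n$ is a partition of $n$ in which the first occurrence of each distinct part may optionally be overlined. A $k$-regular overpartition of $n$ is an overpartition of $n$ in which no part is divisible by $k$; $\overline{p}_k(n)$ counts them. *)

(* Defs.v *)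
From mathcomp Require Import all_boot all_order all_algebra.

Set Implicit Arguments.
Unset Strict Implicit.
Unset Printing Implicit Defensive.

(* An overpartition is written as the nonincreasing sequence of its parts, each
   paired with a flag telling whether that occurrence is overlined; only the
   first occurrence of a part may be flagged. *)
Definition is_overpartition (n : nat) (s : seq (nat * bool)) : bool :=
  [&& all (fun x => 0 < x.1) s,
      sorted geq [seq x.1 | x <- s],
      pairwise (fun x y => (x.1 == y.1) ==> ~~ y.2) s
    & sumn [seq x.1 | x <- s] == n].

Definition is_regular_overpartition (k n : nat) (s : seq (nat * bool)) : bool :=
  is_overpartition n s && all (fun x => ~~ (k %| x.1)) s.

Definition bounded_parts (n : nat) (t : n.-bseq ('I_n.+1 * bool)) :
  seq (nat * bool) := [seq (x.1 : nat, x.2) | x : 'I_n.+1 * bool <- t].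

(* An overpartition of n has at most n parts, all at most n, so the finite type
   n.-bseq ('I_n.+1 * bool) represents all of them, each exactly once
   (bounded_parts_inj and bounded_parts_surj). *)
Definition regular_overpartitions (k n : nat) :
  {set n.-bseq ('I_n.+1 * bool)} :=
  [set t | is_regular_overpartition k n (bounded_parts t)].

Definition pbar (k n : nat) : nat := #|regular_overpartitions k n|.

Lemma bounded_parts_inj (n : nat) : injective (@bounded_parts n).
Proof.
move=> t u /inj_map eq_tu; apply/val_inj/eq_tu => -[i b] [j c] [ij ->].
by congr pair; apply: val_inj.
Qed.

Lemma bounded_parts_surj (n : nat) (s : seq (nat * bool)) :
  is_overpartition n s -> exists t : n.-bseq ('I_n.+1 * bool),
    bounded_parts t = s.
Proof.
case/and4P=> s_gt0 _ _ /eqP sum_s.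
have le_size : size s <= n.
  rewrite -sum_s; elim: s s_gt0 {sum_s} => //= x s IHs /andP[x_gt0 /IHs].
  by rewrite -[(size s).+1]add1n; apply: leq_add.
have s_lt : all (fun x => x.1 < n.+1) s.
  rewrite -sum_s; elim: s {s_gt0 sum_s le_size} => //= x s IHs.
  rewrite ltnS leq_addr /=; apply: sub_all IHs => y.
  by rewrite !ltnS => /leq_trans; apply; apply: leq_addl.
have size_t : size [seq (inord x.1 : 'I_n.+1, x.2) | x <- s] <= n.
  by rewrite size_map.
exists (Bseq size_t); rewrite /bounded_parts /= -map_comp.
rewrite -[RHS]map_id; apply/eq_in_map => -[i b] /(allP s_lt) /= lt_i.
by rewrite inordK.
Qed.

(* Only the values at 2 <= k <= 9 are meaningful. *)
Definition Nbar (k : nat) : nat :=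
  match k with
  | 2 => 75
  | 3 => 17
  | 4 => 33
  | 5 => 30
  | 6 => 10
  | 7 => 24
  | 8 => 27
  | 9 => 10
  | _ => 0
  end.

(* Main.v *)
(** The claim says that [p(n) / p(n-1)] is convex at [n], which by AM-GM follows from positivity
    of the third difference of [ln p].

    Large [n].  Write [f(q) = sum p(n) q^n = prod_(k does not divide m) (1 + q^m) / (1 - q^m)].
    Since [ln ((1 + x) / (1 - x)) = 2 sum_(j odd) x^j / j], [ln f(e^-t)] is a sum over odd [j] of
    [(coth (j t / 2) - coth (j k t / 2)) / j]; inserting the partial fractions of [coth] and
    exchanging the sums gives [ln f(e^-t) = A / t + c + O(exp (- const * Re (1 / t)))], uniformly
    for [t] near [0].  The Lipschitz summation formula shows that the Bessel-type numbers
    [b(n) = sum_j A^(j+1) n^j / (j! (j+1)!)] have generating function [exp (A / t) + O(1)].  Hence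
    [e^-c p(n) - b(n)] is exponentially smaller than [b(n)], by Cauchy's estimate on the circle
    [Re t = sqrt (A / n)], where away from the real axis [f] itself is small.  The logarithmic
    derivative [u] of [b] solves the Riccati equation [x u' + x u^2 + 2 u = A]; a subsolution
    yields [u > sqrt (A / x) - 3 / (4 x)], and then [u'' >= const * x^(-5/2)], which beats the
    error term for [n >= 1601].

    Small [n].  By Gauss's identity [prod (1 - q^m) / (1 + q^m) = 1 + 2 sum_(j >= 1) (-1)^j q^(j^2)],
    whose right-hand side at [q^k] is [f(q)] times its value at [q]; this recurrence computes
    [p(n)] fast enough to test all [n <= 1600]. *)

From Stdlib Require Import ZArith NArith List Arith Factorial Reals Lra Lia Psatz.
From Coquelicot Require Import Coquelicot.
Local Open Scope R_scope.

(** * Complex series *)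

(** The delicate point is accuracy: the third difference of [ln p] is only of order n^(-5/2), so an
    asymptotic expansion of p in powers of n^(-1/2) would have to be carried several terms far. A
    comparison sequence that is exponentially close to p and solves a differential equation avoids
    this: convexity becomes a question about the Riccati equation, and the error may be estimated
    crudely. Integrals and modular transformation formulas do not occur. Averages over N-th roots of
    unity replace the Cauchy integral and also produce the partial fractions of coth; the Lipschitz
    formula comes from a comparison of Taylor coefficients.

    The analytic part uses k <= 9 because the correction exp (- 2 pi^2 Re (1/t) / k) has to outweigh
    most of the main term exp (A Re (1/t)), where A = (pi^2 / 4) (1 - 1/k). All errors are measured
    by one rate: they stay below the main term by a factor of order exp (- 0.83 sqrt n), and from n
    = 1600 = 40^2 on this beats the powers of n that it meets. *)

Lemma Cmod_le_eps_eq (x y : C) :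
  (forall eps, 0 < eps -> Cmod (x - y) <= eps) -> x = y.
Proof.
intros H.
assert (E : Cmod (x - y) = 0).
{ apply Rle_antisym; [|apply Cmod_ge_0]. apply le_epsilon. intros eps He.
  rewrite Rplus_0_l. now apply H. }
apply Cmod_eq_0 in E. replace x with (x - y + y)%C by ring. rewrite E. ring.
Qed.

Fixpoint rsum (a : nat -> R) (N : nat) : R :=
  match N with O => 0 | S n => rsum a n + a n end.

Fixpoint csum (a : nat -> C) (N : nat) : C :=
  match N with O => 0%C | S n => (csum a n + a n)%C end.

Definition Csum (a : nat -> C) : C :=
  (Series (fun n => Re (a n)), Series (fun n => Im (a n))).

Definition summable (a : nat -> C) : Prop := ex_series (fun n => Cmod (a n)).

Definition Clim (u : nat -> C) (l : C) : Prop :=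
  forall eps, 0 < eps -> exists N0, forall N, (N0 <= N)%nat -> Cmod (u N - l) <= eps.

Lemma rsum_S_n a N : rsum a (S N) = sum_n a N.
Proof.
induction N as [|N IH].
- simpl. rewrite sum_O. ring.
- rewrite sum_Sn. rewrite <- IH. reflexivity.
Qed.

Lemma rsum_ext a b N : (forall n, (n < N)%nat -> a n = b n) -> rsum a N = rsum b N.
Proof.
induction N as [|N IH]; simpl; intros H; [reflexivity|].
rewrite IH by (intros; apply H; lia). rewrite H by lia. reflexivity.
Qed.

Lemma rsum_le a b N : (forall n, (n < N)%nat -> a n <= b n) -> rsum a N <= rsum b N.
Proof.
induction N as [|N IH]; simpl; intros H; [lra|].
apply Rplus_le_compat; [apply IH; intros; apply H; lia|apply H; lia].
Qed.

Lemma rsum_nonneg a N : (forall n, 0 <= a n) -> 0 <= rsum a N.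
Proof.
intros H; induction N as [|N IH]; simpl; [lra|]. specialize (H N); lra.
Qed.

Lemma rsum_plus a b N : rsum (fun n => a n + b n) N = rsum a N + rsum b N.
Proof. induction N as [|N IH]; simpl; [ring|rewrite IH; ring]. Qed.

Lemma rsum_scal c a N : rsum (fun n => c * a n) N = c * rsum a N.
Proof. induction N as [|N IH]; simpl; [ring|rewrite IH; ring]. Qed.

Lemma rsum_const c N : rsum (fun _ => c) N = INR N * c.
Proof. induction N as [|N IH]; [simpl; ring|]. rewrite S_INR. simpl. rewrite IH. ring. Qed.

Lemma rsum_split a N M : rsum a (N + M) = rsum a N + rsum (fun n => a (N + n)%nat) M.
Proof.
induction M as [|M IH]; simpl.
- rewrite Nat.add_0_r. ring.
- rewrite Nat.add_succ_r. simpl. rewrite IH. ring.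
Qed.

Lemma rsum_le_mono a N M :
  (forall n, 0 <= a n) -> (N <= M)%nat -> rsum a N <= rsum a M.
Proof.
intros H L. replace M with (N + (M - N))%nat by lia. rewrite rsum_split.
assert (0 <= rsum (fun n => a (N + n)%nat) (M - N)) by (apply rsum_nonneg; auto). lra.
Qed.

Lemma Series_rsum (a : nat -> R) N : ex_series a ->
  Series a = rsum a N + Series (fun n => a (N + n)%nat).
Proof.
intros H. destruct N as [|N].
- simpl. rewrite Rplus_0_l. reflexivity.
- rewrite (Series_incr_n a (S N)) by (auto; lia). simpl pred.
  f_equal. rewrite <- sum_n_Reals. now rewrite rsum_S_n.
Qed.

Lemma ex_series_tail (a : nat -> R) N : ex_series a -> ex_series (fun n => a (N + n)%nat).
Proof. intros H. now apply ex_series_incr_n. Qed.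

Lemma Series_nonneg (a : nat -> R) : (forall n, 0 <= a n) -> ex_series a -> 0 <= Series a.
Proof.
intros H E. replace 0 with (Series (fun n => 0)).
- apply Series_le; auto. intros n; split; [lra|auto].
- transitivity (0 * Series a); [|ring]. rewrite <- Series_scal_l. apply Series_ext; intros; ring.
Qed.

Lemma rsum_le_Series (a : nat -> R) N : (forall n, 0 <= a n) -> ex_series a -> rsum a N <= Series a.
Proof.
intros H E. rewrite (Series_rsum a N E).
assert (0 <= Series (fun n => a (N + n)%nat)).
{ apply Series_nonneg; auto. now apply ex_series_tail. }
lra.
Qed.

Lemma rsum_lim (a : nat -> R) : ex_series a -> is_lim_seq (rsum a) (Series a).
Proof.
intros E. apply is_lim_seq_incr_1.
apply is_lim_seq_ext with (sum_n a).
- intros n. now rewrite <- rsum_S_n.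
- apply Series_correct in E. exact E.
Qed.

Lemma tail_small (a : nat -> R) eps : ex_series a -> 0 < eps ->
  exists N0, forall N, (N0 <= N)%nat -> Rabs (Series (fun n => a (N + n)%nat)) <= eps.
Proof.
intros E He. pose proof (rsum_lim a E) as L.
apply is_lim_seq_spec in L. destruct (L (mkposreal eps He)) as [N0 H].
exists N0. intros N HN. specialize (H N HN). simpl in H.
rewrite (Series_rsum a N E) in H.
replace (rsum a N - (rsum a N + Series (fun n => a (N + n)%nat)))
  with (- Series (fun n => a (N + n)%nat)) in H by ring.
rewrite Rabs_Ropp in H. lra.
Qed.

Lemma Series_le_bound (a : nat -> R) M : (forall n, 0 <= a n) -> (forall N, rsum a N <= M) ->
  ex_series a /\ Series a <= M.
Proof.
intros H B.
assert (E : ex_series a).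
{ assert (F : ex_finite_lim_seq (rsum a)).
  { apply ex_finite_lim_seq_incr with M; auto. intros n. simpl. specialize (H n). lra. }
  destruct F as [l F]. exists l.
  apply is_lim_seq_incr_1 in F. unfold is_series.
  change (is_lim_seq (sum_n a) l).
  apply is_lim_seq_ext with (2 := F). intros n; now rewrite <- rsum_S_n. }
split; [exact E|].
apply (is_lim_seq_le (rsum a) (fun _ => M) (Series a) M); auto.
- now apply rsum_lim.
- apply is_lim_seq_const.
Qed.

Lemma ex_series_le_R (a b : nat -> R) : (forall n, 0 <= a n <= b n) -> ex_series b -> ex_series a.
Proof.
intros H E. apply (Series_le_bound a (Series b)).
- intros n; apply H.
- intros N. apply Rle_trans with (rsum b N).
  + apply rsum_le. intros; apply H.
  + apply rsum_le_Series; auto. intros n. specialize (H n). lra.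
Qed.

Lemma csum_ext a b N : (forall n, (n < N)%nat -> a n = b n) -> csum a N = csum b N.
Proof.
induction N as [|N IH]; simpl; intros H; [reflexivity|].
rewrite IH by (intros; apply H; lia). rewrite H by lia. reflexivity.
Qed.

Lemma csum_plus a b N : csum (fun n => (a n + b n)%C) N = (csum a N + csum b N)%C.
Proof. induction N as [|N IH]; simpl; [ring|rewrite IH; ring]. Qed.

Lemma csum_scal c a N : csum (fun n => (c * a n)%C) N = (c * csum a N)%C.
Proof. induction N as [|N IH]; simpl; [ring|rewrite IH; ring]. Qed.

Lemma csum_split a N M :
  csum a (N + M) = (csum a N + csum (fun n => a (N + n)%nat) M)%C.
Proof.
induction M as [|M IH]; simpl.
- rewrite Nat.add_0_r. ring.
- rewrite Nat.add_succ_r. simpl. rewrite IH. ring.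
Qed.

Lemma csum_Cmod a N : Cmod (csum a N) <= rsum (fun n => Cmod (a n)) N.
Proof.
induction N as [|N IH]; simpl.
- rewrite Cmod_0. lra.
- eapply Rle_trans; [apply Cmod_triangle|lra].
Qed.

Lemma csum_Re a N : Re (csum a N) = rsum (fun n => Re (a n)) N.
Proof. induction N as [|N IH]; simpl; [reflexivity|]. now rewrite <- IH. Qed.

Lemma csum_Im a N : Im (csum a N) = rsum (fun n => Im (a n)) N.
Proof. induction N as [|N IH]; simpl; [reflexivity|]. now rewrite <- IH. Qed.

Lemma Rabs_Re_le (z : C) : Rabs (Re z) <= Cmod z.
Proof. apply re_le_Cmod. Qed.

Lemma Rabs_Im_le (z : C) : Rabs (Im z) <= Cmod z.
Proof.
destruct z as [x y]. unfold Cmod, Im; simpl.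
rewrite <- (sqrt_Rsqr_abs y). apply sqrt_le_1_alt. unfold Rsqr. nra.
Qed.

Lemma summable_Re a : summable a -> ex_series (fun n => Re (a n)).
Proof.
intros H. apply (ex_series_le (V := R_CompleteNormedModule) (fun n => Re (a n)) _ (fun n => Rabs_Re_le (a n)) H).
Qed.

Lemma summable_Im a : summable a -> ex_series (fun n => Im (a n)).
Proof.
intros H. apply (ex_series_le (V := R_CompleteNormedModule) (fun n => Im (a n)) _ (fun n => Rabs_Im_le (a n)) H).
Qed.

Lemma summable_le a b : (forall n, Cmod (a n) <= b n) -> ex_series b -> summable a.
Proof.
intros H E. apply ex_series_le_R with b; auto. intros n; split; [apply Cmod_ge_0|auto].
Qed.

Lemma C_ext (x y : C) : Re x = Re y -> Im x = Im y -> x = y.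
Proof. destruct x, y; simpl; intros -> ->; reflexivity. Qed.

Lemma Csum_ext a b : (forall n, a n = b n) -> Csum a = Csum b.
Proof.
intros H. unfold Csum. f_equal; apply Series_ext; intros n; now rewrite H.
Qed.

Lemma summable_ext a b : (forall n, a n = b n) -> summable a -> summable b.
Proof. intros H. apply ex_series_ext. intros n; now rewrite H. Qed.

Lemma summable_plus a b : summable a -> summable b -> summable (fun n => (a n + b n)%C).
Proof.
intros Ha Hb. apply summable_le with (fun n => Cmod (a n) + Cmod (b n)).
- intros; apply Cmod_triangle.
- now apply (ex_series_plus (V := R_NormedModule)).
Qed.

Lemma summable_scal c a : summable a -> summable (fun n => (c * a n)%C).
Proof.
intros Ha. unfold summable. apply ex_series_ext with (fun n => Cmod c * Cmod (a n)).
- intros; now rewrite Cmod_mult.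
- now apply (ex_series_scal_l (V := R_NormedModule)).
Qed.

Lemma summable_tail a N : summable a -> summable (fun n => a (N + n)%nat).
Proof. intros H. unfold summable. now apply (ex_series_tail (fun n => Cmod (a n))). Qed.

Lemma Csum_plus a b : summable a -> summable b ->
  Csum (fun n => (a n + b n)%C) = (Csum a + Csum b)%C.
Proof.
intros Ha Hb. unfold Csum, Cplus; simpl. f_equal.
- apply Series_plus; now apply summable_Re.
- apply Series_plus; now apply summable_Im.
Qed.

Lemma Csum_scal c a : summable a -> Csum (fun n => (c * a n)%C) = (c * Csum a)%C.
Proof.
intros Ha. destruct c as [x y]. unfold Csum, Cmult; simpl. f_equal.
- rewrite Series_minus.
  + now rewrite !Series_scal_l.
  + apply (ex_series_scal_l (V := R_NormedModule)). now apply summable_Re.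
  + apply (ex_series_scal_l (V := R_NormedModule)). now apply summable_Im.
- rewrite Series_plus.
  + now rewrite !Series_scal_l.
  + apply (ex_series_scal_l (V := R_NormedModule)). now apply summable_Im.
  + apply (ex_series_scal_l (V := R_NormedModule)). now apply summable_Re.
Qed.

Lemma Csum_csum a N : summable a ->
  Csum a = (csum a N + Csum (fun n => a (N + n)%nat))%C.
Proof.
intros Ha. apply C_ext.
- change (Series (fun n => Re (a n)) = Re (csum a N) + Series (fun n => Re (a (N + n)%nat))).
  rewrite csum_Re. apply (Series_rsum (fun n => Re (a n))). now apply summable_Re.
- change (Series (fun n => Im (a n)) = Im (csum a N) + Series (fun n => Im (a (N + n)%nat))).
  rewrite csum_Im. apply (Series_rsum (fun n => Im (a n))). now apply summable_Im.
Qed.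

(** The modulus is the supremum of the linear forms [u * Re z + v * Im z] over the unit disc;
    bounding each of them reduces the triangle inequality for complex series to real series. *)
Lemma Cmod_le_proj (z : C) M :
  (forall u v, u * u + v * v <= 1 -> u * Re z + v * Im z <= M) -> Cmod z <= M.
Proof.
intros H. destruct (Req_dec (Cmod z) 0) as [E|E].
- rewrite E. specialize (H 0 0). lra.
- assert (P : 0 < Cmod z) by (pose proof (Cmod_ge_0 z); lra).
  assert (S := Cmod2_alt z).
  specialize (H (Re z / Cmod z) (Im z / Cmod z)).
  apply Rle_trans with (Re z / Cmod z * Re z + Im z / Cmod z * Im z).
  + right. replace (Re z / Cmod z * Re z + Im z / Cmod z * Im z)
      with ((Re z ^ 2 + Im z ^ 2) / Cmod z) by (field; lra).
    rewrite <- S. field; lra.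
  + apply H. right.
    replace (Re z / Cmod z * (Re z / Cmod z) + Im z / Cmod z * (Im z / Cmod z))
      with ((Re z ^ 2 + Im z ^ 2) / Cmod z ^ 2) by (field; lra).
    rewrite <- S. field; lra.
Qed.

Lemma proj_le_Cmod (z : C) u v : u * u + v * v <= 1 -> u * Re z + v * Im z <= Cmod z.
Proof.
intros H. pose proof (Cmod_ge_0 z) as P. assert (S := Cmod2_alt z).
destruct (Rle_or_lt (u * Re z + v * Im z) 0) as [L|L]; [lra|].
apply Rsqr_incr_0_var; [|exact P]. unfold Rsqr.
replace (Cmod z * Cmod z) with (Cmod z ^ 2) by ring. rewrite S.
set (x := Re z) in *; set (y := Im z) in *.
assert (0 <= (u * y - v * x) ^ 2) by apply pow2_ge_0.
assert ((u * x + v * y) * (u * x + v * y) =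
  (u * u + v * v) * (x ^ 2 + y ^ 2) - (u * y - v * x) ^ 2) as -> by ring.
assert (0 <= x ^ 2 + y ^ 2) by nra. nra.
Qed.

Lemma Csum_Cmod_le a b : (forall n, Cmod (a n) <= b n) -> ex_series b ->
  Cmod (Csum a) <= Series b.
Proof.
intros H E. assert (Sa : summable a) by (now apply summable_le with b).
apply Cmod_le_proj. intros u v Huv. simpl.
rewrite <- !Series_scal_l. rewrite <- Series_plus.
- apply Rle_trans with (Series (fun n => Cmod (a n))).
  2:{ apply Series_le; auto. intros n; split; [apply Cmod_ge_0|auto]. }
  assert (Ex : ex_series (fun n => u * Re (a n) + v * Im (a n))).
  { apply (ex_series_plus (V := R_NormedModule)); apply (ex_series_scal_l (V := R_NormedModule)).
    - now apply summable_Re.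
    - now apply summable_Im. }
  apply (is_lim_seq_le (rsum (fun n => u * Re (a n) + v * Im (a n)))
     (rsum (fun n => Cmod (a n))) (Series (fun n => u * Re (a n) + v * Im (a n))) (Series (fun n => Cmod (a n)))).
  + intros N. apply rsum_le. intros; now apply proj_le_Cmod.
  + now apply rsum_lim.
  + now apply rsum_lim.
- apply (ex_series_scal_l (V := R_NormedModule)). now apply summable_Re.
- apply (ex_series_scal_l (V := R_NormedModule)). now apply summable_Im.
Qed.

Lemma Csum_tail_le a b N : (forall n, Cmod (a n) <= b n) -> ex_series b ->
  Cmod (Csum a - csum a N) <= Series (fun n => b (N + n)%nat).
Proof.
intros H E. rewrite (Csum_csum a N).
- replace (csum a N + Csum (fun n => a (N + n)%nat) - csum a N)%C
    with (Csum (fun n => a (N + n)%nat)) by ring.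
  apply Csum_Cmod_le; auto. now apply ex_series_tail.
- now apply summable_le with b.
Qed.

Lemma Clim_csum a : summable a -> Clim (csum a) (Csum a).
Proof.
intros H eps He. destruct (tail_small _ eps H He) as [N0 HN].
exists N0. intros N L. specialize (HN N L).
replace (csum a N - Csum a)%C with (- (Csum a - csum a N))%C by ring.
rewrite Cmod_opp.
eapply Rle_trans; [apply (Csum_tail_le a (fun n => Cmod (a n)) N)|]; auto.
- intros; lra.
- eapply Rle_trans; [apply Rle_abs|]; auto.
Qed.

Lemma Clim_unique u l1 l2 : Clim u l1 -> Clim u l2 -> l1 = l2.
Proof.
intros H1 H2. apply Cmod_le_eps_eq. intros eps He.
destruct (H1 (eps / 2)) as [N1 K1]; [lra|].
destruct (H2 (eps / 2)) as [N2 K2]; [lra|].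
set (N := max N1 N2).
specialize (K1 N ltac:(lia)). specialize (K2 N ltac:(lia)).
replace (l1 - l2)%C with (- (u N - l1) + (u N - l2))%C by ring.
eapply Rle_trans; [apply Cmod_triangle|]. rewrite Cmod_opp. lra.
Qed.

Lemma Clim_ext u v l : (forall n, u n = v n) -> Clim u l -> Clim v l.
Proof. intros H L eps He. destruct (L eps He) as [N0 K]. exists N0. intros. rewrite <- H. auto. Qed.

Lemma Clim_ext_ev N1 u v l : (forall n, (N1 <= n)%nat -> u n = v n) -> Clim u l -> Clim v l.
Proof.
intros H L eps He. destruct (L eps He) as [N0 K]. exists (max N0 N1). intros.
rewrite <- H by lia. apply K; lia.
Qed.

Lemma Clim_const c : Clim (fun _ => c) c.
Proof.
intros eps He. exists O. intros. replace (c - c)%C with (RtoC 0) by ring. rewrite Cmod_0. lra.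
Qed.

Lemma Clim_plus u v lu lv : Clim u lu -> Clim v lv -> Clim (fun n => (u n + v n)%C) (lu + lv)%C.
Proof.
intros Hu Hv eps He.
destruct (Hu (eps / 2)) as [N1 K1]; [lra|].
destruct (Hv (eps / 2)) as [N2 K2]; [lra|].
exists (max N1 N2). intros N L. specialize (K1 N ltac:(lia)). specialize (K2 N ltac:(lia)).
replace (u N + v N - (lu + lv))%C with ((u N - lu) + (v N - lv))%C by ring.
eapply Rle_trans; [apply Cmod_triangle|]. lra.
Qed.

Lemma Clim_scal c u l : Clim u l -> Clim (fun n => (c * u n)%C) (c * l)%C.
Proof.
intros H eps He. pose proof (Cmod_ge_0 c) as P.
destruct (H (eps / (Cmod c + 1))) as [N1 K1].
{ apply Rdiv_lt_0_compat; lra. }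
exists N1. intros N L. specialize (K1 N L).
replace (c * u N - c * l)%C with (c * (u N - l))%C by ring. rewrite Cmod_mult.
apply Rle_trans with ((Cmod c + 1) * (eps / (Cmod c + 1))).
- apply Rmult_le_compat; auto; try lra. apply Cmod_ge_0.
- right. field. lra.
Qed.

Lemma Clim_0_squeeze (u : nat -> C) (l : C) (e : nat -> R) :
  (forall n, Cmod (u n - l) <= e n) -> is_lim_seq e 0 -> Clim u l.
Proof.
intros H L eps He. apply is_lim_seq_spec in L. destruct (L (mkposreal eps He)) as [N0 K].
exists N0. intros N HN. specialize (K N HN). simpl in K.
eapply Rle_trans; [apply H|]. eapply Rle_trans; [apply Rle_abs|].
replace (e N) with (e N - 0) by ring. lra.
Qed.

Lemma Clim_bounded (u : nat -> C) (l : C) : Clim u l -> exists N0, forall N, (N0 <= N)%nat -> Cmod (u N) <= Cmod l + 1.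
Proof.
intros H. destruct (H 1) as [N0 K]; [lra|]. exists N0. intros N L. specialize (K N L).
replace (u N) with ((u N - l) + l)%C by ring. eapply Rle_trans; [apply Cmod_triangle|]. lra.
Qed.

Lemma Clim_mult u v lu lv : Clim u lu -> Clim v lv -> Clim (fun n => (u n * v n)%C) (lu * lv)%C.
Proof.
intros Hu Hv eps He.
destruct (Clim_bounded u lu Hu) as [N0 K0].
pose proof (Cmod_ge_0 lu) as P1. pose proof (Cmod_ge_0 lv) as P2.
destruct (Hu (eps / (2 * (Cmod lv + 1)))) as [N1 K1].
{ apply Rdiv_lt_0_compat; lra. }
destruct (Hv (eps / (2 * (Cmod lu + 1)))) as [N2 K2].
{ apply Rdiv_lt_0_compat; lra. }
exists (max N0 (max N1 N2)). intros N L.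
specialize (K0 N ltac:(lia)). specialize (K1 N ltac:(lia)). specialize (K2 N ltac:(lia)).
replace (u N * v N - lu * lv)%C with (u N * (v N - lv) + lv * (u N - lu))%C by ring.
eapply Rle_trans; [apply Cmod_triangle|]. rewrite !Cmod_mult.
assert (Cmod (u N) * Cmod (v N - lv) <= (Cmod lu + 1) * (eps / (2 * (Cmod lu + 1)))).
{ apply Rmult_le_compat; auto; apply Cmod_ge_0. }
assert (Cmod lv * Cmod (u N - lu) <= (Cmod lv + 1) * (eps / (2 * (Cmod lv + 1)))).
{ apply Rmult_le_compat; auto; try apply Cmod_ge_0; lra. }
replace ((Cmod lu + 1) * (eps / (2 * (Cmod lu + 1)))) with (eps / 2) in * by (field; lra).
replace ((Cmod lv + 1) * (eps / (2 * (Cmod lv + 1)))) with (eps / 2) in * by (field; lra).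
lra.
Qed.

Lemma Cmod_triangle_inv (x y : C) : Cmod x - Cmod y <= Cmod (x + y).
Proof.
pose proof (Cmod_triangle (x + y) (- y)) as H.
replace (x + y + - y)%C with x in H by ring. rewrite Cmod_opp in H. lra.
Qed.

Lemma Clim_inv (u : nat -> C) (l : C) : l <> 0%C -> Clim u l -> Clim (fun n => (/ u n)%C) (/ l)%C.
Proof.
intros Hl Hu eps He.
assert (P : 0 < Cmod l) by (apply Cmod_gt_0; exact Hl).
destruct (Hu (Cmod l / 2)) as [N0 K0]; [lra|].
destruct (Hu (eps * (Cmod l * (Cmod l / 2)))) as [N1 K1].
{ repeat apply Rmult_lt_0_compat; lra. }
exists (max N0 N1). intros N L. specialize (K0 N ltac:(lia)). specialize (K1 N ltac:(lia)).
assert (Q : Cmod l / 2 <= Cmod (u N)).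
{ pose proof (Cmod_triangle_inv l (u N - l)) as T.
  replace (l + (u N - l))%C with (u N) in T by ring. lra. }
assert (U : u N <> 0%C). { apply Cmod_gt_0. lra. }
replace (/ u N - / l)%C with (- (u N - l) / (l * u N))%C by (field; auto).
rewrite Cmod_div by (apply Cmult_neq_0; auto). rewrite Cmod_opp, Cmod_mult.
apply Rle_div_l; [apply Rmult_lt_0_compat; lra|].
eapply Rle_trans; [apply K1|]. apply Rmult_le_compat_l; [lra|].
apply Rmult_le_compat_l; lra.
Qed.

Lemma Clim_csum_fin (a : nat -> nat -> C) (l : nat -> C) M :
  (forall m, (m < M)%nat -> Clim (fun N => a N m) (l m)) ->
  Clim (fun N => csum (a N) M) (csum l M).
Proof.
induction M as [|M IH]; simpl; intros H.
- apply Clim_const.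
- apply Clim_plus; auto.
Qed.

(* Tannery's theorem; domination is only required of the terms of index [>= L0]. *)
Lemma tannery (a : nat -> nat -> C) (l : nat -> C) (b : nat -> R) (L0 N1 : nat) :
  (forall N, (N1 <= N)%nat -> summable (a N)) -> summable l ->
  (forall m, Clim (fun N => a N m) (l m)) ->
  (forall N m, (N1 <= N)%nat -> (L0 <= m)%nat -> Cmod (a N m) <= b m) ->
  ex_series b ->
  Clim (fun N => Csum (a N)) (Csum l).
Proof.
intros Ha Hl Hlim Hdom Hb eps He.
destruct (tail_small _ (eps / 3) Hb) as [M1 HM1]; [lra|].
destruct (tail_small _ (eps / 3) Hl) as [M2 HM2]; [lra|].
set (M := max L0 (max M1 M2)).
specialize (HM1 M ltac:(lia)). specialize (HM2 M ltac:(lia)).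
destruct (Clim_csum_fin a l M (fun m _ => Hlim m) (eps / 3)) as [N2 K]; [lra|].
exists (max N1 N2). intros N L. specialize (K N ltac:(lia)).
rewrite (Csum_csum (a N) M) by (apply Ha; lia). rewrite (Csum_csum l M) by auto.
set (x := csum (a N) M) in *. set (y := csum l M) in *.
assert (T1 : Cmod (Csum (fun n => a N (M + n)%nat)) <= eps / 3).
{ eapply Rle_trans; [apply (Csum_Cmod_le _ (fun n => b (M + n)%nat))|].
  - intros n. apply Hdom; lia.
  - now apply ex_series_tail.
  - eapply Rle_trans; [apply Rle_abs|]; auto. }
assert (T2 : Cmod (Csum (fun n => l (M + n)%nat)) <= eps / 3).
{ eapply Rle_trans; [apply (Csum_Cmod_le _ (fun n => Cmod (l (M + n)%nat)))|].
  - intros n. lra.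
  - now apply (ex_series_tail (fun n => Cmod (l n))).
  - eapply Rle_trans; [apply Rle_abs|]; auto. }
match goal with |- Cmod (x + ?p - (y + ?q)) <= _ =>
  replace (x + p - (y + q))%C with ((x - y) + (p - q))%C by ring;
  eapply Rle_trans; [apply Cmod_triangle|];
  assert (Cmod (p - q) <= Cmod p + Cmod q) by
   (unfold Cminus; eapply Rle_trans; [apply Cmod_triangle|rewrite Cmod_opp; lra])
end.
lra.
Qed.

Lemma csum_switch (a : nat -> nat -> C) N M :
  csum (fun i => csum (a i) M) N = csum (fun j => csum (fun i => a i j) N) M.
Proof.
induction N as [|N IH]; simpl.
- induction M as [|M IHM]; simpl; [reflexivity|]. rewrite <- IHM. ring.
- rewrite IH, <- csum_plus. reflexivity.
Qed.

(** * Exchange of double sums *)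

Section Exchange.

Variables (a : nat -> nat -> C) (al be : nat -> R).

Hypothesis dom : forall i j, Cmod (a i j) <= al i * be j.

Hypothesis al0 : forall i, 0 <= al i.

Hypothesis be0 : forall i, 0 <= be i.

Hypothesis sal : ex_series al.

Hypothesis sbe : ex_series be.

Lemma row_bound i : Cmod (Csum (a i)) <= al i * Series be.
Proof.
rewrite <- Series_scal_l. apply Csum_Cmod_le; auto.
now apply (ex_series_scal_l (V := R_NormedModule)).
Qed.

Lemma rows_summable : summable (fun i => Csum (a i)).
Proof.
apply summable_le with (fun i => al i * Series be).
- apply row_bound.
- apply ex_series_scal_r; exact sal.
Qed.

(** The rows beyond N form the tail of a convergent series, and the part cut off row i is at most
    [al i] times a tail of [be]. Square partial sums favour neither index, which is what the
    exchange of the two sums rests on. *)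
Lemma Clim_square : Clim (fun N => csum (fun i => csum (a i) N) N) (Csum (fun i => Csum (a i))).
Proof.
intros eps He.
assert (Pal : 0 <= Series al) by (apply Series_nonneg; auto).
destruct (Clim_csum _ rows_summable (eps / 2)) as [N0 K0]; [lra|].
destruct (tail_small be (eps / (2 * (Series al + 1))) sbe) as [N1 K1].
{ apply Rdiv_lt_0_compat; lra. }
exists (max N0 N1). intros N L. specialize (K0 N ltac:(lia)). specialize (K1 N ltac:(lia)).
set (S := Csum (fun i => Csum (a i))) in *.
replace (csum (fun i => csum (a i) N) N - S)%C with
 ((csum (fun i => csum (a i) N) N + (- (1)) * csum (fun i => Csum (a i)) N)
   + (csum (fun i => Csum (a i)) N - S))%C by ring.
rewrite <- csum_scal, <- csum_plus.
eapply Rle_trans; [apply Cmod_triangle|].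
assert (B : Cmod (csum (fun n => (csum (a n) N + - (1) * Csum (a n))%C) N)
   <= Series al * (eps / (2 * (Series al + 1)))).
{ eapply Rle_trans; [apply csum_Cmod|].
  apply Rle_trans with (rsum (fun n => (eps / (2 * (Series al + 1))) * al n) N).
  - apply rsum_le. intros n _.
    replace (csum (a n) N + - (1) * Csum (a n))%C with (- (Csum (a n) - csum (a n) N))%C by ring.
    rewrite Cmod_opp.
    eapply Rle_trans; [apply (Csum_tail_le _ (fun j => al n * be j))|].
    + auto.
    + now apply (ex_series_scal_l (V := R_NormedModule)).
    + rewrite Series_scal_l. rewrite Rmult_comm. apply Rmult_le_compat_r; auto.
      eapply Rle_trans; [apply Rle_abs|]; auto.
  - rewrite rsum_scal. rewrite Rmult_comm. apply Rmult_le_compat_r.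
    + apply Rlt_le, Rdiv_lt_0_compat; lra.
    + now apply rsum_le_Series. }
assert (Series al * (eps / (2 * (Series al + 1))) <= eps / 2).
{ apply Rle_trans with ((Series al + 1) * (eps / (2 * (Series al + 1)))).
  - apply Rmult_le_compat_r; [|lra]. apply Rlt_le, Rdiv_lt_0_compat; lra.
  - right; field; lra. }
lra.
Qed.

End Exchange.

Lemma Csum_exchange (a : nat -> nat -> C) (al be : nat -> R) :
  (forall i j, Cmod (a i j) <= al i * be j) ->
  (forall i, 0 <= al i) -> (forall i, 0 <= be i) ->
  ex_series al -> ex_series be ->
  Csum (fun i => Csum (a i)) = Csum (fun j => Csum (fun i => a i j)).
Proof.
intros dom al0 be0 sal sbe.
apply Clim_unique with (fun N => csum (fun i => csum (a i) N) N).
- now apply Clim_square with al be.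
- apply Clim_ext with (fun N => csum (fun j => csum (fun i => a i j) N) N).
  + intros N. symmetry; apply csum_switch.
  + apply (Clim_square (fun j i => a i j) be al); auto.
    intros; rewrite Rmult_comm; auto.
Qed.

Lemma Clim_subseq (u : nat -> C) (l : C) (phi : nat -> nat) : (forall n, (n <= phi n)%nat) -> Clim u l ->
  Clim (fun n => u (phi n)) l.
Proof.
intros H L eps He. destruct (L eps He) as [N0 K]. exists N0. intros N HN. apply K.
specialize (H N). lia.
Qed.

Lemma csum_blocks a k N : csum a (k * N) = csum (fun m => csum (fun i => a (k * m + i)%nat) k) N.
Proof.
induction N as [|N IH].
- rewrite Nat.mul_0_r. reflexivity.
- rewrite Nat.mul_succ_r, csum_split, IH. reflexivity.
Qed.

Lemma rsum_blocks a k N : rsum a (k * N) = rsum (fun m => rsum (fun i => a (k * m + i)%nat) k) N.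
Proof.
induction N as [|N IH].
- rewrite Nat.mul_0_r. reflexivity.
- rewrite Nat.mul_succ_r, rsum_split, IH. reflexivity.
Qed.

Lemma summable_blocks a k : (0 < k)%nat -> summable a ->
  summable (fun m => csum (fun i => a (k * m + i)%nat) k).
Proof.
intros Hk Ha.
apply (Series_le_bound _ (Series (fun n => Cmod (a n)))).
- intros; apply Cmod_ge_0.
- intros N. apply Rle_trans with (rsum (fun n => Cmod (a n)) (k * N)).
  + rewrite rsum_blocks. apply rsum_le. intros n _. apply csum_Cmod.
  + apply rsum_le_Series; auto. intros; apply Cmod_ge_0.
Qed.

Lemma Csum_blocks a k : (0 < k)%nat -> summable a ->
  Csum a = Csum (fun m => csum (fun i => a (k * m + i)%nat) k).
Proof.
intros Hk Ha. apply Clim_unique with (fun N => csum a (k * N)).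
- apply (Clim_subseq (csum a) _ (fun N => (k * N)%nat)); [intros; nia|]. now apply Clim_csum.
- apply Clim_ext with (csum (fun m => csum (fun i => a (k * m + i)%nat) k)).
  + intros N. symmetry; apply csum_blocks.
  + apply Clim_csum. now apply summable_blocks.
Qed.

Lemma ex_series_subseq (a : nat -> R) (phi : nat -> nat) : (forall n, 0 <= a n) ->
  (forall n, (phi n < phi (S n))%nat) -> ex_series a -> ex_series (fun n => a (phi n)).
Proof.
intros H Hphi E. apply (Series_le_bound _ (Series a)); [auto|].
intros N. apply Rle_trans with (rsum a (phi N)).
- induction N as [|N IH]; simpl; [now apply rsum_nonneg|].
  apply Rle_trans with (rsum a (S (phi N))).
  + simpl. lra.
  + apply rsum_le_mono; [auto|apply Hphi].
- now apply rsum_le_Series.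
Qed.

Lemma summable_subseq a (phi : nat -> nat) :
  (forall n, (phi n < phi (S n))%nat) -> summable a -> summable (fun n => a (phi n)).
Proof.
intros Hphi E. apply (ex_series_subseq (fun n => Cmod (a n))); auto. intros; apply Cmod_ge_0.
Qed.

Lemma Csum_even_odd a : summable a ->
  Csum a = (Csum (fun n => a (2 * n)%nat) + Csum (fun n => a (2 * n + 1)%nat))%C.
Proof.
intros Ha. rewrite (Csum_blocks a 2) by (auto; lia).
rewrite <- Csum_plus.
- apply Csum_ext. intros n. unfold csum. rewrite Nat.add_0_r. ring.
- apply (summable_subseq a (fun n => 2 * n)%nat); auto. intros; lia.
- apply (summable_subseq a (fun n => 2 * n + 1)%nat); auto. intros; lia.
Qed.

Lemma Csum_incr_1 a : summable a -> Csum a = (a O + Csum (fun n => a (S n)))%C.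
Proof. intros H. rewrite (Csum_csum a 1 H). simpl csum. f_equal. ring. Qed.

Lemma Csum_opp a : Csum (fun n => (- a n)%C) = (- Csum a)%C.
Proof. unfold Csum, Copp; simpl. f_equal; apply Series_opp. Qed.

Lemma summable_opp a : summable a -> summable (fun n => (- a n)%C).
Proof. apply ex_series_ext. intros; now rewrite Cmod_opp. Qed.

Lemma Csum_minus a b : summable a -> summable b ->
  Csum (fun n => (a n - b n)%C) = (Csum a - Csum b)%C.
Proof.
intros Ha Hb. unfold Cminus. rewrite <- Csum_opp. apply Csum_plus; auto. now apply summable_opp.
Qed.

Lemma summable_minus a b : summable a -> summable b -> summable (fun n => (a n - b n)%C).
Proof. intros Ha Hb. apply summable_plus; auto. now apply summable_opp. Qed.

Lemma Csum_RtoC a : Csum (fun n => RtoC (a n)) = RtoC (Series a).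
Proof.
unfold Csum, RtoC; simpl. f_equal.
transitivity (0 * Series a); [|ring]. rewrite <- Series_scal_l. apply Series_ext; intros; simpl; ring.
Qed.

Lemma csum_geom (z : C) N : z <> RtoC 1 -> csum (fun n => z ^ n)%C N = ((1 - z ^ N) / (1 - z))%C.
Proof.
intros Hz. assert (1 - z <> 0)%C.
{ intros E. apply Hz. replace z with (1 - (1 - z))%C by ring. rewrite E. ring. }
induction N as [|N IH]; simpl.
- field; auto.
- rewrite IH. field; auto.
Qed.

Lemma summable_geom (z : C) : Cmod z < 1 -> summable (fun n => z ^ n)%C.
Proof.
intros H. unfold summable. apply ex_series_ext with (fun n => Cmod z ^ n).
- intros; now rewrite Cmod_pow.
- apply ex_series_geom. rewrite Rabs_pos_eq; auto. apply Cmod_ge_0.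
Qed.

Lemma Csum_geom (z : C) : Cmod z < 1 -> Csum (fun n => z ^ n)%C = (/ (1 - z))%C.
Proof.
intros H.
assert (N1 : (1 - z <> 0)%C).
{ intros E. replace z with (1 - (1 - z))%C in H by ring. rewrite E in H.
  replace (1 - 0)%C with (RtoC 1) in H by ring. rewrite Cmod_1 in H. lra. }
assert (G := summable_geom z H).
pose proof (Csum_incr_1 _ G) as E. cbv beta in E.
assert (E2 : Csum (fun n => z ^ S n)%C = (z * Csum (fun n => z ^ n))%C).
{ rewrite <- Csum_scal by auto. apply Csum_ext. intros; reflexivity. }
rewrite E2 in E. simpl Cpow in E. set (x := Csum (fun n => z ^ n)%C) in *.
assert (x * (1 - z) = 1)%C.
{ replace (x * (1 - z))%C with (x - z * x)%C by ring. rewrite E at 1. ring. }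
replace x with (x * (1 - z) / (1 - z))%C by (field; auto). rewrite H0. field; auto.
Qed.

(** * The complex exponential and the logarithm series *)

Definition Cexp (z : C) : C := (exp (Re z) * cos (Im z), exp (Re z) * sin (Im z)).

Lemma Cexp_plus (z w : C) : Cexp (z + w)%C = (Cexp z * Cexp w)%C.
Proof.
destruct z as [a b], w as [c d]. unfold Cexp, Cmult; simpl.
rewrite exp_plus, cos_plus, sin_plus. f_equal; ring.
Qed.

Lemma Cexp_RtoC x : Cexp (RtoC x) = RtoC (exp x).
Proof. unfold Cexp, RtoC; simpl. rewrite cos_0, sin_0. f_equal; ring. Qed.

Lemma Cexp_0 : Cexp 0%C = 1%C.
Proof. rewrite Cexp_RtoC, exp_0. reflexivity. Qed.

Lemma Cmod_Cexp z : Cmod (Cexp z) = exp (Re z).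
Proof.
destruct z as [a b]. unfold Cexp, Cmod; simpl.
replace (exp a * cos b * (exp a * cos b * 1) + exp a * sin b * (exp a * sin b * 1))
  with (exp a * exp a * (Rsqr (sin b) + Rsqr (cos b))) by (unfold Rsqr; ring).
rewrite sin2_cos2, Rmult_1_r. apply sqrt_square. apply Rlt_le, exp_pos.
Qed.

Lemma Cexp_neq_0 z : Cexp z <> RtoC 0.
Proof. apply Cmod_gt_0. rewrite Cmod_Cexp. apply exp_pos. Qed.

Lemma Cexp_opp z : Cexp (- z)%C = (/ Cexp z)%C.
Proof.
assert (E : (Cexp z * Cexp (- z) = 1)%C).
{ rewrite <- Cexp_plus. replace (z + - z)%C with (RtoC 0) by ring. apply Cexp_0. }
pose proof (Cexp_neq_0 z).
replace (Cexp (- z)) with (Cexp z * Cexp (- z) / Cexp z)%C by (field; auto).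
rewrite E. field; auto.
Qed.

Lemma Cexp_INR z n : Cexp (RtoC (INR n) * z)%C = (Cexp z ^ n)%C.
Proof.
induction n as [|n IH].
- simpl. replace (0 * z)%C with (RtoC 0) by ring. apply Cexp_0.
- rewrite S_INR, RtoC_plus. replace ((INR n + 1) * z)%C with (z + INR n * z)%C by ring.
  rewrite Cexp_plus, IH. reflexivity.
Qed.

(** * Complex functions of a real variable and their derivatives *)

Definition Cder (f : R -> C) (s : R) (l : C) : Prop :=
  is_derive (fun x => Re (f x)) s (Re l) /\ is_derive (fun x => Im (f x)) s (Im l).

Lemma Cder_const c s : Cder (fun _ => c) s 0%C.
Proof. split; simpl; apply is_derive_Reals, derivable_pt_lim_const. Qed.

Lemma Cder_ext f g s l : (forall x, f x = g x) -> Cder f s l -> Cder g s l.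
Proof.
intros H [H1 H2]. split; [apply is_derive_ext with (2 := H1)|apply is_derive_ext with (2 := H2)];
  intros; now rewrite H.
Qed.

Lemma Cder_plus f g s l m : Cder f s l -> Cder g s m -> Cder (fun x => (f x + g x)%C) s (l + m)%C.
Proof.
intros [H1 H2] [K1 K2]. split; simpl.
- apply (is_derive_plus (fun x => Re (f x)) (fun x => Re (g x))); auto.
- apply (is_derive_plus (fun x => Im (f x)) (fun x => Im (g x))); auto.
Qed.

Lemma is_derive_mult_R (f g : R -> R) s a b : is_derive f s a -> is_derive g s b ->
  is_derive (fun x => f x * g x) s (a * g s + f s * b).
Proof. intros H K. apply (is_derive_mult f g s a b H K). intros; apply Rmult_comm. Qed.

Lemma is_derive_comp_R (f g : R -> R) s a b : is_derive f (g s) a -> is_derive g s b ->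
  is_derive (fun x => f (g x)) s (b * a).
Proof. intros H K. apply (is_derive_comp f g s a b H K). Qed.

Lemma is_derive_eq (f : R -> R) s a b : is_derive f s a -> a = b -> is_derive f s b.
Proof. intros H <-; exact H. Qed.

Lemma Cder_mult f g s l m : Cder f s l -> Cder g s m ->
  Cder (fun x => (f x * g x)%C) s (l * g s + f s * m)%C.
Proof.
intros [H1 H2] [K1 K2]. split.
- eapply is_derive_eq.
  + apply (is_derive_minus (fun x => Re (f x) * Re (g x)) (fun x => Im (f x) * Im (g x)));
      apply is_derive_mult_R; eassumption.
  + unfold minus, plus, opp, Re, Im; simpl. ring.
- eapply is_derive_eq.
  + apply (is_derive_plus (fun x => Re (f x) * Im (g x)) (fun x => Im (f x) * Re (g x)));
      apply is_derive_mult_R; eassumption.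
  + unfold plus, Re, Im; simpl. ring.
Qed.

Lemma Cder_exp f s l : Cder f s l -> Cder (fun x => Cexp (f x)) s (l * Cexp (f s))%C.
Proof.
intros [H1 H2].
assert (He := is_derive_comp_R exp _ s _ _ (is_derive_exp _) H1).
assert (Hc := is_derive_comp_R cos _ s _ _ (is_derive_cos _) H2).
assert (Hs := is_derive_comp_R sin _ s _ _ (is_derive_sin _) H2).
split.
- eapply is_derive_eq.
  + apply (is_derive_mult_R _ _ _ _ _ He Hc).
  + unfold Re, Im; simpl; unfold Re, Im; ring.
- eapply is_derive_eq.
  + apply (is_derive_mult_R _ _ _ _ _ He Hs).
  + unfold Re, Im; simpl; unfold Re, Im; ring.
Qed.

Lemma Cder_linear z s : Cder (fun x => (RtoC x * z)%C) s z.
Proof.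
destruct z as [a b]. split.
- change (is_derive (fun x => x * a - 0 * b) s a). auto_derive; [auto|ring].
- change (is_derive (fun x => x * b + 0 * a) s b). auto_derive; [auto|ring].
Qed.

Lemma Cder_zero_const f : (forall s, 0 <= s <= 1 -> Cder f s 0%C) -> f 1 = f 0.
Proof.
intros H. apply C_ext; symmetry.
- apply (eq_is_derive (fun x => Re (f x)) 0 1); [|lra]. intros t Ht. apply (H t Ht).
- apply (eq_is_derive (fun x => Im (f x)) 0 1); [|lra]. intros t Ht. apply (H t Ht).
Qed.

Lemma CV_radius_ge (a : nat -> R) (r M : R) :
  (forall n, Rabs (a n * r ^ n) <= M) -> Rbar_le r (CV_radius a).
Proof. intros H. apply (proj1 (CV_radius_bounded a)). now exists M. Qed.

Lemma Csum_PSeries (a : nat -> C) x :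
  Csum (fun n => (RtoC (x ^ n) * a n)%C) = (PSeries (fun n => Re (a n)) x, PSeries (fun n => Im (a n)) x).
Proof.
unfold Csum, PSeries. f_equal; apply Series_ext; intros n; simpl; unfold Re, Im; ring.
Qed.

Lemma CV_radius_gt (a : nat -> R) (r M s : R) :
  Rabs s < r -> (forall n, Rabs (a n) * r ^ n <= M) -> Rbar_lt (Rabs s) (CV_radius a).
Proof.
intros Hs H. apply Rbar_lt_le_trans with r; [exact Hs|]. apply CV_radius_ge with M.
intros n. rewrite Rabs_mult, <- RPow_abs, (Rabs_pos_eq r); auto.
pose proof (Rabs_pos s); lra.
Qed.

Lemma Re_scal_l x (z : C) : Re (RtoC x * z)%C = x * Re z.
Proof. unfold Re; simpl. ring. Qed.

Lemma Im_scal_l x (z : C) : Im (RtoC x * z)%C = x * Im z.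
Proof. unfold Im; simpl. ring. Qed.

(** Boundedness of [Cmod (a n) * r ^ n] places [s] strictly inside the interval of convergence of
    the real and of the imaginary part, where termwise differentiation is allowed. *)
Lemma Cder_power_series (a : nat -> C) (r M s : R) :
  Rabs s < r -> (forall n, Cmod (a n) * r ^ n <= M) ->
  Cder (fun x => Csum (fun n => (RtoC (x ^ n) * a n)%C)) s
    (Csum (fun n => (RtoC (s ^ n) * (INR (S n) * a (S n)))%C)).
Proof.
intros Hs H.
assert (Hr : 0 <= r) by (pose proof (Rabs_pos s); lra).
assert (E : Csum (fun n => (RtoC (s ^ n) * (INR (S n) * a (S n)))%C) =
   (PSeries (PS_derive (fun n => Re (a n))) s, PSeries (PS_derive (fun n => Im (a n))) s)).
{ rewrite Csum_PSeries. unfold PS_derive. f_equal; apply PSeries_ext; intros n;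
   [apply Re_scal_l|apply Im_scal_l]. }
rewrite E.
apply Cder_ext with (fun x => (PSeries (fun n => Re (a n)) x, PSeries (fun n => Im (a n)) x)).
{ intros x. now rewrite Csum_PSeries. }
split; simpl.
- apply is_derive_PSeries. apply CV_radius_gt with r M; auto.
  intros n. eapply Rle_trans; [|apply (H n)]. apply Rmult_le_compat_r; [now apply pow_le|apply Rabs_Re_le].
- apply is_derive_PSeries. apply CV_radius_gt with r M; auto.
  intros n. eapply Rle_trans; [|apply (H n)]. apply Rmult_le_compat_r; [now apply pow_le|apply Rabs_Im_le].
Qed.

Lemma exp_series x : is_series (fun n => x ^ n / INR (fact n)) (exp x).
Proof.
pose proof (is_exp_Reals x) as H. unfold is_pseries in H.
apply is_series_ext with (2 := H). intros n.
unfold scal; simpl. unfold mult; simpl. rewrite pow_n_pow. unfold Rdiv. ring.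
Qed.

Lemma exp_Series x : Series (fun n => x ^ n / INR (fact n)) = exp x.
Proof. apply is_series_unique, exp_series. Qed.

Lemma ex_series_exp x : ex_series (fun n => x ^ n / INR (fact n)).
Proof. exists (exp x). apply exp_series. Qed.

Lemma pow_div_fact_pos x n : 0 <= x -> 0 <= x ^ n / INR (fact n).
Proof. intros H. apply Rdiv_le_0_compat; [now apply pow_le|apply INR_fact_lt_0]. Qed.

Lemma pow_div_fact_le x n : 0 <= x -> x ^ n / INR (fact n) <= exp x.
Proof.
intros Hx. rewrite <- exp_Series.
pose proof (rsum_le_Series (fun n => x ^ n / INR (fact n)) (S n)
  (fun m => pow_div_fact_pos x m Hx) (ex_series_exp x)) as H.
simpl rsum in H.
assert (0 <= rsum (fun n => x ^ n / INR (fact n)) n).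
{ apply rsum_nonneg. intros; now apply pow_div_fact_pos. }
lra.
Qed.

Lemma Cmod_pow_div_fact (z : C) n : Cmod (z ^ n / RtoC (INR (fact n)))%C = Cmod z ^ n / INR (fact n).
Proof.
assert (P : 0 < INR (fact n)) by apply INR_fact_lt_0.
rewrite Cmod_div.
- rewrite Cmod_pow, Cmod_R, Rabs_pos_eq; auto; lra.
- intros E. apply RtoC_inj in E. lra.
Qed.

Lemma RtoC_INR_neq_0 n : (0 < n)%nat -> RtoC (INR n) <> RtoC 0.
Proof. intros H E. apply RtoC_inj in E. apply lt_INR in H. simpl in H. lra. Qed.

Lemma summable_Cexp (z : C) : summable (fun n => z ^ n / RtoC (INR (fact n)))%C.
Proof.
unfold summable. apply ex_series_ext with (fun n => Cmod z ^ n / INR (fact n)).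
- intros; now rewrite Cmod_pow_div_fact.
- apply ex_series_exp.
Qed.

(** As a function of x, [Cexp (- x z)] times the series at [x z] has derivative 0 on [0, 1], so it
    keeps the value 1 that it has at x = 0. *)
Lemma Cexp_series (z : C) : Csum (fun n => z ^ n / RtoC (INR (fact n)))%C = Cexp z.
Proof.
set (a := fun n => (z ^ n / RtoC (INR (fact n)))%C).
set (g := fun x => Csum (fun n => (RtoC (x ^ n) * a n)%C)).
assert (Hg : forall s, 0 <= s <= 1 -> Cder g s (z * g s)%C).
{ intros s Hs. replace (z * g s)%C with (Csum (fun n => (RtoC (s ^ n) * (INR (S n) * a (S n)))%C)).
  - apply (Cder_power_series a 2 (exp (Cmod z * 2))).
    + rewrite Rabs_pos_eq; lra.
    + intros n. unfold a. rewrite Cmod_pow_div_fact.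
      replace (Cmod z ^ n / INR (fact n) * 2 ^ n) with ((Cmod z * 2) ^ n / INR (fact n))
       by (rewrite Rpow_mult_distr; unfold Rdiv; ring).
      apply pow_div_fact_le. pose proof (Cmod_ge_0 z); lra.
  - unfold g. rewrite <- Csum_scal.
    + apply Csum_ext. intros n. unfold a. rewrite fact_simpl, mult_INR, RtoC_mult, Cpow_S.
      field. split; apply RtoC_INR_neq_0; try lia. apply lt_O_fact.
    + apply summable_le with (fun n => Cmod z ^ n / INR (fact n)); [|apply ex_series_exp].
      intros n. rewrite Cmod_mult. unfold a. rewrite Cmod_pow_div_fact, Cmod_R.
      rewrite <- (Rmult_1_l (Cmod z ^ n / INR (fact n))) at 2.
      apply Rmult_le_compat_r; [apply pow_div_fact_pos, Cmod_ge_0|].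
      rewrite <- RPow_abs, Rabs_pos_eq by lra. rewrite <- (pow1 n). apply pow_incr; lra. }
set (h := fun x => (Cexp (RtoC x * - z) * g x)%C).
assert (K : h 1 = h 0).
{ apply Cder_zero_const. intros s Hs.
  replace (RtoC 0) with ((- z * Cexp (RtoC s * - z)) * g s + Cexp (RtoC s * - z) * (z * g s))%C by ring.
  apply Cder_mult; auto. apply (Cder_exp (fun x => (RtoC x * - z)%C)). apply Cder_linear. }
assert (G0 : g 0 = 1%C).
{ unfold g. rewrite Csum_incr_1.
  - rewrite (Csum_ext _ (fun n => (0 * a (1 + n)%nat)%C)).
    + rewrite Csum_scal by (apply (summable_tail a 1), summable_Cexp).
      unfold a at 1. simpl. field.
    + intros n. simpl pow. rewrite Rmult_0_l. reflexivity.
  - apply summable_ext with (fun n => (RtoC (0 ^ n) * a n)%C); [auto|].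
    apply summable_le with (fun n => Cmod z ^ n / INR (fact n)); [|apply ex_series_exp].
    intros n. rewrite Cmod_mult. unfold a. rewrite Cmod_pow_div_fact, Cmod_R.
    rewrite <- (Rmult_1_l (Cmod z ^ n / INR (fact n))) at 2.
    apply Rmult_le_compat_r; [apply pow_div_fact_pos, Cmod_ge_0|].
    rewrite <- RPow_abs, Rabs_R0. rewrite <- (pow1 n). apply pow_incr; lra. }
unfold h in K. rewrite G0 in K.
replace (RtoC 1 * - z)%C with (- z)%C in K by ring.
replace (RtoC 0 * - z)%C with (RtoC 0) in K by ring.
rewrite Cexp_0, Cexp_opp in K.
replace (Csum a) with (g 1).
- pose proof (Cexp_neq_0 z). replace (g 1) with (Cexp z * (/ Cexp z * g 1))%C by (field; auto).
  rewrite K. ring.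
- unfold g. apply Csum_ext. intros n. rewrite pow1. ring.
Qed.

Lemma Cexp_series_tail1 (z : C) :
  (Cexp z - 1)%C = Csum (fun n => z ^ S n / RtoC (INR (fact (S n))))%C.
Proof.
rewrite <- Cexp_series, Csum_incr_1 by apply summable_Cexp.
replace (z ^ 0 / RtoC (INR (fact 0)))%C with (RtoC 1) by (simpl; field). ring.
Qed.

Lemma Cexp_series_tail2 (z : C) :
  (Cexp z - 1 - z)%C = Csum (fun n => z ^ S (S n) / RtoC (INR (fact (S (S n)))))%C.
Proof.
rewrite Cexp_series_tail1, Csum_incr_1
 by apply (summable_tail (fun n => z ^ n / RtoC (INR (fact n)))%C 1), summable_Cexp.
replace (z ^ 1 / RtoC (INR (fact 1)))%C with z by (simpl; field). ring.
Qed.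

Lemma fact_le_S n : (fact n <= fact (S n))%nat.
Proof. simpl. lia. Qed.

Lemma Cexp_minus_1_bound (z : C) : Cmod (Cexp z - 1) <= Cmod z * exp (Cmod z).
Proof.
rewrite Cexp_series_tail1, <- exp_Series, <- Series_scal_l.
apply Csum_Cmod_le.
- intros n. rewrite Cmod_pow_div_fact. unfold Rdiv. simpl pow. rewrite Rmult_assoc.
  apply Rmult_le_compat_l; [apply Cmod_ge_0|]. apply Rmult_le_compat_l; [apply pow_le, Cmod_ge_0|].
  apply Rinv_le_contravar; [apply INR_fact_lt_0|]. apply le_INR, fact_le_S.
- apply (ex_series_scal_l (V := R_NormedModule)). apply ex_series_exp.
Qed.

Lemma Cexp_minus_1_z_bound (z : C) : Cmod (Cexp z - 1 - z) <= Cmod z * Cmod z * exp (Cmod z).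
Proof.
rewrite Cexp_series_tail2, <- exp_Series, <- Series_scal_l.
apply Csum_Cmod_le.
- intros n. rewrite Cmod_pow_div_fact. unfold Rdiv. simpl pow. rewrite !Rmult_assoc.
  apply Rmult_le_compat_l; [apply Cmod_ge_0|].
  apply Rmult_le_compat_l; [apply Cmod_ge_0|]. apply Rmult_le_compat_l; [apply pow_le, Cmod_ge_0|].
  apply Rinv_le_contravar; [apply INR_fact_lt_0|]. apply le_INR.
  apply Nat.le_trans with (fact (S n)); apply fact_le_S.
- apply (ex_series_scal_l (V := R_NormedModule)). apply ex_series_exp.
Qed.

Definition log_term (z : C) (n : nat) : C :=
  match n with O => 0%C | S _ => (z ^ n / RtoC (INR n))%C end.

Lemma Cmod_log_term z n : Cmod (log_term z n) <= Cmod z ^ n.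
Proof.
destruct n as [|n]; unfold log_term.
- rewrite Cmod_0. simpl. lra.
- rewrite Cmod_div by (apply RtoC_INR_neq_0; lia). rewrite Cmod_pow, Cmod_R.
  assert (1 <= INR (S n)) by (rewrite S_INR; pose proof (pos_INR n); lra).
  rewrite Rabs_pos_eq by lra. apply Rle_div_l; [lra|].
  rewrite <- (Rmult_1_r (Cmod z ^ S n)) at 1.
  apply Rmult_le_compat_l; auto. apply pow_le, Cmod_ge_0.
Qed.

Lemma summable_log_term z : Cmod z < 1 -> summable (log_term z).
Proof.
intros H. apply summable_le with (fun n => Cmod z ^ n); [apply Cmod_log_term|].
apply ex_series_geom. rewrite Rabs_pos_eq; auto. apply Cmod_ge_0.
Qed.

Lemma C1_minus_neq_0 (w : C) : Cmod w < 1 -> (1 - w <> 0)%C.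
Proof.
intros H E. replace w with (1 - (1 - w))%C in H by ring. rewrite E in H.
replace (1 - 0)%C with (RtoC 1) in H by ring. rewrite Cmod_1 in H. lra.
Qed.

(* [x |-> (1 - x z) exp (sum (x z)^n / n)] has zero derivative. *)
Lemma Cexp_log_series (z : C) : Cmod z < 1 -> ((1 - z) * Cexp (Csum (log_term z)) = 1)%C.
Proof.
intros Hz. pose proof (Cmod_ge_0 z) as Pz.
set (g := fun x => Csum (fun n => (RtoC (x ^ n) * log_term z n)%C)).
(* A radius above 1 with [Cmod z * r <= 1], so that termwise differentiation is valid on all of
   [0, 1]. *)
set (r := 2 / (1 + Cmod z)).
assert (Hr : 1 < r).
{ unfold r. apply Rlt_div_r; lra. }
assert (Hrz : Cmod z * r <= 1).
{ unfold r. replace (Cmod z * (2 / (1 + Cmod z))) with (2 * Cmod z / (1 + Cmod z)) by (field; lra).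
  apply Rle_div_l; lra. }
assert (Hsz : forall s, 0 <= s <= 1 -> Cmod (RtoC s * z) < 1).
{ intros s Hs. rewrite Cmod_mult, Cmod_R, Rabs_pos_eq by lra.
  apply Rle_lt_trans with (Cmod z); auto. rewrite <- (Rmult_1_l (Cmod z)) at 2.
  apply Rmult_le_compat_r; lra. }
assert (Hg : forall s, 0 <= s <= 1 -> Cder g s (z / (1 - RtoC s * z))%C).
{ intros s Hs.
  replace (z / (1 - RtoC s * z))%C with (Csum (fun n => (RtoC (s ^ n) * (INR (S n) * log_term z (S n)))%C)).
  - apply (Cder_power_series (log_term z) r 1).
    + rewrite Rabs_pos_eq; lra.
    + intros n. apply Rle_trans with (Cmod z ^ n * r ^ n).
      * apply Rmult_le_compat_r; [apply pow_le; lra|apply Cmod_log_term].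
      * rewrite <- Rpow_mult_distr. rewrite <- (pow1 n). apply pow_incr. split; auto. nra.
  - unfold Cdiv. rewrite <- Csum_geom by auto. rewrite <- Csum_scal by (apply summable_geom; auto).
    apply Csum_ext. intros n. rewrite Cpow_mult_l, RtoC_pow. unfold log_term. rewrite Cpow_S.
    field. apply RtoC_INR_neq_0; lia. }
set (h := fun x => ((1 + RtoC x * - z) * Cexp (g x))%C).
assert (K : h 1 = h 0).
{ apply Cder_zero_const. intros s Hs.
  pose proof (C1_minus_neq_0 _ (Hsz s Hs)) as NZ.
  replace (RtoC 0) with ((0 + - z) * Cexp (g s) + (1 + RtoC s * - z) * (z / (1 - RtoC s * z) * Cexp (g s)))%C
   by (field; auto).
  apply (Cder_mult (fun x => (1 + RtoC x * - z)%C) (fun x => Cexp (g x))).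
  - apply Cder_plus; [apply Cder_const|apply Cder_linear].
  - apply Cder_exp; auto. }
assert (G0 : g 0 = 0%C).
{ unfold g. rewrite (Csum_ext _ (fun n => (0 * log_term z n)%C)).
  - rewrite Csum_scal by now apply summable_log_term. ring.
  - intros n. destruct n; simpl; [ring|]. rewrite Rmult_0_l. reflexivity. }
unfold h in K. rewrite G0, Cexp_0 in K.
replace (Csum (log_term z)) with (g 1).
- transitivity ((1 + 1 * - z) * Cexp (g 1))%C; [ring|]. rewrite K. ring.
- unfold g. apply Csum_ext. intros n. rewrite pow1. ring.
Qed.

Definition odd_term (z : C) (i : nat) : C := (RtoC (2 / INR (2 * i + 1)) * z ^ (2 * i + 1))%C.

Lemma Cmod_odd_term z i : Cmod (odd_term z i) <= 2 * Cmod z ^ (2 * i + 1).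
Proof.
unfold odd_term. rewrite Cmod_mult, Cmod_pow, Cmod_R.
assert (1 <= INR (2 * i + 1)) by (rewrite plus_INR; simpl INR at 2; pose proof (pos_INR (2 * i)); lra).
assert (0 < 2 / INR (2 * i + 1)) by (apply Rdiv_lt_0_compat; lra).
rewrite Rabs_pos_eq by lra. apply Rmult_le_compat_r; [apply pow_le, Cmod_ge_0|].
apply Rle_div_l; lra.
Qed.

Lemma summable_odd_term z : Cmod z < 1 -> summable (odd_term z).
Proof.
intros H. apply summable_le with (fun i => 2 * Cmod z ^ (2 * i + 1)); [apply Cmod_odd_term|].
apply (ex_series_scal_l (V := R_NormedModule)).
apply (ex_series_subseq (fun n => Cmod z ^ n) (fun i => 2 * i + 1)%nat).
- intros; apply pow_le, Cmod_ge_0.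
- intros; lia.
- apply ex_series_geom. rewrite Rabs_pos_eq; auto. apply Cmod_ge_0.
Qed.

(** The exponent is the difference of the logarithm series at [z] and at [- z], in which the even
    powers cancel. Only exponentials of logarithms occur, so no branch has to be chosen. *)
Lemma artanh_series (z : C) : Cmod z < 1 ->
  ((1 + z) / (1 - z) = Cexp (Csum (odd_term z)))%C.
Proof.
intros Hz. assert (Hz' : Cmod (- z) < 1) by now rewrite Cmod_opp.
pose proof (Cexp_log_series z Hz) as E1. pose proof (Cexp_log_series (- z) Hz') as E2.
assert (E : Csum (odd_term z) = (Csum (log_term z) - Csum (log_term (- z)))%C).
{ rewrite <- Csum_minus by now apply summable_log_term.
  assert (S0 : summable (fun n => (log_term z n - log_term (- z) n)%C))
    by (apply summable_minus; now apply summable_log_term).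
  rewrite (Csum_even_odd _ S0).
  rewrite (Csum_ext (fun n => (log_term z (2 * n) - log_term (- z) (2 * n))%C) (fun n => (0 * odd_term z n)%C)).
  - rewrite Csum_scal by now apply summable_odd_term.
    rewrite Cmult_0_l, Cplus_0_l. apply Csum_ext. intros n.
    replace (2 * n + 1)%nat with (S (2 * n)) by lia. unfold log_term, odd_term.
    replace (2 * n + 1)%nat with (S (2 * n)) by lia.
    replace (- z)%C with (- (1) * z)%C by ring.
    rewrite (Cpow_mult_l (- (1))%C), !Cpow_S. rewrite (Cpow_mult_r (- (1))%C).
    replace ((- (1)) ^ 2)%C with (RtoC 1) by (simpl; ring). rewrite Cpow_1_l.
    rewrite RtoC_div.
    + field. apply RtoC_INR_neq_0; lia.
    + apply not_0_INR; lia.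
  - intros n. destruct n as [|n]; [simpl; ring|].
    replace (2 * S n)%nat with (S (S (2 * n))) by lia. unfold log_term.
    replace (S (S (2 * n))) with (2 * S n)%nat by lia.
    rewrite !Cpow_mult_r. replace ((- z) ^ 2)%C with (z ^ 2)%C by (simpl; ring).
    unfold Cdiv. ring. }
rewrite E. unfold Cminus. rewrite Cexp_plus, Cexp_opp.
pose proof (C1_minus_neq_0 z Hz) as N1. pose proof (C1_minus_neq_0 (- z) Hz') as N2.
assert (F1 : Cexp (Csum (log_term z)) = (/ (1 - z))%C).
{ transitivity ((1 - z) * Cexp (Csum (log_term z)) * / (1 - z))%C; [field; auto|rewrite E1; ring]. }
assert (F2 : Cexp (Csum (log_term (- z))) = (/ (1 - - z))%C).
{ transitivity ((1 - - z) * Cexp (Csum (log_term (- z))) * / (1 - - z))%C; [field; auto|rewrite E2; ring]. }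
rewrite F1, F2. field. auto.
Qed.

(** * Partial fractions of coth and tanh *)

Lemma rsum_inv_sq N : rsum (fun n => / (INR n + 1) ^ 2) N <= 2 - 2 / (INR N + 1).
Proof.
induction N as [|N IH]; [simpl; lra|]. rewrite S_INR. simpl rsum.
pose proof (pos_INR N) as P.
apply Rle_trans with (2 - 2 / (INR N + 1) + / (INR N + 1) ^ 2); [now apply Rplus_le_compat_r|].
apply Rminus_le.
replace (2 - 2 / (INR N + 1) + / (INR N + 1) ^ 2 - (2 - 2 / (INR N + 1 + 1)))
 with (- (INR N / ((INR N + 1) ^ 2 * (INR N + 2)))) by (field; lra).
assert (0 <= INR N / ((INR N + 1) ^ 2 * (INR N + 2))); [|lra].
apply Rdiv_le_0_compat; auto. apply Rmult_lt_0_compat; [apply pow_lt; lra|lra].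
Qed.

Lemma inv_sq_series : ex_series (fun n => / (INR n + 1) ^ 2) /\
  Series (fun n => / (INR n + 1) ^ 2) <= 2.
Proof.
apply Series_le_bound.
- intros n. pose proof (pos_INR n). apply Rlt_le, Rinv_0_lt_compat, pow_lt. lra.
- intros N. eapply Rle_trans; [apply rsum_inv_sq|]. pose proof (pos_INR N).
  assert (0 < 2 / (INR N + 1)) by (apply Rdiv_lt_0_compat; lra). lra.
Qed.

Lemma summable_le_ev (a : nat -> C) (b : nat -> R) N0 :
  (forall n, (N0 <= n)%nat -> Cmod (a n) <= b n) -> ex_series b -> summable a.
Proof.
intros H E. unfold summable. apply (ex_series_incr_n _ N0).
apply ex_series_le_R with (fun n => b (N0 + n)%nat).
- intros n; split; [apply Cmod_ge_0|apply H; lia].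
- now apply ex_series_tail.
Qed.

Lemma Csum_finite (a : nat -> C) N : (forall n, (N <= n)%nat -> a n = 0%C) ->
  summable a /\ Csum a = csum a N.
Proof.
intros H. assert (S : summable a).
(* Any convergent positive majorant serves here, since the terms from [N] on vanish. *)
{ apply summable_le_ev with (fun n => / (INR n + 1) ^ 2) N; [|apply inv_sq_series].
  intros n Hn. rewrite H, Cmod_0 by auto. pose proof (pos_INR n).
  apply Rlt_le, Rinv_0_lt_compat, pow_lt. lra. }
split; auto.
apply Clim_unique with (csum a).
- now apply Clim_csum.
- apply (Clim_ext_ev N (fun _ => csum a N)); [|apply Clim_const].
  intros n Hn. replace n with (N + (n - N))%nat by lia. rewrite csum_split.
  generalize (n - N)%nat as M. intros M. induction M as [|M IH]; simpl; [ring|].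
  rewrite H by lia. rewrite IH at 1. ring.
Qed.

(** Jordan's inequality, by concavity: were the graph below the chord at x, the mean slopes on the
    two sides of x would contradict the decrease of cosine. *)
Lemma sin_ge_linear x : 0 <= x <= PI / 2 -> 2 / PI * x <= sin x.
Proof.
intros [H1 H2]. pose proof PI_RGT_0 as HP.
destruct (Req_dec x 0) as [E0|E0]; [subst; rewrite sin_0; lra|].
destruct (Req_dec x (PI / 2)) as [E1|E1].
{ subst. rewrite sin_PI2. right; field; lra. }
apply Rnot_lt_le. intros L.
destruct (MVT_gen sin 0 x cos) as [c1 [Hc1 K1]].
{ intros; apply is_derive_sin. }
{ intros y _. apply continuity_pt_filterlim, (ex_derive_continuous sin). eexists; apply is_derive_sin. }
destruct (MVT_gen sin x (PI / 2) cos) as [c2 [Hc2 K2]].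
{ intros; apply is_derive_sin. }
{ intros y _. apply continuity_pt_filterlim, (ex_derive_continuous sin). eexists; apply is_derive_sin. }
rewrite Rmin_left, Rmax_right in Hc1 by lra. rewrite Rmin_left, Rmax_right in Hc2 by lra.
rewrite sin_0 in K1. rewrite sin_PI2 in K2.
assert (C21 : cos c2 <= cos c1) by (apply cos_decr_1; lra).
assert (A1 : cos c1 * x < 2 / PI * x) by lra.
assert (A2 : cos c2 * (PI / 2 - x) > 1 - 2 / PI * x) by lra.
assert (1 - 2 / PI * x = 2 / PI * (PI / 2 - x)) as E by (field; lra). rewrite E in A2.
assert (cos c1 < 2 / PI) by (apply Rmult_lt_reg_r with x; lra).
assert (cos c2 > 2 / PI) by (apply Rmult_lt_reg_r with (PI / 2 - x); lra).
lra.
Qed.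

Definition imc (y : R) : C := (0, y).

Definition rootu (N : nat) : C := Cexp (0, 2 * PI / INR N).

Lemma rootu_pow N l : (rootu N ^ l)%C = Cexp (0, 2 * PI * INR l / INR N).
Proof.
unfold rootu. rewrite <- Cexp_INR. f_equal. unfold RtoC, Cmult; simpl. f_equal; unfold Rdiv; ring.
Qed.

Lemma Cexp_2PI : Cexp (0, 2 * PI) = 1%C.
Proof. unfold Cexp; simpl. rewrite cos_2PI, sin_2PI, exp_0. unfold RtoC. f_equal; ring. Qed.

Lemma rootu_pow_N N : (0 < N)%nat -> (rootu N ^ N)%C = 1%C.
Proof.
intros H. rewrite rootu_pow. rewrite <- Cexp_2PI. f_equal. f_equal. field. apply not_0_INR; lia.
Qed.

Lemma rootu_pow_neq_1 N i : (0 < i < N)%nat -> (rootu N ^ i)%C <> RtoC 1.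
Proof.
intros H E. rewrite rootu_pow in E. unfold Cexp in E. simpl in E. rewrite exp_0 in E.
injection E as E _. rewrite Rmult_1_l in E.
assert (P : 0 < INR i) by (apply lt_0_INR; lia).
assert (Q : INR i < INR N) by (apply lt_INR; lia).
set (y := PI * INR i / INR N) in *.
replace (2 * PI * INR i / INR N) with (2 * y) in E by (unfold y; field; lra).
pose proof PI_RGT_0.
assert (0 < y < PI).
{ unfold y; split; [apply Rdiv_lt_0_compat; nra|]. apply Rlt_div_l; [lra|]. nra. }
assert (0 < sin y) by (apply sin_gt_0; lra).
rewrite cos_2a_sin in E. nra.
Qed.

Lemma sum_roots N i : (0 < i < N)%nat -> csum (fun l => (rootu N ^ i) ^ l)%C N = 0%C.
Proof.
intros H. rewrite csum_geom by now apply rootu_pow_neq_1.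
rewrite <- Cpow_mult_r, Nat.mul_comm, Cpow_mult_r, rootu_pow_N, Cpow_1_l by lia.
unfold Cdiv. ring.
Qed.

Lemma csum_const (c : C) N : csum (fun _ => c) N = (RtoC (INR N) * c)%C.
Proof. induction N as [|N IH]; [simpl; ring|]. rewrite S_INR, RtoC_plus. simpl. rewrite IH. ring. Qed.

(** Each summand is a geometric sum of length N over the common denominator [1 - u ^ N];
    orthogonality of the roots of unity removes all powers of u but the zeroth. *)
Lemma sum_inv_1_minus_roots N u : (0 < N)%nat -> Cmod u < 1 ->
  csum (fun l => / (1 - rootu N ^ l * u))%C N = (RtoC (INR N) / (1 - u ^ N))%C.
Proof.
intros HN Hu.
assert (Cu : Cmod (u ^ N)%C < 1).
{ rewrite Cmod_pow. apply pow_lt_1_compat; [split; [apply Cmod_ge_0|auto]|lia]. }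
assert (NZ := C1_minus_neq_0 _ Cu).
assert (Mr : forall l, Cmod (rootu N ^ l)%C = 1).
{ intros l. rewrite rootu_pow, Cmod_Cexp. simpl. apply exp_0. }
rewrite (csum_ext _ (fun l => (/ (1 - u ^ N) * csum (fun i => (rootu N ^ l * u) ^ i) N)%C)).
2:{ intros l _. assert (Cl : Cmod (rootu N ^ l * u) < 1) by (rewrite Cmod_mult, Mr; lra).
  assert (NZl := C1_minus_neq_0 _ Cl).
  rewrite csum_geom.
  2:{ intros E. apply NZl. rewrite E. ring. }
  rewrite Cpow_mult_l, <- Cpow_mult_r, Nat.mul_comm, Cpow_mult_r, rootu_pow_N, Cpow_1_l by auto.
  field. auto. }
rewrite csum_scal, csum_switch.
assert (E : csum (fun j => csum (fun i => ((rootu N ^ i * u) ^ j)%C) N) N = RtoC (INR N)).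
{ destruct N as [|N]; [lia|].
  set (f := fun j => csum (fun i => ((rootu (S N) ^ i * u) ^ j)%C) (S N)).
  assert (F0 : f O = RtoC (INR (S N))).
  { unfold f. rewrite (csum_ext _ (fun _ => 1%C)) by (intros; reflexivity).
    rewrite csum_const. ring. }
  assert (Fj : forall j, (j < N)%nat -> f (1 + j)%nat = 0%C).
  { intros j Hj. unfold f.
    rewrite (csum_ext _ (fun i => (u ^ (1 + j) * (rootu (S N) ^ (1 + j)) ^ i)%C)).
    + rewrite csum_scal, sum_roots by lia. ring.
    + intros i _. rewrite Cpow_mult_l, <- !Cpow_mult_r. rewrite (Nat.mul_comm i). ring. }
  change (csum f (1 + N) = RtoC (INR (S N))). rewrite csum_split.
  rewrite (csum_ext _ (fun _ => 0%C) N Fj), csum_const. simpl csum. rewrite F0. ring. }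
rewrite E. field. auto.
Qed.

Lemma csum_1 (a : nat -> C) : csum a 1 = a O.
Proof. simpl. ring. Qed.

Lemma csum_rev (f : nat -> C) N : csum f N = csum (fun i => f (N - 1 - i)%nat) N.
Proof.
induction N as [|N IH]; [reflexivity|].
change (csum f N + f N = csum (fun i => f (S N - 1 - i)%nat) (1 + N))%C.
rewrite csum_split, IH.
rewrite (csum_ext (fun i => f (N - 1 - i)%nat) (fun n => f (S N - 1 - (1 + n))%nat)).
- rewrite csum_1. replace (S N - 1 - 0)%nat with N by lia. ring.
- intros. f_equal. lia.
Qed.

Lemma csum_fold (f : nat -> C) M :
  csum f (2 * M + 1) = (f O + csum (fun l => f (l + 1)%nat + f (2 * M - l)%nat)%C M)%C.
Proof.
replace (2 * M + 1)%nat with (1 + (M + M))%nat by lia. rewrite !csum_split, csum_plus.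
rewrite (csum_rev (fun n => f (1 + (M + n))%nat)), csum_1.
rewrite (csum_ext (fun n => f (1 + n)%nat) (fun n => f (n + 1)%nat)) by (intros; f_equal; lia).
rewrite (csum_ext (fun i => f (1 + (M + (M - 1 - i)))%nat) (fun l => f (2 * M - l)%nat))
  by (intros; f_equal; lia).
ring.
Qed.

(** Among an odd number of roots of unity only 1 is real, so all the others fall into conjugate
    pairs. *)
Definition oddN (M : nat) : R := INR (2 * M + 1).

Lemma oddN_pos M : 0 < oddN M.
Proof. apply lt_0_INR; lia. Qed.

Lemma oddN_lim K : is_lim_seq (fun M => K / oddN M) 0.
Proof.
apply (is_lim_seq_ext (fun M => K * / oddN M)); [intros; reflexivity|].
replace (Finite 0) with (Rbar_mult K 0) by (simpl; f_equal; ring).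
apply is_lim_seq_scal_l.
replace (Finite 0) with (Rbar_inv p_infty) by reflexivity.
apply is_lim_seq_inv; [|easy].
apply is_lim_seq_le_p_loc with INR; [|apply is_lim_seq_INR].
exists O. intros n _. apply le_INR. lia.
Qed.

Lemma Clim_exp_quotient (z : C) :
  Clim (fun M => (RtoC (oddN M) * (Cexp (z / RtoC (oddN M)) - 1))%C) z.
Proof.
apply Clim_0_squeeze with (fun M => Cmod z * Cmod z * exp (Cmod z) / oddN M); [|apply oddN_lim].
intros M. pose proof (oddN_pos M) as P. set (N := oddN M) in *.
assert (N1 : 1 <= N). { unfold N, oddN. replace 1 with (INR 1) by reflexivity. apply le_INR; lia. }
assert (NZ : RtoC N <> RtoC 0) by (intros E; apply RtoC_inj in E; lra).
replace (RtoC N * (Cexp (z / RtoC N) - 1) - z)%C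
 with (RtoC N * (Cexp (z / RtoC N) - 1 - z / RtoC N))%C by (field; auto).
rewrite Cmod_mult, Cmod_R, Rabs_pos_eq by lra.
assert (Ez : Cmod (z / RtoC N) = Cmod z / N) by (rewrite Cmod_div, Cmod_R, Rabs_pos_eq; auto; lra).
pose proof (Cmod_ge_0 z) as Pz.
apply Rle_trans with (N * (Cmod z / N * (Cmod z / N) * exp (Cmod z))).
- apply Rmult_le_compat_l; [lra|]. eapply Rle_trans; [apply Cexp_minus_1_z_bound|]. rewrite Ez.
  apply Rmult_le_compat_l.
  + apply Rmult_le_pos; apply Rdiv_le_0_compat; lra.
  + assert (L : Cmod z / N <= Cmod z).
    { apply Rle_div_l; [lra|]. nra. }
    destruct (Rle_lt_or_eq_dec _ _ L) as [L'|L']; [apply Rlt_le, exp_increasing; lra|rewrite L'; lra].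
- right. field. lra.
Qed.

Lemma Clim_exp_div (z : C) : Clim (fun M => Cexp (z / RtoC (oddN M))) 1%C.
Proof.
apply Clim_ext with (fun M => (RtoC (/ oddN M) * (RtoC (oddN M) * (Cexp (z / RtoC (oddN M)) - 1)) + 1)%C).
- intros M. pose proof (oddN_pos M). rewrite RtoC_inv by lra. field.
  intros E; apply RtoC_inj in E; lra.
- match goal with |- Clim ?F _ => cut (Clim F (0 * z + 1)%C) end.
  { intros H. replace (0 * z + 1)%C with (RtoC 1) in H by ring. exact H. }
  apply Clim_plus; [|apply Clim_const].
  apply Clim_mult; [|apply Clim_exp_quotient].
  apply Clim_0_squeeze with (fun M => 1 / oddN M); [|apply oddN_lim].
  intros M. pose proof (oddN_pos M) as P. replace (RtoC (/ oddN M) - 0)%C with (RtoC (/ oddN M)) by ring.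
  rewrite Cmod_R, Rabs_pos_eq; [right; field; lra|]. apply Rlt_le, Rinv_0_lt_compat, P.
Qed.

(* [cth s] is [coth (s / 2)], and below [tnh w] is [tanh (w / 2)]. *)
Definition cth (s : C) : C := ((Cexp s + 1) / (Cexp s - 1))%C.

Lemma Cexp_neq_1 s : 0 < Re s -> (Cexp s - 1 <> 0)%C.
Proof.
intros H E. assert (Cexp s = 1)%C as F.
{ replace (Cexp s) with (Cexp s - 1 + 1)%C by ring. rewrite E. ring. }
assert (K : Cmod (Cexp s) = 1) by (rewrite F; apply Cmod_1).
rewrite Cmod_Cexp in K. apply exp_increasing in H. rewrite exp_0 in H. lra.
Qed.

Lemma Re_pos_neq_0 (s : C) : 0 < Re s -> s <> RtoC 0.
Proof. intros H E. rewrite E in H. simpl in H. lra. Qed.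

Lemma sq_plus_sq_neq_0 (s : C) y : 0 < Re s -> (s * s + RtoC (y ^ 2) <> 0)%C.
Proof.
intros H. replace (s * s + RtoC (y ^ 2))%C with ((s + imc y) * (s + imc (- y)))%C.
- apply Cmult_neq_0; apply Re_pos_neq_0; unfold Re in *; simpl; lra.
- destruct s as [a b]. unfold Cmult, Cplus, RtoC; simpl. f_equal; ring.
Qed.

Lemma Cmod_sq_plus_sq (s : C) y : y ^ 2 - Cmod s ^ 2 <= Cmod (s * s + RtoC (y ^ 2)).
Proof.
rewrite Cplus_comm. pose proof (Cmod_triangle_inv (RtoC (y ^ 2)) (s * s)) as H.
rewrite Cmod_mult, Cmod_R, Rabs_pos_eq in H by apply pow2_ge_0. simpl in *. lra.
Qed.

Lemma summable_pf (s : C) (c : R) : 0 < c -> 0 < Re s ->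
  summable (fun m => (4 * s / (s * s + RtoC ((c * INR (m + 1)) ^ 2)))%C).
Proof.
intros Hc Hs. pose proof (Cmod_ge_0 s) as P.
destruct (INR_unbounded (2 * Cmod s / c)) as [N0 HN0].
apply summable_le_ev with (fun m => 8 * Cmod s / c ^ 2 * / (INR m + 1) ^ 2) N0.
- intros n Hn. rewrite Cmod_div by now apply sq_plus_sq_neq_0.
  rewrite Cmod_mult, Cmod_R, Rabs_pos_eq by lra.
  rewrite plus_INR. simpl (INR 1). set (x := INR n + 1).
  assert (Hx : 2 * Cmod s <= c * x).
  { assert (INR N0 <= INR n) by now apply le_INR.
    assert (L : 2 * Cmod s / c < x) by (unfold x; lra).
    apply Rlt_div_l in L; lra. }
  assert (0 < x) by (unfold x; pose proof (pos_INR n); lra).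
  assert (Pcx : 0 < (c * x) ^ 2) by (apply pow_lt; apply Rmult_lt_0_compat; lra).
  pose proof (Cmod_sq_plus_sq s (c * x)) as L.
  assert (Cmod s ^ 2 <= (c * x) ^ 2 / 4) by nra.
  apply Rle_trans with (4 * Cmod s / ((c * x) ^ 2 / 2)).
  + apply Rmult_le_compat_l; [lra|]. apply Rinv_le_contravar; lra.
  + right. field. lra.
- apply (ex_series_scal_l (V := R_NormedModule)). apply inv_sq_series.
Qed.

(* The finite identity behind the partial fraction expansion of [coth]: summation over
   [N]-th roots of unity, with conjugate roots paired. *)
Definition cth_term (s : C) (M m : nat) : C :=
  let N := oddN M in
  let u := Cexp (- s / RtoC N)%C in
  let p := Cexp (imc (2 * PI * INR (m + 1)) / RtoC N)%C in
  let q := Cexp (imc (- (2 * PI * INR (m + 1))) / RtoC N)%C in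
  (2 * ((RtoC N * (1 - u)) * (1 + u)) /
   ((RtoC N * (1 - u)) * (RtoC N * (1 - u)) + u * ((RtoC N * (p - 1)) * (RtoC N * (q - 1)))))%C.

Lemma Cmod_exp_neg (s : C) N : 0 < N -> 0 < Re s -> Cmod (Cexp (- s / RtoC N)%C) < 1.
Proof.
intros HN Hs. rewrite Cmod_Cexp, <- exp_0. apply exp_increasing.
replace (- s / RtoC N)%C with (RtoC (/ N) * - s)%C.
- rewrite Re_scal_l. simpl. pose proof (Rinv_0_lt_compat N HN).
  change (/ N * - Re s < 0). nra.
- rewrite RtoC_inv by lra. field. intros E; apply RtoC_inj in E; lra.
Qed.

Lemma cth_finite (s : C) M : 0 < Re s ->
  let N := oddN M in let u := Cexp (- s / RtoC N)%C in
  cth s = ((1 + u) / (RtoC N * (1 - u)) + csum (cth_term s M) M)%C.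
Proof.
intros Hs N u. pose proof (oddN_pos M) as P. fold N in P.
assert (NZ : RtoC N <> RtoC 0) by (intros E; apply RtoC_inj in E; lra).
assert (Hu : Cmod u < 1) by now apply Cmod_exp_neg.
assert (NZu := C1_minus_neq_0 _ Hu).
pose proof (sum_inv_1_minus_roots (2 * M + 1) u ltac:(lia) Hu) as E.
fold (oddN M) in E. fold N in E.
assert (EuN : (u ^ (2 * M + 1))%C = Cexp (- s)).
{ unfold u. rewrite <- Cexp_INR. fold (oddN M); fold N. f_equal. field; auto. }
rewrite EuN, Cexp_opp in E.
pose proof (Cexp_neq_1 s Hs) as NZs. pose proof (Cexp_neq_0 s) as NZe.
(* Since [u ^ N] is exp (-s), the sum of the [1 / (1 - rootu ^ l * u)] is N / (1 - exp (-s)), while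
   coth (s/2) = 2 / (1 - exp (-s)) - 1. *)
assert (Ecth : cth s = (RtoC (/ N) * csum (fun l => 2 * / (1 - rootu (2 * M + 1) ^ l * u) + - (1)) (2 * M + 1))%C).
{ rewrite csum_plus, csum_scal, csum_const, E. fold (oddN M); fold N. unfold cth.
  rewrite RtoC_inv by lra. field. repeat split; auto. }
rewrite Ecth, csum_fold, Cmult_plus_distr_l. f_equal.
- simpl Cpow. rewrite RtoC_inv by lra. field. auto.
- rewrite <- csum_scal. apply csum_ext. intros l Hl.
  unfold cth_term. fold N. fold u. cbv zeta.
  assert (Ep : (rootu (2 * M + 1) ^ (l + 1))%C = Cexp (imc (2 * PI * INR (l + 1)) / RtoC N)%C).
  { rewrite rootu_pow. fold (oddN M); fold N. f_equal. apply C_ext; simpl.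
    - field; nra.
    - field; nra. }
  assert (Eq : (rootu (2 * M + 1) ^ (2 * M - l))%C = Cexp (imc (- (2 * PI * INR (l + 1))) / RtoC N)%C).
  { rewrite rootu_pow. fold (oddN M); fold N.
    replace (0, 2 * PI * INR (2 * M - l) / N) with (imc (2 * PI) + imc (- (2 * PI * INR (l + 1))) / RtoC N)%C.
    - rewrite Cexp_plus. unfold imc at 1. rewrite Cexp_2PI. ring.
    - rewrite minus_INR, plus_INR by lia.
      assert (EN : INR (2 * M) = N - 1) by (unfold N, oddN; rewrite plus_INR; simpl; lra).
      rewrite EN. apply C_ext; simpl; field; nra. }
  rewrite Ep, Eq.
  set (p := Cexp (imc (2 * PI * INR (l + 1)) / RtoC N)%C).
  set (q := Cexp (imc (- (2 * PI * INR (l + 1))) / RtoC N)%C).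
  assert (Epq : (p * q = 1)%C).
  { unfold p, q. rewrite <- Cexp_plus.
    replace (imc (2 * PI * INR (l + 1)) / RtoC N + imc (- (2 * PI * INR (l + 1))) / RtoC N)%C with (RtoC 0).
    - apply Cexp_0.
    - apply C_ext; simpl; field; nra. }
  assert (Mp : Cmod p = 1).
  { unfold p. rewrite Cmod_Cexp. rewrite <- exp_0. f_equal. simpl. field; nra. }
  assert (Mq : Cmod q = 1).
  { unfold q. rewrite Cmod_Cexp. rewrite <- exp_0. f_equal. simpl. field; nra. }
  assert (NZp : (1 - p * u <> 0)%C) by (apply C1_minus_neq_0; rewrite Cmod_mult, Mp; lra).
  assert (NZq : (1 - q * u <> 0)%C) by (apply C1_minus_neq_0; rewrite Cmod_mult, Mq; lra).
  (* By [p * q = 1] the product of two conjugate factors is expressed through [N (1 - u)],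
     [N (p - 1)] and [N (q - 1)], each of which converges as N grows. *)
  replace ((RtoC N * (1 - u)) * (RtoC N * (1 - u)) + u * ((RtoC N * (p - 1)) * (RtoC N * (q - 1))))%C
   with (RtoC N * RtoC N * ((1 - p * u) * (1 - q * u)))%C.
  2:{ transitivity (RtoC N * RtoC N * (1 - u * (p + q) + (p * q) * u * u))%C; [ring|].
      transitivity (RtoC N * RtoC N * (1 - u - u + u * u + u * ((p * q) - p - q + 1)))%C; [|ring].
      rewrite Epq. ring. }
  rewrite RtoC_inv by lra.
  transitivity (2 * (1 - (p * q) * u * u) / (RtoC N * ((1 - p * u) * (1 - q * u))))%C.
  + field. auto.
  + rewrite Epq. field. auto.
Qed.

Lemma imc_div y N : N <> 0 -> (imc y / RtoC N)%C = imc (y / N).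
Proof. intros H. apply C_ext; simpl; field; nra. Qed.

Lemma Cmod_Cexp_imc_minus_1 y : Cmod (Cexp (imc y) - 1) = 2 * Rabs (sin (y / 2)).
Proof.
unfold Cmod, Cexp, imc; simpl. rewrite exp_0.
replace (_ + _) with (Rsqr (2 * sin (y / 2))).
- rewrite sqrt_Rsqr_abs, Rabs_mult, (Rabs_pos_eq 2) by lra. reflexivity.
- replace y with (2 * (y / 2)) at 2 3 4 5 by field. rewrite cos_2a_sin, sin_2a.
  pose proof (sin2_cos2 (y / 2)) as H. unfold Rsqr in *.
  set (a := sin (y / 2)) in *; set (b := cos (y / 2)) in *.
  replace ((1 * (1 - 2 * a * a) + - (1)) * ((1 * (1 - 2 * a * a) + - (1)) * 1) + (1 * (2 * a * b) + - 0) * ((1 * (2 * a * b) + - 0) * 1))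
   with (4 * a * a * (a * a) + 4 * a * a * (b * b)) by ring.
  replace (b * b) with (1 - a * a) by lra. ring.
Qed.

(** Jordan's inequality makes the bound uniform in N, as the majorant of [cth_term] requires. *)
Lemma Cmod_root_minus_1 N y : 0 < N -> 0 <= y <= PI * N ->
  2 * y / PI <= Cmod (RtoC N * (Cexp (imc y / RtoC N) - 1)) /\
  2 * y / PI <= Cmod (RtoC N * (Cexp (imc (- y) / RtoC N) - 1)).
Proof.
intros HN Hy. pose proof PI_RGT_0.
assert (K : 2 * y / PI <= N * (2 * Rabs (sin (y / N / 2)))).
{ assert (0 <= y / N / 2 <= PI / 2).
  { split; [apply Rdiv_le_0_compat; [apply Rdiv_le_0_compat|]; lra|].
    apply Rmult_le_compat_r; [lra|]. apply Rle_div_l; lra. }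
  assert (J := sin_ge_linear (y / N / 2) H0).
  assert (N * (2 * (2 / PI * (y / N / 2))) <= N * (2 * Rabs (sin (y / N / 2)))).
  { apply Rmult_le_compat_l; [lra|]. apply Rmult_le_compat_l; [lra|].
    eapply Rle_trans; [apply J|apply Rle_abs]. }
  replace (2 * y / PI) with (N * (2 * (2 / PI * (y / N / 2)))) by (field; lra). lra. }
split; rewrite Cmod_mult, Cmod_R, (Rabs_pos_eq N), imc_div, Cmod_Cexp_imc_minus_1 by lra.
- exact K.
- replace (- y / N / 2) with (- (y / N / 2)) by (field; lra). rewrite sin_neg, Rabs_Ropp. exact K.
Qed.

Lemma Clim_cth_factor (s : C) :
  Clim (fun M => (RtoC (oddN M) * (1 - Cexp (- s / RtoC (oddN M))))%C) s.
Proof.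
apply Clim_ext with (fun M => (- (1) * (RtoC (oddN M) * (Cexp (- s / RtoC (oddN M)) - 1)))%C).
- intros M. ring.
- match goal with |- Clim ?F _ => cut (Clim F (- (1) * - s)%C) end.
  { intros H. replace (- (1) * - s)%C with s in H by ring. exact H. }
  apply Clim_scal. apply Clim_exp_quotient.
Qed.

Lemma Clim_cth_term (s : C) m : 0 < Re s ->
  Clim (fun M => cth_term s M m) (4 * s / (s * s + RtoC ((2 * PI * INR (m + 1)) ^ 2)))%C.
Proof.
intros Hs. set (y := 2 * PI * INR (m + 1)).
assert (NZ := sq_plus_sq_neq_0 s y Hs).
assert (Ey : (s * s + 1 * (imc y * imc (- y)) = s * s + RtoC (y ^ 2))%C).
{ f_equal. apply C_ext; simpl; ring. }
match goal with |- Clim _ ?l => replace l with (2 * (s * (1 + 1)) * / (s * s + 1 * (imc y * imc (- y))))%C end.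
2:{ rewrite Ey. field. exact NZ. }
unfold cth_term, Cdiv. cbv zeta.
apply Clim_mult.
- apply Clim_scal. apply Clim_mult; [apply Clim_cth_factor|].
  apply Clim_plus; [apply Clim_const|apply (Clim_exp_div (- s))].
- apply Clim_inv; [rewrite Ey; exact NZ|].
  apply Clim_plus.
  + apply Clim_mult; apply Clim_cth_factor.
  + apply Clim_mult; [apply (Clim_exp_div (- s))|].
    apply Clim_mult; apply Clim_exp_quotient.
Qed.

(** The majorant for Tannery's theorem. Once m exceeds [Cmod s], the product of the two root factors
    dominates the bounded factor [N (1 - u)], so the denominator grows like (m + 1)^2, uniformly in
    M. *)
Lemma cth_term_bound (s : C) : 0 < Re s -> exists L0 N1, forall M m,
  (N1 <= M)%nat -> (L0 <= m < M)%nat ->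
  Cmod (cth_term s M m) <= (Cmod s + 1) * / (INR m + 1) ^ 2.
Proof.
intros Hs. pose proof (Cmod_ge_0 s) as Ps.
destruct (Clim_bounded _ _ (Clim_cth_factor s)) as [N0 K0].
destruct (Clim_exp_div (- s) (1 / 2)) as [N2 K2]; [lra|].
destruct (INR_unbounded (Cmod s)) as [L0 HL0].
exists L0, (max N0 N2). intros M m HM Hm.
specialize (K0 M ltac:(lia)). specialize (K2 M ltac:(lia)).
unfold cth_term. cbv zeta.
pose proof (oddN_pos M) as PN. set (N := oddN M) in *.
set (u := Cexp (- s / RtoC N)) in *.
assert (Hu1 : Cmod u < 1) by now apply Cmod_exp_neg.
assert (Hu2 : / 2 <= Cmod u).
{ pose proof (Cmod_triangle_inv 1 (u - 1)) as T. replace (1 + (u - 1))%C with u in T by ring.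
  rewrite Cmod_1 in T. lra. }
set (l := INR m + 1).
assert (El : INR (m + 1) = l) by (unfold l; rewrite plus_INR; reflexivity). rewrite El.
assert (Hl0 : Cmod s + 1 <= l).
{ unfold l. assert (INR L0 <= INR m) by (apply le_INR; lia). lra. }
pose proof PI_RGT_0 as HPI.
assert (HlN : 2 * l <= N).
{ unfold N, oddN, l. rewrite plus_INR, mult_INR. simpl (INR 1); simpl (INR 2).
  assert (INR (m + 1) <= INR M) by (apply le_INR; lia). rewrite plus_INR in H. simpl in H. lra. }
assert (Hl : 1 <= l) by lra.
destruct (Cmod_root_minus_1 N (2 * PI * l) PN) as [B1 B2].
{ split; [apply Rmult_le_pos; lra|]. nra. }
replace (2 * (2 * PI * l) / PI) with (4 * l) in * by (field; lra).
set (P := (RtoC N * (Cexp (imc (2 * PI * l) / RtoC N) - 1))%C) in *.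
set (Q := (RtoC N * (Cexp (imc (- (2 * PI * l)) / RtoC N) - 1))%C) in *.
set (F := (RtoC N * (1 - u))%C) in *.
assert (D1 : 8 * l * l <= Cmod (u * (P * Q))).
{ rewrite !Cmod_mult. apply Rle_trans with (/ 2 * (4 * l * (4 * l))); [right; field|].
  apply Rmult_le_compat; try lra; [nra|]. apply Rmult_le_compat; lra. }
assert (D2 : Cmod (F * F) <= l * l).
{ rewrite Cmod_mult. pose proof (Cmod_ge_0 F). apply Rmult_le_compat; lra. }
assert (D3 : 4 * l * l <= Cmod (F * F + u * (P * Q))).
{ pose proof (Cmod_triangle_inv (u * (P * Q)) (F * F)) as T.
  rewrite (Cplus_comm (u * (P * Q)) (F * F)) in T. nra. }
assert (D0 : 0 < 4 * l * l) by nra.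
rewrite Cmod_div by (apply Cmod_gt_0; lra).
assert (Nn : Cmod (2 * (F * (1 + u))) <= 4 * (Cmod s + 1)).
{ rewrite !Cmod_mult, Cmod_R, Rabs_pos_eq by lra.
  assert (Cmod (1 + u) <= 2).
  { eapply Rle_trans; [apply Cmod_triangle|]. rewrite Cmod_1. lra. }
  pose proof (Cmod_ge_0 F). pose proof (Cmod_ge_0 (1 + u)).
  assert (Cmod F * Cmod (1 + u) <= (Cmod s + 1) * 2) by (apply Rmult_le_compat; lra). lra. }
apply Rle_trans with (4 * (Cmod s + 1) / (4 * l * l)).
- apply Rmult_le_compat; auto; [apply Cmod_ge_0| |].
  + apply Rlt_le, Rinv_0_lt_compat. lra.
  + apply Rinv_le_contravar; lra.
- right. field. lra.
Qed.

Theorem cth_partial_fractions (s : C) : 0 < Re s ->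
  cth s = (2 / s + Csum (fun m => 4 * s / (s * s + RtoC ((2 * PI * INR (m + 1)) ^ 2))))%C.
Proof.
intros Hs. pose proof PI_RGT_0 as HPI.
set (l := fun m => (4 * s / (s * s + RtoC ((2 * PI * INR (m + 1)) ^ 2)))%C).
(* Setting the terms beyond M to 0 turns the finite sums into series, to which Tannery's theorem
   applies. *)
set (a := fun M m => if (m <? M)%nat then cth_term s M m else 0%C).
assert (Fa : forall M, summable (a M) /\ Csum (a M) = csum (cth_term s M) M).
{ intros M. destruct (Csum_finite (a M) M) as [S E].
  - intros n Hn. unfold a. destruct (Nat.ltb_spec n M); [lia|reflexivity].
  - split; auto. rewrite E. apply csum_ext. intros n Hn. unfold a.
    destruct (Nat.ltb_spec n M); [reflexivity|lia]. }
assert (La : Clim (fun M => Csum (a M)) (Csum l)).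
{ destruct (cth_term_bound s Hs) as (L0 & N1 & K).
  apply tannery with (fun m => (Cmod s + 1) * / (INR m + 1) ^ 2) L0 N1.
  - intros; apply Fa.
  - apply summable_pf; auto; lra.
  - intros m. apply (Clim_ext_ev (S m) (fun M => cth_term s M m)); [|now apply Clim_cth_term].
    intros n Hn. unfold a. destruct (Nat.ltb_spec m n); [reflexivity|lia].
  - intros N m HN Hm. unfold a. destruct (Nat.ltb_spec m N).
    + apply K; lia.
    + rewrite Cmod_0. pose proof (Cmod_ge_0 s). pose proof (pos_INR m).
      apply Rmult_le_pos; [lra|]. apply Rlt_le, Rinv_0_lt_compat, pow_lt. lra.
  - apply (ex_series_scal_l (V := R_NormedModule)). apply inv_sq_series. }
apply Clim_unique with (fun M => cth s); [apply Clim_const|].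
apply Clim_ext with (fun M => ((1 + Cexp (- s / RtoC (oddN M))) * / (RtoC (oddN M) * (1 - Cexp (- s / RtoC (oddN M)))) + Csum (a M))%C).
- intros M. rewrite (proj2 (Fa M)). symmetry. now apply cth_finite.
- apply Clim_plus; auto.
  match goal with |- Clim ?F _ => cut (Clim F ((1 + 1) * / s)%C) end.
  { intros H. replace ((1 + 1) * / s)%C with (2 / s)%C in H; [exact H|].
    field. now apply Re_pos_neq_0. }
  apply Clim_mult; [apply Clim_plus; [apply Clim_const|apply (Clim_exp_div (- s))]|].
  apply Clim_inv; [now apply Re_pos_neq_0|apply Clim_cth_factor].
Qed.

Definition tnh (w : C) : C := ((1 - Cexp (- w)) / (1 + Cexp (- w)))%C.

(** From tanh (w/2) = 2 coth w - coth (w/2): the pole at 0 and those at even multiples of pi i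
    cancel, and the odd multiples remain. *)
Theorem tnh_partial_fractions (w : C) : 0 < Re w ->
  tnh w = Csum (fun i => 4 * w / (w * w + RtoC ((PI * INR (2 * i + 1)) ^ 2)))%C.
Proof.
intros Hw. pose proof PI_RGT_0 as HPI. pose proof (Re_pos_neq_0 w Hw) as NZ.
assert (H2 : 0 < Re (2 * w)%C) by (rewrite Re_scal_l; lra).
set (h := fun m => (4 * w / (w * w + RtoC ((PI * INR (m + 1)) ^ 2)))%C).
assert (Sh : summable h) by (apply summable_pf; auto).
assert (E1 : cth (2 * w) = (1 / w + / 2 * Csum h)%C).
{ rewrite cth_partial_fractions by auto. f_equal; [field; auto|].
  rewrite <- Csum_scal by exact Sh. apply Csum_ext.
  intros m. unfold h.
  replace (RtoC ((2 * PI * INR (m + 1)) ^ 2)) with (4 * RtoC ((PI * INR (m + 1)) ^ 2))%C.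
  - field. split; [now apply sq_plus_sq_neq_0|].
    replace (2 * w * (2 * w) + 4 * RtoC ((PI * INR (m + 1)) ^ 2))%C
      with (4 * (w * w + RtoC ((PI * INR (m + 1)) ^ 2)))%C by ring.
    apply Cmult_neq_0; [intros E; apply RtoC_inj in E; lra|now apply sq_plus_sq_neq_0].
  - rewrite <- RtoC_mult. f_equal. ring. }
assert (E2 : cth w = (2 / w + Csum (fun i => h (2 * i + 1)%nat))%C).
{ rewrite cth_partial_fractions by auto. f_equal. apply Csum_ext. intros m. unfold h.
  replace (PI * INR (2 * m + 1 + 1)) with (2 * PI * INR (m + 1)); [reflexivity|].
  rewrite !plus_INR, mult_INR. simpl (INR 1); simpl (INR 2). ring. }
assert (E3 : tnh w = (2 * cth (2 * w) - cth w)%C).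
{ unfold tnh, cth. replace (2 * w)%C with (w + w)%C by ring. rewrite Cexp_plus, Cexp_opp.
  pose proof (Cexp_neq_0 w) as N0. pose proof (Cexp_neq_1 w Hw) as N1.
  assert (N2 : (Cexp w + 1 <> 0)%C).
  { intros E. assert (K : Cexp w = (- (1))%C).
    { replace (Cexp w) with (Cexp w + 1 - 1)%C by ring. rewrite E. ring. }
    assert (K2 : Cmod (Cexp w) = 1) by (rewrite K, Cmod_opp; apply Cmod_1).
    rewrite Cmod_Cexp in K2. apply exp_increasing in Hw. rewrite exp_0 in Hw. lra. }
  field. repeat split; auto.
  replace (Cexp w * Cexp w - 1)%C with ((Cexp w - 1) * (Cexp w + 1))%C by ring.
  now apply Cmult_neq_0. }
rewrite E3, E1, E2, (Csum_even_odd h Sh).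
rewrite (Csum_ext (fun i => h (2 * i)%nat) (fun i => 4 * w / (w * w + RtoC ((PI * INR (2 * i + 1)) ^ 2)))%C) by reflexivity.
field. auto.
Qed.

(** * Expansion of the sum of coth at 0 *)

Definition w32 (n : nat) : R := / ((INR n + 1) * sqrt (INR n + 1)).

Lemma w32_pos n : 0 < w32 n.
Proof.
pose proof (pos_INR n). apply Rinv_0_lt_compat, Rmult_lt_0_compat; [lra|apply sqrt_lt_R0; lra].
Qed.

Lemma ex_series_w32 : ex_series w32.
Proof.
apply (Series_le_bound _ 4); [intros; apply Rlt_le, w32_pos|].
intros N. apply Rle_trans with (4 - 4 / sqrt (INR N + 1)).
- induction N as [|N IH].
  + simpl. rewrite Rplus_0_l, sqrt_1. lra.
  + rewrite S_INR. simpl rsum. apply Rle_trans with (4 - 4 / sqrt (INR N + 1) + w32 N); [lra|].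
    unfold w32. pose proof (pos_INR N) as P. set (x := INR N + 1) in *.
    assert (Hx : 1 <= x) by (unfold x; lra). clearbody x.
    set (p := sqrt x). set (q := sqrt (x + 1)).
    assert (Hp : p * p = x) by (apply sqrt_sqrt; lra).
    assert (Hq : q * q = x + 1) by (apply sqrt_sqrt; lra).
    assert (Pp : 0 < p) by (apply sqrt_lt_R0; lra).
    assert (Pq : 0 < q) by (apply sqrt_lt_R0; lra).
    assert (Hpq : p <= q) by (apply sqrt_le_1_alt; lra).
    assert (Hq2 : q <= 3 / 2 * p) by (apply Rsqr_incr_0_var; unfold Rsqr; nra).
    rewrite <- Hp.
    apply Rminus_le.
    replace (4 - 4 / p + / (p * p * p) - (4 - 4 / q)) with
      ((q - 4 * (p * p) * (q - p)) / (p * p * p * q)) by (field; lra).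
    assert (E1 : (q - p) * (q + p) = 1) by lra.
    assert (E2 : q <= 4 * (p * p) * (q - p)).
    { apply Rmult_le_reg_r with (q + p); [lra|].
      replace (4 * (p * p) * (q - p) * (q + p)) with (4 * (p * p) * ((q - p) * (q + p))) by ring.
      rewrite E1. nra. }
    assert (0 < p * p * p * q) by (repeat apply Rmult_lt_0_compat; lra).
    apply Rmult_le_reg_r with (p * p * p * q); auto.
    unfold Rdiv. rewrite Rmult_assoc, Rinv_l by lra. lra.
- assert (0 < 4 / sqrt (INR N + 1)); [|lra].
  apply Rdiv_lt_0_compat; [lra|]. apply sqrt_lt_R0. pose proof (pos_INR N); lra.
Qed.

(** The exchange of sums needs a majorant in product form. With j = p^2, x = q^2 and S = p^4 + q^4,
    both p^2 q^2 <= S and p q^3 <= S hold; the claim is their product. *)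
Lemma lattice_weight j x : 1 <= j -> 1 <= x ->
  x / (j ^ 2 + x ^ 2) ^ 2 <= / (j * sqrt j) * / (x * sqrt x).
Proof.
intros Hj Hx. set (p := sqrt j). set (q := sqrt x).
assert (Hp : j = p * p) by (symmetry; apply sqrt_sqrt; lra).
assert (Hq : x = q * q) by (symmetry; apply sqrt_sqrt; lra).
assert (Pp : 0 < p) by (apply sqrt_lt_R0; lra).
assert (Pq : 0 < q) by (apply sqrt_lt_R0; lra).
clearbody p q. subst j x.
assert (D : 0 < (p * p) ^ 2 + (q * q) ^ 2) by nra.
set (S := (p * p) ^ 2 + (q * q) ^ 2) in *.
assert (A1 : 2 * (p * p) * (q * q) <= S) by (pose proof (pow2_ge_0 (p * p - q * q)); unfold S; lra).
assert (A2 : p * q * (q * q) <= S).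
{ unfold S. destruct (Rle_or_lt p q).
  - apply Rle_trans with ((q * q) ^ 2); [|nra].
    replace ((q * q) ^ 2) with (q * q * (q * q)) by ring.
    apply Rmult_le_compat_r; nra.
  - apply Rle_trans with ((p * p) ^ 2); [|nra].
    replace ((p * p) ^ 2) with (p * p * (p * p)) by ring.
    apply Rmult_le_compat; nra. }
apply Rle_div_l; [apply pow_lt; auto|].
apply Rmult_le_reg_l with (p * p * p * (q * q * q)); [repeat apply Rmult_lt_0_compat; lra|].
replace (p * p * p * (q * q * q) * (/ (p * p * p) * / (q * q * q) * S ^ 2)) with (S * S) by (field; lra).
replace (p * p * p * (q * q * q) * (q * q)) with ((p * p * (q * q)) * (p * q * (q * q))) by ring.
assert (0 <= p * p * (q * q)) by (repeat apply Rmult_le_pos; lra).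
apply Rmult_le_compat; try lra. repeat apply Rmult_le_pos; lra.
Qed.

Definition oddR (i : nat) : R := INR (2 * i + 1).

Lemma oddR_ge i : INR i + 1 <= oddR i.
Proof. unfold oddR. rewrite <- S_INR. apply le_INR. lia. Qed.

Lemma oddR_ge_1 i : 1 <= oddR i.
Proof. pose proof (oddR_ge i). pose proof (pos_INR i). lra. Qed.

(** The contribution to coth (j t / 2) / j, with j = [oddR i], of the poles at j t = 2 pi i x and
    its conjugate. The argument x is real because scaling t by k divides it by k ([lat_kt]). *)
Definition lat (t : C) (i : nat) (x : R) : C :=
  (4 * t / ((RtoC (oddR i) * t) * (RtoC (oddR i) * t) + RtoC ((2 * PI * x) ^ 2)))%C.

Lemma lat_den_lower (t : C) : 0 < Re t -> exists c, 0 < c /\ forall j y,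
  (j ^ 2 + y ^ 2) <= c * Cmod ((RtoC j * t) * (RtoC j * t) + RtoC (y ^ 2))%C.
Proof.
intros Ht. destruct t as [a b]. simpl in Ht.
(* This value gives [c >= 2] and [c * a ^ 2 >= 1 + 2 * b ^ 2]; then c times the squared modulus of
   [j t + i z] exceeds [j ^ 2 + z ^ 2] by at least (2 j b + z)^2. *)
exists (2 + (1 + 2 * b ^ 2) / a ^ 2).
assert (Pa : 0 < a ^ 2) by (apply pow_lt; auto).
assert (P1 : 0 < (1 + 2 * b ^ 2) / a ^ 2) by (apply Rdiv_lt_0_compat; nra).
set (c := 2 + (1 + 2 * b ^ 2) / a ^ 2) in *.
assert (Hc : (1 + 2 * b ^ 2) <= c * a ^ 2).
{ unfold c. rewrite Rmult_plus_distr_r. unfold Rdiv at 1. rewrite Rmult_assoc, Rinv_l by lra. nra. }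
split; [unfold c; lra|]. intros j y.
assert (K : forall y, j ^ 2 + y ^ 2 <= c * Cmod (RtoC j * (a, b) + imc y)%C ^ 2).
{ intros z. rewrite Cmod2_alt. simpl.
  replace ((j * a - 0 * b + 0) * ((j * a - 0 * b + 0) * 1) + (j * b + 0 * a + z) * ((j * b + 0 * a + z) * 1))
   with (j ^ 2 * a ^ 2 + (j * b + z) ^ 2) by ring.
  assert (0 <= (j * b + z) ^ 2) by apply pow2_ge_0.
  assert (0 <= j ^ 2) by apply pow2_ge_0.
  assert (2 * (j * b + z) ^ 2 <= c * (j * b + z) ^ 2) by (apply Rmult_le_compat_r; unfold c; lra).
  assert (j ^ 2 * (1 + 2 * b ^ 2) <= j ^ 2 * (c * a ^ 2)) by (apply Rmult_le_compat_l; lra).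
  pose proof (pow2_ge_0 (2 * j * b + z)). lra. }
replace ((RtoC j * (a, b)) * (RtoC j * (a, b)) + RtoC (y ^ 2))%C
  with ((RtoC j * (a, b) + imc y) * (RtoC j * (a, b) + imc (- y)))%C.
2:{ unfold Cmult, Cplus, RtoC, imc; simpl. f_equal; ring. }
rewrite Cmod_mult. pose proof (K y) as K1. pose proof (K (- y)) as K2.
replace ((- y) ^ 2) with (y ^ 2) in K2 by ring.
set (u := Cmod (RtoC j * (a, b) + imc y)%C) in *. set (v := Cmod (RtoC j * (a, b) + imc (- y))%C) in *.
assert (Pu : 0 <= u) by apply Cmod_ge_0. assert (Pv : 0 <= v) by apply Cmod_ge_0.
assert (Pc : 0 < c) by (unfold c; lra).
destruct (Rle_or_lt u v).
- apply Rle_trans with (c * u ^ 2); auto. apply Rmult_le_compat_l; nra.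
- apply Rle_trans with (c * v ^ 2); auto. apply Rmult_le_compat_l; nra.
Qed.

Lemma csum_opp a N : csum (fun n => (- a n)%C) N = (- csum a N)%C.
Proof. induction N as [|N IH]; simpl; [ring|rewrite IH; ring]. Qed.

Lemma lat_den_neq_0 (s : C) i x : 0 < Re s ->
  ((RtoC (oddR i) * s) * (RtoC (oddR i) * s) + RtoC ((2 * PI * x) ^ 2) <> 0)%C.
Proof.
intros Hs. apply sq_plus_sq_neq_0. rewrite Re_scal_l. pose proof (oddR_ge_1 i). nra.
Qed.

Section Swap.

Variables (k : nat) (t : C).

Hypothesis Hk : (1 <= k)%nat.

Hypothesis Ht : 0 < Re t.

Let kt : C := (RtoC (INR k) * t)%C.

Lemma INR_k : 1 <= INR k.
Proof. replace 1 with (INR 1) by reflexivity. now apply le_INR. Qed.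

Lemma Re_kt : 0 < Re kt.
Proof. unfold kt. rewrite Re_scal_l. pose proof INR_k. nra. Qed.

(* The pole sums of [coth (j t / 2)] and [coth (j k t / 2)] give no absolutely convergent double
   series; matching one pole of the former with [k] of the latter does. *)
Definition block (i m : nat) : C :=
  (lat t i (INR (m + 1)) - csum (fun r => lat kt i (INR (k * m + r + 1))) k)%C.

Lemma lat_kt i x : lat kt i x = (RtoC (/ INR k) * lat t i (x / INR k))%C.
Proof.
pose proof INR_k as K. pose proof Re_kt as R. unfold lat.
assert (NK : RtoC (INR k) <> RtoC 0) by (apply RtoC_INR_neq_0; lia).
replace (RtoC ((2 * PI * x) ^ 2)) with (RtoC (INR k) * RtoC (INR k) * RtoC ((2 * PI * (x / INR k)) ^ 2))%C.
2:{ rewrite <- !RtoC_mult. f_equal. field. lra. }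
rewrite RtoC_inv by lra. unfold kt.
pose proof (lat_den_neq_0 t i (x / INR k) Ht) as D.
set (z := RtoC ((2 * PI * (x / INR k)) ^ 2)) in *.
field. repeat split; auto.
replace (_ + _)%C with (INR k * INR k * (oddR i * t * (oddR i * t) + z))%C by ring.
repeat apply Cmult_neq_0; auto.
Qed.

(** A block is an average of k differences of [lat t i] at points at distance at most 1. Such
    differences decay faster than the single values, and this gives absolute convergence. *)
Lemma blk_avg i m : block i m = csum (fun r => (RtoC (/ INR k) *
  (lat t i (INR (m + 1)) - lat t i (INR (k * m + r + 1) / INR k)))%C) k.
Proof.
pose proof INR_k as K. unfold block.
rewrite (csum_ext (fun r => lat kt i (INR (k * m + r + 1))) (fun r => (RtoC (/ INR k) * lat t i (INR (k * m + r + 1) / INR k))%C))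
  by (intros; apply lat_kt).
rewrite !csum_scal. unfold Cminus. rewrite csum_plus, csum_const.
rewrite csum_opp, RtoC_inv by lra. field. apply RtoC_INR_neq_0; lia.
Qed.

(** The condition [x / INR k <= x'] keeps the second denominator comparable with the first, up to
    k^2; in the block m = 0 the point x' can be as small as 1/k. *)
Lemma lat_diff_bound : exists K, 0 <= K /\ forall i x x', 1 <= x -> x / INR k <= x' -> x - 1 <= x' <= x ->
  Cmod (lat t i x - lat t i x') <= K * (x / (oddR i ^ 2 + x ^ 2) ^ 2).
Proof.
destruct (lat_den_lower t Ht) as [c [Pc Hc]].
pose proof INR_k as Kk. pose proof PI_RGT_0 as HPI.
assert (PI1 : 1 < PI) by (pose proof PI2_1; lra).
exists (4 * Cmod t * (2 * PI) ^ 2 * 2 * (c * c * (INR k) ^ 2)).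
pose proof (Cmod_ge_0 t) as Pt.
assert (Q1 : 0 <= (2 * PI) ^ 2) by apply pow2_ge_0.
assert (Q2 : 0 <= INR k ^ 2) by apply pow2_ge_0.
split.
{ apply Rmult_le_pos; [apply Rmult_le_pos; [apply Rmult_le_pos; [lra|exact Q1]|lra]|].
  apply Rmult_le_pos; [nra|exact Q2]. }
intros i x x' Hx Hk' Hxx. pose proof (oddR_ge_1 i) as HJ.
pose proof (lat_den_neq_0 t i x Ht) as N1. pose proof (lat_den_neq_0 t i x' Ht) as N2.
unfold lat.
set (D1 := ((RtoC (oddR i) * t) * (RtoC (oddR i) * t) + RtoC ((2 * PI * x) ^ 2))%C) in *.
set (D2 := ((RtoC (oddR i) * t) * (RtoC (oddR i) * t) + RtoC ((2 * PI * x') ^ 2))%C) in *.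
assert (E : (4 * t / D1 - 4 * t / D2 = 4 * t * RtoC ((2 * PI) ^ 2 * (x' ^ 2 - x ^ 2)) / (D1 * D2))%C).
{ replace (RtoC ((2 * PI) ^ 2 * (x' ^ 2 - x ^ 2))) with (D2 - D1)%C.
  - field. auto.
  - unfold D1, D2.
    replace ((2 * PI) ^ 2 * (x' ^ 2 - x ^ 2)) with ((2 * PI * x') ^ 2 - (2 * PI * x) ^ 2) by ring.
    rewrite RtoC_minus. ring. }
rewrite E. rewrite Cmod_div by (apply Cmult_neq_0; auto). rewrite !Cmod_mult, !Cmod_R.
rewrite (Rabs_pos_eq 4) by lra.
assert (X' : 0 <= x') by (apply Rle_trans with (x / INR k); [apply Rdiv_le_0_compat|]; lra).
assert (B0 : Rabs ((2 * PI) ^ 2 * (x' ^ 2 - x ^ 2)) <= (2 * PI) ^ 2 * (2 * x)).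
{ rewrite Rabs_mult, (Rabs_pos_eq ((2 * PI) ^ 2)) by apply pow2_ge_0.
  apply Rmult_le_compat_l; [apply pow2_ge_0|]. rewrite Rabs_left1 by nra. nra. }
set (S := oddR i ^ 2 + x ^ 2). assert (PS : 0 < S) by (unfold S; nra).
assert (B1 : S <= c * Cmod D1).
{ eapply Rle_trans; [|apply (Hc (oddR i) (2 * PI * x))]. unfold S.
  apply Rplus_le_compat_l. apply pow_incr. split; [lra|]. nra. }
assert (B2 : S / (INR k) ^ 2 <= c * Cmod D2).
{ eapply Rle_trans; [|apply (Hc (oddR i) (2 * PI * x'))]. unfold S.
  apply Rle_div_l; [apply pow_lt; lra|].
  assert (x <= INR k * x') by (rewrite Rmult_comm; apply (Rle_div_l x); lra).
  assert (0 <= oddR i ^ 2) by (apply pow_le; lra).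
  assert (1 <= INR k ^ 2) by nra.
  assert (oddR i ^ 2 * 1 <= oddR i ^ 2 * INR k ^ 2) by (apply Rmult_le_compat_l; lra).
  assert (x ^ 2 <= (2 * PI * x') ^ 2 * INR k ^ 2).
  { replace ((2 * PI * x') ^ 2 * INR k ^ 2) with ((2 * PI * (INR k * x')) ^ 2) by ring.
    apply pow_incr. split; [lra|]. nra. }
  lra. }
assert (PD1 : 0 < Cmod D1) by (apply Cmod_gt_0; auto).
assert (PD2 : 0 < Cmod D2) by (apply Cmod_gt_0; auto).
assert (B3 : S * S <= c * c * INR k ^ 2 * (Cmod D1 * Cmod D2)).
{ assert (B2' : S <= c * Cmod D2 * INR k ^ 2) by (apply (Rle_div_l S _ (INR k ^ 2)); [apply pow_lt; lra|exact B2]).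
  replace (c * c * INR k ^ 2 * (Cmod D1 * Cmod D2)) with ((c * Cmod D1) * (c * Cmod D2 * INR k ^ 2)) by ring.
  apply Rmult_le_compat; lra. }
apply Rle_div_l; [now apply Rmult_lt_0_compat|].
replace (4 * Cmod t * (2 * PI) ^ 2 * 2 * (c * c * INR k ^ 2) * (x / S ^ 2) * (Cmod D1 * Cmod D2))
  with (4 * Cmod t * ((2 * PI) ^ 2 * (2 * x)) * ((c * c * INR k ^ 2 * (Cmod D1 * Cmod D2)) / (S * S))) by (field; lra).
apply Rle_trans with (4 * Cmod t * ((2 * PI) ^ 2 * (2 * x)) * 1).
- rewrite Rmult_1_r. apply Rmult_le_compat_l; [lra|auto].
- apply Rmult_le_compat_l.
  + apply Rmult_le_pos; [lra|]. apply Rmult_le_pos; [exact Q1|lra].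
  + apply Rle_div_r; nra.
Qed.

Lemma blk_bound : exists K, 0 <= K /\ forall i m, Cmod (block i m) <= K * w32 i * w32 m.
Proof.
destruct lat_diff_bound as [K [PK HK]]. pose proof INR_k as Kk.
exists K. split; auto. intros i m. rewrite blk_avg.
eapply Rle_trans; [apply csum_Cmod|].
apply Rle_trans with (rsum (fun _ => / INR k * (K * w32 i * w32 m)) k).
2:{ rewrite rsum_const. right. field. lra. }
apply rsum_le. intros r Hr. rewrite Cmod_mult, Cmod_R.
assert (Pk : 0 < / INR k) by (apply Rinv_0_lt_compat; lra).
rewrite Rabs_pos_eq by lra. apply Rmult_le_compat_l; [lra|].
pose proof (pos_INR m) as Pm. pose proof (pos_INR i) as Pi.
assert (Em : INR (m + 1) = INR m + 1) by (rewrite plus_INR; reflexivity).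
eapply Rle_trans; [apply HK|].
- rewrite Em. lra.
- apply Rmult_le_compat_r; [lra|]. apply le_INR. nia.
- assert (E : INR (k * m + r + 1) = INR k * INR m + INR (r + 1)).
  { rewrite <- Nat.add_assoc, plus_INR, mult_INR. reflexivity. }
  rewrite E, Em.
  assert (INR (r + 1) <= INR k) by (apply le_INR; lia).
  pose proof (pos_INR (r + 1)).
  split.
  + apply Rle_div_r; nra.
  + apply Rle_div_l; nra.
- rewrite Rmult_assoc. apply Rmult_le_compat_l; auto. rewrite Em.
  eapply Rle_trans; [apply lattice_weight; [apply oddR_ge_1|lra]|].
  unfold w32. apply Rmult_le_compat_r.
  + apply Rlt_le, w32_pos.
  + pose proof (oddR_ge i). apply Rinv_le_contravar.
    * apply Rmult_lt_0_compat; [lra|apply sqrt_lt_R0; lra].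
    * apply Rmult_le_compat; try lra; [apply sqrt_pos|apply sqrt_le_1_alt; lra].
Qed.

End Swap.

Definition exp_ratio (w : C) : C := (Cexp (- w) / (1 + Cexp (- w)))%C.

(** Read in the other direction, the same terms are the partial fractions of tanh (w/2) at w = 2
    pi^2 x / s. As tanh is exponentially close to 1, each column gives the constant 1/(2x) and a
    small correction. *)
Lemma lat_sum (s : C) x : 0 < Re s -> 0 < x ->
  summable (fun i => lat s i x) /\
  Csum (fun i => lat s i x) =
   (RtoC (/ (2 * x)) - RtoC (/ x) * exp_ratio (RtoC (2 * PI ^ 2 * x) / s))%C.
Proof.
intros Hs Hx. pose proof PI_RGT_0 as HPI. pose proof (Re_pos_neq_0 s Hs) as Ns.
set (w := (RtoC (2 * PI ^ 2 * x) / s)%C).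
assert (Px : 0 < 2 * PI ^ 2 * x) by (assert (0 < PI ^ 2) by (apply pow_lt; lra); apply Rmult_lt_0_compat; lra).
assert (Hw : 0 < Re w).
{ unfold w, Cdiv. rewrite Re_scal_l. apply Rmult_lt_0_compat; auto.
  destruct s as [a b]. simpl in *. apply Rdiv_lt_0_compat; auto.
  assert (0 <= b * b) by nra. nra. }
assert (E : forall i, lat s i x = (RtoC (/ (2 * x)) * (4 * w / (w * w + RtoC ((PI * INR (2 * i + 1)) ^ 2))))%C).
{ intros i. pose proof (lat_den_neq_0 s i x Hs) as D.
  pose proof (sq_plus_sq_neq_0 w (PI * INR (2 * i + 1)) Hw) as D2.
  unfold lat in *. fold (oddR i) in *.
  assert (Nx : RtoC x <> RtoC 0) by (intros E; apply RtoC_inj in E; lra).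
  assert (NPI : RtoC PI <> RtoC 0) by (intros E; apply RtoC_inj in E; lra).
  assert (E3 : (w * w + RtoC ((PI * oddR i) ^ 2))%C =
    (RtoC PI * RtoC PI / (s * s) * ((RtoC (oddR i) * s) * (RtoC (oddR i) * s) + RtoC ((2 * PI * x) ^ 2)))%C).
  { unfold w. replace (2 * PI ^ 2 * x) with (2 * PI * PI * x) by ring.
    replace ((PI * oddR i) ^ 2) with (PI * oddR i * (PI * oddR i)) by ring.
    replace ((2 * PI * x) ^ 2) with (2 * PI * x * (2 * PI * x)) by ring.
    rewrite !RtoC_mult. field. auto. }
  rewrite E3. unfold w.
  replace (2 * PI ^ 2 * x) with (2 * PI * PI * x) by ring.
  rewrite RtoC_inv by lra. rewrite !RtoC_mult.
  set (DD := (RtoC (oddR i) * s * (RtoC (oddR i) * s) + RtoC ((2 * PI * x) ^ 2))%C) in *.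
  field. repeat split; auto. }
assert (SS : summable (fun i => 4 * w / (w * w + RtoC ((PI * INR (2 * i + 1)) ^ 2)))%C).
{ apply (summable_subseq (fun m => 4 * w / (w * w + RtoC ((PI * INR (m + 1)) ^ 2)))%C (fun i => 2 * i)%nat).
  - intros; lia.
  - apply summable_pf; auto. }
split.
- apply summable_ext with (fun i => (RtoC (/ (2 * x)) * (4 * w / (w * w + RtoC ((PI * INR (2 * i + 1)) ^ 2))))%C).
  + intros; now rewrite E.
  + now apply summable_scal.
- rewrite (Csum_ext _ _ E), Csum_scal by auto. rewrite <- tnh_partial_fractions by auto.
  unfold tnh, exp_ratio. rewrite !RtoC_inv, RtoC_mult by lra.
  assert (N1 : (1 + Cexp (- w) <> 0)%C).
  { replace (Cexp (- w)) with (- - Cexp (- w))%C by ring. apply C1_minus_neq_0.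
    rewrite Cmod_opp, Cmod_Cexp, <- exp_0. apply exp_increasing.
    change (- Re w < 0). lra. }
  assert (Nx : RtoC x <> RtoC 0) by (intros E'; apply RtoC_inj in E'; lra).
  field. repeat split; auto.
Qed.

Definition rho (s : C) : R := Re (/ s)%C.

Lemma rho_pos s : 0 < Re s -> 0 < rho s.
Proof.
intros Hs. destruct s as [a b]. simpl in *. unfold rho. simpl. apply Rdiv_lt_0_compat; auto.
assert (0 <= b * b) by nra. nra.
Qed.

Lemma Re_scal_div c s : Re (RtoC c / s)%C = c * rho s.
Proof. unfold Cdiv. now rewrite Re_scal_l. Qed.

Lemma exp_pow_INR x n : exp x ^ n = exp (INR n * x).
Proof.
induction n as [|n IH]; [simpl; rewrite Rmult_0_l, exp_0; reflexivity|].
rewrite S_INR. simpl. rewrite IH, <- exp_plus. f_equal. ring.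
Qed.

Definition zed (s : C) : R := exp (- (2 * PI ^ 2 * rho s)).

Lemma zed_bounds s : 0 < Re s -> 0 < zed s < 1.
Proof.
intros Hs. split; [apply exp_pos|]. unfold zed. rewrite <- exp_0. apply exp_increasing.
pose proof (rho_pos s Hs). assert (0 < PI ^ 2) by (apply pow_lt; apply PI_RGT_0).
assert (0 < 2 * PI ^ 2 * rho s) by (apply Rmult_lt_0_compat; lra). lra.
Qed.

Definition eps_term (s : C) (n : nat) : C :=
  (RtoC (/ (INR n + 1)) * exp_ratio (RtoC (2 * PI ^ 2 * (INR n + 1)) / s))%C.

Definition Eps (s : C) : C := Csum (eps_term s).

Lemma eps_term_bound s n : 0 < Re s -> Cmod (eps_term s n) <= zed s / (1 - zed s) * zed s ^ n.
Proof.
intros Hs. pose proof (zed_bounds s Hs) as [Z0 Z1]. pose proof (pos_INR n) as Pn.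
unfold eps_term, exp_ratio.
set (w := (RtoC (2 * PI ^ 2 * (INR n + 1)) / s)%C).
assert (Ew : Cmod (Cexp (- w)) = zed s ^ S n).
{ rewrite Cmod_Cexp. change (exp (- Re w) = zed s ^ S n). unfold w. rewrite Re_scal_div.
  unfold zed. rewrite exp_pow_INR. f_equal. rewrite S_INR. ring. }
assert (Zn : zed s ^ S n <= zed s).
{ simpl. rewrite <- (Rmult_1_r (zed s)) at 3. apply Rmult_le_compat_l; [lra|].
  rewrite <- (pow1 n). apply pow_incr. lra. }
assert (D : 1 - zed s <= Cmod (1 + Cexp (- w))).
{ pose proof (Cmod_triangle_inv 1 (Cexp (- w))) as T. rewrite Cmod_1, Ew in T. lra. }
rewrite Cmod_mult, Cmod_R, Cmod_div, Ew by (apply Cmod_gt_0; lra).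
assert (0 < / (INR n + 1) <= 1).
{ split; [apply Rinv_0_lt_compat; lra|]. rewrite <- Rinv_1. apply Rinv_le_contravar; lra. }
rewrite Rabs_pos_eq by lra.
assert (P : 0 < zed s ^ S n) by (apply pow_lt; auto).
apply Rle_trans with (1 * (zed s ^ S n / Cmod (1 + Cexp (- w)))).
- apply Rmult_le_compat_r; [|lra]. apply Rdiv_le_0_compat; lra.
- rewrite Rmult_1_l. apply Rle_trans with (zed s ^ S n / (1 - zed s)).
  + apply Rmult_le_compat_l; [lra|]. apply Rinv_le_contravar; lra.
  + right. simpl. field. lra.
Qed.

Lemma ex_series_eps_bound s : 0 < Re s -> ex_series (fun n => zed s / (1 - zed s) * zed s ^ n).
Proof.
intros Hs. pose proof (zed_bounds s Hs) as [Z0 Z1].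
apply (ex_series_scal_l (V := R_NormedModule)). apply ex_series_geom. rewrite Rabs_pos_eq; lra.
Qed.

Lemma summable_eps s : 0 < Re s -> summable (eps_term s).
Proof.
intros Hs. eapply summable_le; [intros n; now apply eps_term_bound|]. now apply ex_series_eps_bound.
Qed.

Lemma Eps_bound s : 0 < Re s -> Cmod (Eps s) <= zed s / (1 - zed s) ^ 2.
Proof.
intros Hs. pose proof (zed_bounds s Hs) as [Z0 Z1].
replace (zed s / (1 - zed s) ^ 2) with (Series (fun n => zed s / (1 - zed s) * zed s ^ n)).
- apply Csum_Cmod_le; [intros n; now apply eps_term_bound|now apply ex_series_eps_bound].
- rewrite Series_scal_l, Series_geom by (rewrite Rabs_pos_eq; lra). field. lra.
Qed.

Definition Zodd : R := Series (fun i => / oddR i ^ 2).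

Lemma ex_series_Zodd : ex_series (fun i => / oddR i ^ 2).
Proof.
apply ex_series_le_R with (fun n => / (INR n + 1) ^ 2); [|apply inv_sq_series].
intros n. pose proof (oddR_ge n). pose proof (pos_INR n). split.
- apply Rlt_le, Rinv_0_lt_compat, pow_lt. lra.
- apply Rinv_le_contravar; [apply pow_lt; lra|]. apply pow_incr. lra.
Qed.

(** The constants 1/(2x) left by the columns. Their sum converges only in blocks, since the two
    parts are harmonic series. *)
Definition kap_term (k m : nat) : R :=
  / (2 * INR (m + 1)) - rsum (fun r => / (2 * INR (k * m + r + 1))) k.

(* This is [- ln k / 2]. *)
Definition kap (k : nat) : R := Series (kap_term k).

Section Main.

Variables (k : nat) (t : C).

Hypothesis Hk : (1 <= k)%nat.

Hypothesis Ht : 0 < Re t.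

Let kt : C := (RtoC (INR k) * t)%C.

Lemma J_neq_0 i : RtoC (oddR i) <> RtoC 0.
Proof. intros E. apply RtoC_inj in E. pose proof (oddR_ge_1 i). lra. Qed.

Lemma cth_row (s : C) i : 0 < Re s ->
  summable (fun m => lat s i (INR (m + 1))) /\
  (RtoC (/ oddR i) * cth (RtoC (oddR i) * s) =
   2 / s * RtoC (/ oddR i ^ 2) + Csum (fun m => lat s i (INR (m + 1))))%C.
Proof.
intros Hs. pose proof (oddR_ge_1 i) as HJ. pose proof (J_neq_0 i) as NJ.
assert (HJs : 0 < Re (RtoC (oddR i) * s)%C) by (rewrite Re_scal_l; nra).
pose proof PI_RGT_0 as HPI.
assert (E : forall m, lat s i (INR (m + 1)) =
  (RtoC (/ oddR i) * (4 * (RtoC (oddR i) * s) / ((RtoC (oddR i) * s) * (RtoC (oddR i) * s) + RtoC ((2 * PI * INR (m + 1)) ^ 2))))%C).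
{ intros m. unfold lat. rewrite RtoC_inv by lra. field. split; auto. now apply lat_den_neq_0. }
assert (SS := summable_pf (RtoC (oddR i) * s)%C (2 * PI) ltac:(lra) HJs).
split.
- eapply summable_ext; [intros m; symmetry; apply E|]. now apply summable_scal.
- rewrite (Csum_ext _ _ E), Csum_scal by auto. rewrite cth_partial_fractions by auto.
  assert (E2 : (RtoC (/ oddR i) * (2 / (RtoC (oddR i) * s)) = 2 / s * RtoC (/ oddR i ^ 2))%C).
  { replace (oddR i ^ 2) with (oddR i * oddR i) by ring. rewrite !RtoC_inv, RtoC_mult by nra.
    field. split; auto using Re_pos_neq_0. }
  rewrite Cmult_plus_distr_l, E2. reflexivity.
Qed.

(** Summation by rows: the poles at 0 of the two coth combine into the term in 1/t, all other poles
    into blocks. *)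
Lemma row_eq i : summable (block k t i) /\
  (RtoC (/ oddR i) * (cth (RtoC (oddR i) * t) - cth (RtoC (oddR i) * kt)) =
   2 * (1 - / RtoC (INR k)) / t * RtoC (/ oddR i ^ 2) + Csum (block k t i))%C.
Proof.
pose proof (Re_kt k t Hk Ht) as Hkt. fold kt in Hkt.
destruct (cth_row t i Ht) as [S1 E1]. destruct (cth_row kt i Hkt) as [S2 E2].
pose proof (summable_blocks _ k Hk S2) as S3.
pose proof (Csum_blocks _ k Hk S2) as E3. cbv beta in E3, S3.
split.
- apply summable_minus; auto.
- unfold block. fold kt. rewrite Csum_minus by auto. rewrite <- E3.
  unfold Cminus at 1. rewrite Cmult_plus_distr_l, E1.
  transitivity (2 / t * RtoC (/ oddR i ^ 2) + Csum (fun m : nat => lat t i (INR (m + 1))) - RtoC (/ oddR i) * cth (RtoC (oddR i) * kt))%C; [ring|].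
  rewrite E2. unfold kt. field. split; [apply RtoC_INR_neq_0; lia|now apply Re_pos_neq_0].
Qed.

Lemma INR_S_eq m : INR (m + 1) = INR m + 1.
Proof. rewrite plus_INR. reflexivity. Qed.

(** Summation by columns, through [lat_sum]: the constants 1/(2x) make up [kap], the exponentially
    small remainders make up [Eps]. *)
Lemma col_eq m : Csum (fun i => block k t i m) =
  (RtoC (kap_term k m) - eps_term t m + csum (fun r => eps_term kt (k * m + r)) k)%C.
Proof.
pose proof (Re_kt k t Hk Ht) as Hkt. fold kt in Hkt.
assert (P : forall n, 0 < INR (n + 1)) by (intros; apply lt_0_INR; lia).
destruct (lat_sum t (INR (m + 1)) Ht (P m)) as [S1 E1].
assert (K : forall N,
  summable (fun i => csum (fun r => lat kt i (INR (k * m + r + 1))) N) /\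
  Csum (fun i => csum (fun r => lat kt i (INR (k * m + r + 1))) N) =
  (RtoC (rsum (fun r => / (2 * INR (k * m + r + 1)))%R N) - csum (fun r => eps_term kt (k * m + r)) N)%C).
{ induction N as [|N [IS IE]]; simpl.
  - destruct (Csum_finite (fun _ => RtoC 0) 0 (fun _ _ => eq_refl)) as [S0 E0].
    split; auto. rewrite E0. simpl. ring.
  - destruct (lat_sum kt (INR (k * m + N + 1)) Hkt (P _)) as [S2 E2].
    split; [now apply summable_plus|]. rewrite Csum_plus by auto. rewrite IE, E2.
    rewrite RtoC_plus. unfold eps_term at 3. rewrite <- INR_S_eq. ring. }
destruct (K k) as [S2 E2]. unfold block. fold kt. rewrite Csum_minus by auto.
rewrite E1, E2. unfold kap_term, eps_term at 2. rewrite <- INR_S_eq, RtoC_minus. ring.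
Qed.

Theorem coth_sum_expansion :
  Csum (fun i => RtoC (/ oddR i) * (cth (RtoC (oddR i) * t) - cth (RtoC (oddR i) * kt)))%C =
  (RtoC (2 * (1 - / INR k) * Zodd) / t + RtoC (kap k) - Eps t + Eps kt)%C.
Proof.
pose proof (Re_kt k t Hk Ht) as Hkt. fold kt in Hkt.
destruct (blk_bound k t Hk Ht) as [K [PK HK]].
assert (Sw : ex_series (fun i => K * w32 i)) by (apply (ex_series_scal_l (V := R_NormedModule)), ex_series_w32).
assert (Pw : forall i, 0 <= K * w32 i) by (intros; apply Rmult_le_pos; [auto|apply Rlt_le, w32_pos]).
assert (Pw' : forall i, 0 <= w32 i) by (intros; apply Rlt_le, w32_pos).
assert (R1 : summable (fun i => Csum (block k t i))).
{ apply (rows_summable (block k t) (fun i => K * w32 i) w32); auto. apply ex_series_w32. }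
assert (R2 : summable (fun m => Csum (fun i => block k t i m))).
{ apply (rows_summable (fun m i => block k t i m) w32 (fun i => K * w32 i)); auto.
  - intros m i. eapply Rle_trans; [apply HK|]. right; ring.
  - apply ex_series_w32. }
assert (SZ : summable (fun i => RtoC (/ oddR i ^ 2))).
{ apply summable_le with (fun i => / oddR i ^ 2); [|apply ex_series_Zodd].
  intros n. rewrite Cmod_R, Rabs_pos_eq; [lra|]. pose proof (oddR_ge_1 n).
  apply Rlt_le, Rinv_0_lt_compat, pow_lt. lra. }
rewrite (Csum_ext _ _ (fun i => proj2 (row_eq i))).
rewrite Csum_plus by (auto; now apply summable_scal).
rewrite Csum_scal, Csum_RtoC by auto. fold Zodd.
rewrite (Csum_exchange (block k t) (fun i => K * w32 i) w32) by (auto; apply ex_series_w32).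
pose proof (summable_eps t Ht) as Se. pose proof (summable_eps kt Hkt) as Sek.
pose proof (summable_blocks _ k Hk Sek) as Seb.
(* Convergence of the constants is read off from that of the column sums. *)
assert (Sk : summable (fun m => RtoC (kap_term k m))).
{ apply summable_ext with (fun m => (Csum (fun i => block k t i m) + eps_term t m
    - csum (fun r => eps_term kt (k * m + r)) k)%C).
  - intros m. rewrite col_eq. ring.
  - apply summable_minus; auto. now apply summable_plus. }
rewrite (Csum_ext _ _ col_eq).
rewrite Csum_plus by (auto; now apply summable_minus).
rewrite Csum_minus by auto. rewrite <- (Csum_blocks (eps_term kt) k Hk Sek).
rewrite Csum_RtoC. fold (kap k). fold (Eps t). fold (Eps kt).
assert (NK : RtoC (INR k) <> RtoC 0) by (apply RtoC_INR_neq_0; lia).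
rewrite !RtoC_mult, RtoC_minus, RtoC_inv by (apply not_0_INR; lia).
field. split; [auto|now apply Re_pos_neq_0].
Qed.

End Main.

(** * Generating functions of overpartitions *)

(* Overpartitions with parts at most [m]: [prev] counts those with parts below [m]; [cont]
   counts the possible remainders after a first occurrence of [m]. The first argument
   [fuel >= n] only serves termination. *)
Fixpoint cont (m : nat) (prev : nat -> nat) (fuel n : nat) : nat :=
  (prev n + match fuel with
            | O => 0
            | S f => if (m <=? n)%nat then cont m prev f (n - m) else 0
            end)%nat.

(** The factor 2 is the choice of an overline on the first occurrence of m. *)
Definition add_part (m : nat) (prev : nat -> nat) (n : nat) : nat :=
  (prev n + 2 * if (m <=? n)%nat then cont m prev (n - m) (n - m) else 0)%nat.

(** For k = 0 the divisibility test always fails, as [m mod 0 = m]; thus [cpart 0] counts all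
    overpartitions, which is the case that Gauss's identity concerns. *)
Fixpoint cpart (k M : nat) : nat -> nat :=
  match M with
  | O => fun n => if (n =? 0)%nat then 1%nat else 0%nat
  | S m => if (S m mod k =? 0)%nat then cpart k m else add_part (S m) (cpart k m)
  end.

Definition pk (k n : nat) : nat := cpart k n n.

Lemma cont_fuel m prev f n : (0 < m)%nat -> (n <= f)%nat ->
  cont m prev f n = cont m prev n n.
Proof.
intros Hm. revert n. induction f as [f IH] using (well_founded_induction lt_wf). intros n Hn.
destruct f as [|f]; [replace n with O by lia; reflexivity|].
destruct n as [|n].
- simpl. destruct m; [lia|reflexivity].
- simpl. f_equal. destruct m as [|m]; [lia|].
  destruct (Nat.leb_spec (S m) (S n)); [|reflexivity].
  rewrite (IH f) by lia. symmetry. apply (IH n); lia.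
Qed.

Lemma cont_rec m prev n : (0 < m)%nat ->
  cont m prev n n = (prev n + if (m <=? n)%nat then cont m prev (n - m) (n - m) else 0)%nat.
Proof.
intros Hm. destruct n as [|n].
- simpl. destruct m; [lia|reflexivity].
- simpl cont at 1. f_equal. destruct (Nat.leb_spec m (S n)); [|reflexivity].
  apply cont_fuel; lia.
Qed.

Lemma step_cont m prev n : (0 < m)%nat ->
  add_part m prev n = (cont m prev n n + if (m <=? n)%nat then cont m prev (n - m) (n - m) else 0)%nat.
Proof. intros Hm. unfold add_part. rewrite (cont_rec m prev n) by auto. lia. Qed.

Definition shiftC (m : nat) (a : nat -> C) (n : nat) : C := if (m <=? n)%nat then a (n - m)%nat else 0%C.

Lemma shiftC_sum m a : summable a -> summable (shiftC m a) /\ Csum (shiftC m a) = Csum a.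
Proof.
intros Ha.
assert (Z : csum (shiftC m a) m = 0%C).
{ rewrite (csum_ext _ (fun _ => 0%C)); [rewrite csum_const; ring|].
  intros n Hn. unfold shiftC. destruct (Nat.leb_spec m n); [lia|reflexivity]. }
assert (E : forall n, shiftC m a (m + n) = a n).
{ intros n. unfold shiftC. destruct (Nat.leb_spec m (m + n)); [|lia]. f_equal. lia. }
assert (S : summable (shiftC m a)).
{ unfold summable. apply (ex_series_incr_n _ m).
  apply ex_series_ext with (fun n => Cmod (a n)); [intros; now rewrite E|auto]. }
split; auto. rewrite (Csum_csum _ m) by auto. rewrite Z, (Csum_ext _ _ E). ring.
Qed.

Definition gterm (u : nat -> nat) (z : C) (n : nat) : C := (RtoC (INR (u n)) * z ^ n)%C.

Lemma Cmod_gterm u z n : Cmod (gterm u z n) = INR (u n) * Cmod z ^ n.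
Proof. unfold gterm. rewrite Cmod_mult, Cmod_R, Cmod_pow, Rabs_pos_eq; auto. apply pos_INR. Qed.

Lemma gterm_shift m u z n :
  (z ^ m * (if (m <=? n)%nat then gterm u z (n - m) else 0) =
   gterm (fun n => if (m <=? n)%nat then u (n - m)%nat else O) z n)%C.
Proof.
unfold gterm. destruct (Nat.leb_spec m n); [|simpl; ring].
assert (E : (z ^ n = z ^ m * z ^ (n - m))%C) by (rewrite <- Cpow_add_r; f_equal; lia).
rewrite E. ring.
Qed.

(** The recursion for [cont] bounds the N-th partial sum S by P + r^m S, with P the sum for [prev],
    hence by P / (1 - r^m). *)
Lemma cont_summable m prev z : (0 < m)%nat -> Cmod z < 1 ->
  summable (gterm prev z) -> summable (gterm (fun n => cont m prev n n) z).
Proof.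
intros Hm Hz Hp. set (U := fun n => cont m prev n n).
pose proof (Cmod_ge_0 z) as Pz. set (r := Cmod z) in *.
assert (Hr : r ^ m < 1) by (apply pow_lt_1_compat; auto).
assert (Pr : 0 <= r ^ m) by now apply pow_le.
set (P := Series (fun n => Cmod (gterm prev z n))).
assert (B : forall N, rsum (fun n => Cmod (gterm U z n)) N <= P + r ^ m * rsum (fun n => Cmod (gterm U z n)) N).
{ intros N.
  assert (Epos : forall n, Cmod (gterm U z n) = Cmod (gterm prev z n) + r ^ m * Cmod (shiftC m (gterm U z) n)).
  { intros n. unfold r. rewrite <- Cmod_pow, <- Cmod_mult. unfold shiftC. rewrite gterm_shift.
    rewrite !Cmod_gterm. unfold U. rewrite (cont_rec m prev n), plus_INR by auto. ring. }
  apply Rle_trans with (rsum (fun n => Cmod (gterm prev z n) + r ^ m * Cmod (shiftC m (gterm U z) n)) N).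
  { right. apply rsum_ext. intros; apply Epos. }
    rewrite rsum_plus, rsum_scal. apply Rplus_le_compat.
    + apply rsum_le_Series; auto. intros; apply Cmod_ge_0.
    + apply Rmult_le_compat_l; auto.
      destruct (Nat.le_gt_cases m N) as [L|L].
      * replace N with (m + (N - m))%nat at 1 by lia. rewrite rsum_split.
        rewrite (rsum_ext _ (fun _ => 0)), rsum_const.
        -- rewrite (rsum_ext _ (fun n => Cmod (gterm U z n))).
           ++ rewrite Rmult_0_r, Rplus_0_l. apply rsum_le_mono; [intros; apply Cmod_ge_0|lia].
           ++ intros n _. unfold shiftC. destruct (Nat.leb_spec m (m + n)); [|lia]. do 2 f_equal. lia.
        -- intros n Hn. unfold shiftC. destruct (Nat.leb_spec m n); [lia|apply Cmod_0].
      * rewrite (rsum_ext _ (fun _ => 0)), rsum_const.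
        -- rewrite Rmult_0_r. apply rsum_nonneg. intros; apply Cmod_ge_0.
        -- intros n Hn. unfold shiftC. destruct (Nat.leb_spec m n); [lia|apply Cmod_0]. }
apply (Series_le_bound _ (P / (1 - r ^ m))).
- intros; apply Cmod_ge_0.
- intros N. specialize (B N). apply Rle_div_r; [lra|]. lra.
Qed.

(** With U the generating function of [cont], that of [prev] is (1 - z^m) U by [cont_rec] and that
    of [add_part] is (1 + z^m) U by [step_cont]. *)
Lemma step_gf m prev z : (0 < m)%nat -> Cmod z < 1 -> summable (gterm prev z) ->
  summable (gterm (add_part m prev) z) /\
  Csum (gterm (add_part m prev) z) = ((1 + z ^ m) / (1 - z ^ m) * Csum (gterm prev z))%C.
Proof.
intros Hm Hz Hp. set (U := fun n => cont m prev n n).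
assert (SU : summable (gterm U z)) by now apply cont_summable.
destruct (shiftC_sum m _ SU) as [SS ES].
assert (E1 : forall n, gterm prev z n = (gterm U z n - z ^ m * shiftC m (gterm U z) n)%C).
{ intros n. unfold shiftC. rewrite gterm_shift. unfold gterm, U. rewrite (cont_rec m prev n), plus_INR, RtoC_plus by auto. ring. }
assert (E2 : forall n, gterm (add_part m prev) z n = (gterm U z n + z ^ m * shiftC m (gterm U z) n)%C).
{ intros n. unfold shiftC. rewrite gterm_shift. unfold gterm, U. rewrite (step_cont m prev n), plus_INR, RtoC_plus by auto. ring. }
assert (NZ : (1 - z ^ m <> 0)%C).
{ apply C1_minus_neq_0. rewrite Cmod_pow. apply pow_lt_1_compat; auto. split; [apply Cmod_ge_0|auto]. }
split.
- apply summable_ext with (fun n => (gterm U z n + z ^ m * shiftC m (gterm U z) n)%C); [auto|].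
  apply summable_plus; auto. now apply summable_scal.
- rewrite (Csum_ext _ _ E1), (Csum_ext _ _ E2).
  rewrite Csum_plus, Csum_minus, Csum_scal, ES by (auto; now apply summable_scal).
  field. auto.
Qed.

(** * The logarithm of the generating function *)

Definition regular (k m : nat) : C := if (S m mod k =? 0)%nat then 0%C else 1%C.

Definition log_part (k : nat) (z : C) (m : nat) : C := (regular k m * Csum (odd_term (z ^ S m)%C))%C.

Lemma Cmod_pow_S_lt_1 z m : Cmod z < 1 -> Cmod (z ^ S m)%C < 1.
Proof. intros H. rewrite Cmod_pow. apply pow_lt_1_compat; [split; [apply Cmod_ge_0|auto]|lia]. Qed.

Lemma cpart_gf k M z : Cmod z < 1 ->
  summable (gterm (cpart k M) z) /\ Csum (gterm (cpart k M) z) = Cexp (csum (log_part k z) M).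
Proof.
intros Hz. induction M as [|M [IS IE]].
- destruct (Csum_finite (gterm (cpart k 0) z) 1) as [S E].
  + intros n Hn. unfold gterm. simpl. destruct (Nat.eqb_spec n 0); [lia|]. simpl. ring.
  + split; auto. rewrite E. simpl csum at 2. rewrite Cexp_0, csum_1. unfold gterm. simpl. ring.
- simpl cpart. simpl csum. unfold log_part at 2, regular.
  destruct (S M mod k =? 0)%nat.
  + split; auto. rewrite IE. f_equal. ring.
  + destruct (step_gf (S M) (cpart k M) z ltac:(lia) Hz IS) as [S E]. split; auto.
    rewrite E, IE, Cexp_plus, Cmult_1_l, <- artanh_series by now apply Cmod_pow_S_lt_1. ring.
Qed.

Lemma cpart_le_S k M n : (cpart k M n <= cpart k (S M) n)%nat.
Proof. simpl. destruct (S M mod k =? 0)%nat; [lia|]. unfold add_part. lia. Qed.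

Lemma cpart_eq_S k M n : (n <= M)%nat -> cpart k (S M) n = cpart k M n.
Proof.
intros H. cbn [cpart]. destruct (S M mod k =? 0)%nat; [reflexivity|]. unfold add_part.
destruct (Nat.leb_spec (S M) n); lia.
Qed.

Lemma cpart_pk k M n : (n <= M)%nat -> cpart k M n = pk k n.
Proof.
intros H. unfold pk. replace M with (n + (M - n))%nat by lia. generalize (M - n)%nat as d.
intros d; induction d as [|d IH]; [f_equal; lia|].
rewrite Nat.add_succ_r, cpart_eq_S by lia. exact IH.
Qed.

Lemma cpart_le_pk k M n : (cpart k M n <= pk k n)%nat.
Proof.
destruct (Nat.le_gt_cases n M) as [L|L]; [rewrite cpart_pk; auto|].
unfold pk. replace n with (M + (n - M))%nat at 2 by lia. generalize (n - M)%nat as d.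
intros d; induction d as [|d IH]; [rewrite Nat.add_0_r; auto|].
eapply Nat.le_trans; [apply IH|]. rewrite Nat.add_succ_r. apply cpart_le_S.
Qed.

Definition odd_log_term (k : nat) (z : C) (m i : nat) : C := (regular k m * odd_term (z ^ S m)%C i)%C.

Lemma Cmod_regular k m : Cmod (regular k m) <= 1.
Proof. unfold regular. destruct (S m mod k =? 0)%nat; rewrite ?Cmod_0, ?Cmod_1; lra. Qed.

Lemma dbl_bound k z m i : Cmod z < 1 -> Cmod (odd_log_term k z m i) <= 2 * Cmod z ^ m * Cmod z ^ i.
Proof.
intros Hz. pose proof (Cmod_ge_0 z) as Pz. unfold odd_log_term. rewrite Cmod_mult.
apply Rle_trans with (1 * (2 * Cmod (z ^ S m)%C ^ (2 * i + 1))).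
- apply Rmult_le_compat; try apply Cmod_ge_0; [apply Cmod_regular|apply Cmod_odd_term].
- rewrite Rmult_1_l, Rmult_assoc. apply Rmult_le_compat_l; [lra|].
  rewrite Cmod_pow, <- pow_mult, <- pow_add.
  set (r := Cmod z) in *. replace (S m * (2 * i + 1))%nat with ((m + i) + (1 + i + 2 * m * i))%nat by lia.
  rewrite pow_add. rewrite <- (Rmult_1_r (r ^ (m + i))) at 2.
  apply Rmult_le_compat_l; [now apply pow_le|].
  rewrite <- (pow1 (1 + i + 2 * m * i)). apply pow_incr. lra.
Qed.

Lemma ex_series_pow r : 0 <= r < 1 -> ex_series (fun n => r ^ n).
Proof. intros H. apply ex_series_geom. rewrite Rabs_pos_eq; lra. Qed.

Lemma log_part_sum k z : Cmod z < 1 ->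
  summable (log_part k z) /\
  Csum (log_part k z) = Csum (fun i => Csum (fun m => odd_log_term k z m i)).
Proof.
intros Hz. pose proof (Cmod_ge_0 z) as Pz.
assert (E : forall m, log_part k z m = Csum (odd_log_term k z m)).
{ intros m. unfold log_part, odd_log_term. rewrite Csum_scal; auto. apply summable_odd_term, Cmod_pow_S_lt_1, Hz. }
assert (D : forall m i, Cmod (odd_log_term k z m i) <= 2 * Cmod z ^ m * Cmod z ^ i) by (intros; now apply dbl_bound).
assert (E1 : ex_series (fun m => 2 * Cmod z ^ m)) by (apply (ex_series_scal_l (V := R_NormedModule)), ex_series_pow; lra).
assert (E2 : ex_series (fun m => Cmod z ^ m)) by (apply ex_series_pow; lra).
assert (P1 : forall m, 0 <= 2 * Cmod z ^ m) by (intros; apply Rmult_le_pos; [lra|now apply pow_le]).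
assert (P2 : forall m, 0 <= Cmod z ^ m) by (intros; now apply pow_le).
split.
- apply summable_ext with (fun m => Csum (odd_log_term k z m)); [intros; now rewrite E|].
  now apply (rows_summable _ _ _ D).
- rewrite (Csum_ext _ _ E). now apply (Csum_exchange _ _ _ D).
Qed.

(** The multiples of k are subtracted from the full geometric series; in each block of k consecutive
    exponents only the last is such a multiple. *)
Lemma regular_geom k (w : C) : (1 <= k)%nat -> Cmod w < 1 ->
  Csum (fun m => regular k m * w ^ S m)%C = (w / (1 - w) - w ^ k / (1 - w ^ k))%C.
Proof.
intros Hk Hw.
assert (Hwk : Cmod (w ^ k)%C < 1) by (destruct k; [lia|now apply Cmod_pow_S_lt_1]).
assert (S1 : summable (fun m => w ^ S m)%C) by (apply (summable_tail (fun n => w ^ n)%C 1), summable_geom, Hw).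
set (b := fun m => ((1 - regular k m) * w ^ S m)%C).
assert (S2 : summable b).
{ apply summable_le with (fun m => Cmod w ^ S m).
  - intros m. unfold b, regular. rewrite Cmod_mult, Cmod_pow.
    pose proof (pow_le (Cmod w) (S m) (Cmod_ge_0 w)).
    destruct (S m mod k =? 0)%nat.
    + replace (1 - 0)%C with (RtoC 1) by ring. rewrite Cmod_1. lra.
    + replace (1 - 1)%C with (RtoC 0) by ring. rewrite Cmod_0. lra.
  - apply (ex_series_tail (fun n => Cmod w ^ n) 1), ex_series_pow. split; [apply Cmod_ge_0|auto]. }
rewrite (Csum_ext _ (fun m => (w ^ S m - b m)%C)).
2:{ intros m. unfold b. ring. }
rewrite Csum_minus by auto. f_equal.
- rewrite (Csum_ext _ (fun m => (w * w ^ m)%C)) by reflexivity.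
  rewrite Csum_scal, Csum_geom by (auto; now apply summable_geom). reflexivity.
- rewrite (Csum_blocks b k) by auto.
  rewrite (Csum_ext _ (fun m => (w ^ k * (w ^ k) ^ m)%C)).
  + rewrite Csum_scal, Csum_geom by (auto; now apply summable_geom). reflexivity.
  + intros m. destruct k as [|k']; [lia|]. cbn [csum].
    rewrite (csum_ext _ (fun _ => 0%C)).
    * rewrite csum_const. unfold b, regular.
      assert (Em : S (S k' * m + k') = (S m * S k')%nat) by lia. rewrite Em.
      rewrite Nat.Div0.mod_mul. simpl (0 =? 0)%nat. cbv iota.
      rewrite Nat.mul_comm, Cpow_mult_r. rewrite Cpow_S. ring.
    * intros i Hi. unfold b, regular.
      assert (Ei : (S (S k' * m + i) mod S k' = S i)%nat).
      { replace (S (S k' * m + i)) with (S i + m * S k')%nat by lia.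
        rewrite Nat.Div0.mod_add. apply Nat.mod_small. lia. }
      rewrite Ei. simpl. ring.
Qed.

(** The logarithm with its two sums exchanged: the outer one runs over odd j, and the inner one over
    the parts has been evaluated as two geometric series. *)
Definition log_fk (k : nat) (z : C) : C :=
  Csum (fun i => RtoC (2 / oddR i) * (z ^ (2 * i + 1) / (1 - z ^ (2 * i + 1))
    - (z ^ (2 * i + 1)) ^ k / (1 - (z ^ (2 * i + 1)) ^ k)))%C.

Lemma log_fk_row k z i : (1 <= k)%nat -> Cmod z < 1 ->
  (RtoC (2 / oddR i) * (z ^ (2 * i + 1) / (1 - z ^ (2 * i + 1))
    - (z ^ (2 * i + 1)) ^ k / (1 - (z ^ (2 * i + 1)) ^ k)) = Csum (fun m => odd_log_term k z m i))%C.
Proof.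
intros Hk Hz.
assert (Hw : Cmod (z ^ (2 * i + 1))%C < 1) by (rewrite Nat.add_1_r; now apply Cmod_pow_S_lt_1).
rewrite <- regular_geom by auto.
assert (SR : summable (fun m => regular k m * (z ^ (2 * i + 1)) ^ S m)%C).
{ apply summable_le with (fun m => Cmod (z ^ (2 * i + 1))%C ^ S m).
  - intros m. rewrite Cmod_mult, (Cmod_pow (_ ^ _)%C). rewrite <- (Rmult_1_l (_ ^ S m)) at 2.
    apply Rmult_le_compat_r; [apply pow_le, Cmod_ge_0|apply Cmod_regular].
  - apply (ex_series_tail (fun n => Cmod (z ^ (2 * i + 1))%C ^ n) 1), ex_series_pow.
    split; [apply Cmod_ge_0|auto]. }
rewrite <- Csum_scal by auto. apply Csum_ext. intros m. unfold odd_log_term, odd_term.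
fold (oddR i). rewrite <- !Cpow_mult_r, (Nat.mul_comm (S m)). ring.
Qed.

Lemma log_fk_summable k z : (1 <= k)%nat -> Cmod z < 1 ->
  summable (fun i => RtoC (2 / oddR i) * (z ^ (2 * i + 1) / (1 - z ^ (2 * i + 1))
    - (z ^ (2 * i + 1)) ^ k / (1 - (z ^ (2 * i + 1)) ^ k)))%C.
Proof.
intros Hk Hz. pose proof (Cmod_ge_0 z) as Pz.
apply summable_ext with (fun i => Csum (fun m => odd_log_term k z m i)).
{ intros i. now rewrite log_fk_row. }
apply (rows_summable (fun i m => odd_log_term k z m i) (fun i => Cmod z ^ i) (fun m => 2 * Cmod z ^ m)).
- intros i m. rewrite Rmult_comm. now apply dbl_bound.
- apply ex_series_pow; lra.
- apply (ex_series_scal_l (V := R_NormedModule)), ex_series_pow; lra.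
Qed.

Lemma log_part_log_fk k z : (1 <= k)%nat -> Cmod z < 1 -> Csum (log_part k z) = log_fk k z.
Proof.
intros Hk Hz. rewrite (proj2 (log_part_sum k z Hz)). apply Csum_ext. intros i.
now rewrite <- log_fk_row.
Qed.

Lemma Clim_Cexp u l : Clim u l -> Clim (fun n => Cexp (u n)) (Cexp l).
Proof.
intros H.
assert (H1 : Clim (fun n => (Cexp (u n - l) - 1)%C) 0%C).
{ intros eps He. destruct (H (Rmin 1 (eps / exp 1))) as [N0 K].
  { apply Rmin_pos; [lra|]. apply Rdiv_lt_0_compat; [auto|apply exp_pos]. }
  exists N0. intros N L. specialize (K N L). pose proof (exp_pos 1) as P1.
  replace (Cexp (u N - l) - 1 - 0)%C with (Cexp (u N - l) - 1)%C by ring.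
  eapply Rle_trans; [apply Cexp_minus_1_bound|].
  assert (K1 : Cmod (u N - l) <= 1) by (eapply Rle_trans; [apply K|apply Rmin_l]).
  assert (K2 : Cmod (u N - l) <= eps / exp 1) by (eapply Rle_trans; [apply K|apply Rmin_r]).
  assert (exp (Cmod (u N - l)) <= exp 1).
  { destruct (Rle_lt_or_eq_dec _ _ K1) as [L'|L']; [apply Rlt_le, exp_increasing; auto|rewrite L'; lra]. }
  apply Rle_trans with (eps / exp 1 * exp 1).
  - apply Rmult_le_compat; auto; [apply Cmod_ge_0|apply Rlt_le, exp_pos].
  - right. field. lra. }
apply Clim_ext with (fun n => (Cexp l * (Cexp (u n - l) - 1) + Cexp l)%C).
- intros n. transitivity (Cexp l * Cexp (u n - l))%C; [ring|]. rewrite <- Cexp_plus. f_equal. ring.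
- match goal with |- Clim ?F _ => cut (Clim F (Cexp l * 0 + Cexp l)%C) end.
  { intros K. replace (Cexp l * 0 + Cexp l)%C with (Cexp l) in K by ring. exact K. }
  apply Clim_plus; [now apply Clim_scal|apply Clim_const].
Qed.

Lemma exp_le_exp x y : x <= y -> exp x <= exp y.
Proof. intros [H|H]; [apply Rlt_le, exp_increasing, H|rewrite H; lra]. Qed.

(** Coefficients below N of [pk k] and [cpart k N] agree, and the latter series at |z| is at most
    the exponential of the sum of all moduli in the logarithm; so partial sums stay bounded. Then
    [pk k] itself dominates every [cpart k M], and Tannery's theorem gives the limit. *)
Theorem pk_gf k z : Cmod z < 1 ->
  summable (gterm (pk k) z) /\
  Clim (fun M => Csum (gterm (cpart k M) z)) (Csum (gterm (pk k) z)) /\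
  Csum (gterm (pk k) z) = Cexp (Csum (log_part k z)).
Proof.
intros Hz. pose proof (Cmod_ge_0 z) as Pz.
set (r := RtoC (Cmod z)).
assert (Hr : Cmod r < 1) by (unfold r; rewrite Cmod_R, Rabs_pos_eq; auto).
assert (S : summable (gterm (pk k) z)).
{ apply (Series_le_bound _ (exp (Series (fun m => Cmod (log_part k r m))))).
  - intros; apply Cmod_ge_0.
  - intros N. apply Rle_trans with (Cmod (Csum (gterm (cpart k N) r))).
    + destruct (cpart_gf k N r Hr) as [SN _].
      rewrite (Csum_ext _ (fun n => RtoC (INR (cpart k N n) * Cmod z ^ n))).
      2:{ intros n. unfold gterm, r. rewrite RtoC_mult, RtoC_pow. reflexivity. }
      rewrite Csum_RtoC, Cmod_R. eapply Rle_trans; [|apply Rle_abs].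
      assert (P : forall n, 0 <= INR (cpart k N n) * Cmod z ^ n).
      { intros n. apply Rmult_le_pos; [apply pos_INR|now apply pow_le]. }
      rewrite (rsum_ext _ (fun n => INR (cpart k N n) * Cmod z ^ n)).
      * apply rsum_le_Series; auto.
        apply ex_series_ext with (2 := SN). intros n. rewrite Cmod_gterm. unfold r.
        rewrite Cmod_R, Rabs_pos_eq; auto.
      * intros n Hn. rewrite Cmod_gterm, cpart_pk by lia. reflexivity.
    + destruct (cpart_gf k N r Hr) as [_ EN]. rewrite EN, Cmod_Cexp. apply exp_le_exp.
      eapply Rle_trans; [|eapply Rle_trans; [apply csum_Cmod|]].
      * eapply Rle_trans; [apply Rle_abs|apply Rabs_Re_le].
      * apply rsum_le_Series; [intros; apply Cmod_ge_0|]. apply (log_part_sum k r Hr). }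
assert (L : Clim (fun M => Csum (gterm (cpart k M) z)) (Csum (gterm (pk k) z))).
{ apply tannery with (fun n => Cmod (gterm (pk k) z n)) O O; auto.
  + intros N _. now apply cpart_gf.
  + intros m. apply (Clim_ext_ev m (fun _ => gterm (pk k) z m)); [|apply Clim_const].
    intros n Hn. unfold gterm. now rewrite cpart_pk.
  + intros N m _ _. rewrite !Cmod_gterm. apply Rmult_le_compat_r; [now apply pow_le|].
    apply le_INR, cpart_le_pk. }
repeat split; auto.
apply (Clim_unique _ _ _ L).
apply Clim_ext with (fun M => Cexp (csum (log_part k z) M)).
- intros M. symmetry. now apply cpart_gf.
- apply Clim_Cexp, Clim_csum. now apply log_part_sum.
Qed.

Theorem fk_exp k z : (1 <= k)%nat -> Cmod z < 1 ->
  summable (gterm (pk k) z) /\ Csum (gterm (pk k) z) = Cexp (log_fk k z).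
Proof.
intros Hk Hz. destruct (pk_gf k z Hz) as [S [_ E]]. now rewrite <- log_part_log_fk.
Qed.

(** * The Lipschitz summation formula and the Bessel comparison series *)

Lemma Cpow_inv_S (v : C) j : v <> RtoC 0 -> (/ v ^ S j = / v * (/ v) ^ j)%C.
Proof. intros H. rewrite Cpow_S, Cpow_inv by auto. field. split; [now apply Cpow_nz|auto]. Qed.

Lemma geom_expansion (v : C) s : Rabs s < Cmod v ->
  summable (fun j => RtoC (s ^ j) * / v ^ S j)%C /\
  Csum (fun j => RtoC (s ^ j) * / v ^ S j)%C = (/ (v - RtoC s))%C.
Proof.
intros H. assert (Pv : 0 < Cmod v) by (pose proof (Rabs_pos s); lra).
assert (NZ : v <> RtoC 0) by (apply Cmod_gt_0; auto).
assert (Hq : Cmod (RtoC s / v) < 1).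
{ rewrite Cmod_div, Cmod_R by auto. apply Rlt_div_l; lra. }
assert (E : forall j, (RtoC (s ^ j) * / v ^ S j = / v * (RtoC s / v) ^ j)%C).
{ intros j. unfold Cdiv. rewrite Cpow_mult_l, RtoC_pow, Cpow_inv_S by auto. ring. }
assert (SS := summable_geom _ Hq).
split.
- eapply summable_ext; [intros j; symmetry; apply E|]. now apply summable_scal.
- rewrite (Csum_ext _ _ E), Csum_scal, Csum_geom by auto.
  assert (N1 := C1_minus_neq_0 _ Hq).
  assert (N2 : (v - RtoC s <> 0)%C).
  { intros E0. apply N1. replace (RtoC s) with v; [field; auto|].
    replace v with (v - RtoC s + RtoC s)%C by ring. rewrite E0. ring. }
  field. auto.
Qed.

Lemma summable_term_bound a n : summable a -> Cmod (a n) <= Series (fun n => Cmod (a n)).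
Proof.
intros H. pose proof (rsum_le_Series (fun n => Cmod (a n)) (S n) (fun n => Cmod_ge_0 _) H) as B.
simpl in B. assert (0 <= rsum (fun n => Cmod (a n)) n) by (apply rsum_nonneg; intros; apply Cmod_ge_0). lra.
Qed.

Lemma power_series_unique (a b : nat -> C) r : 0 < r ->
  (forall s, Rabs s < r -> summable (fun j => RtoC (s ^ j) * a j)%C /\ summable (fun j => RtoC (s ^ j) * b j)%C /\
    Csum (fun j => RtoC (s ^ j) * a j)%C = Csum (fun j => RtoC (s ^ j) * b j)%C) ->
  forall j, a j = b j.
Proof.
intros Hr H j.
assert (CV : forall (c : nat -> C) (g : C -> R), (forall z, Rabs (g z) <= Cmod z) ->
  summable (fun j => RtoC ((r / 2) ^ j) * c j)%C -> Rbar_lt 0 (CV_radius (fun n => g (c n)))).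
{ intros c g Hg Sc. rewrite <- Rabs_R0.
  apply (CV_radius_gt _ (r / 2) (Series (fun n => Cmod (RtoC ((r / 2) ^ n) * c n)%C))).
  - rewrite Rabs_R0. lra.
  - intros n. eapply Rle_trans; [|apply (summable_term_bound _ n Sc)].
    rewrite Cmod_mult, Cmod_R. rewrite (Rmult_comm (Rabs _)), (Rabs_pos_eq ((r / 2) ^ n)) by (apply pow_le; lra).
    apply Rmult_le_compat_l; [apply pow_le; lra|auto]. }
destruct (H (r / 2)) as [Sa [Sb _]]; [rewrite Rabs_pos_eq; lra|].
assert (L : forall s : R, Rabs s < r ->
  PSeries (fun n => Re (a n)) s = PSeries (fun n => Re (b n)) s /\
  PSeries (fun n => Im (a n)) s = PSeries (fun n => Im (b n)) s).
{ intros s Hs. destruct (H s Hs) as [_ [_ E]]. rewrite !Csum_PSeries in E. injection E; auto. }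
assert (Loc : locally 0 (fun x => Rabs x < r)).
{ exists (mkposreal r Hr). intros y Hy. unfold ball in Hy; simpl in Hy. unfold AbsRing_ball, abs, minus, plus, opp in Hy; simpl in Hy.
  rewrite Ropp_0, Rplus_0_r in Hy. exact Hy. }
apply C_ext.
- apply (PSeries_ext_recip (fun n => Re (a n)) (fun n => Re (b n)) j).
  + apply (CV a Re Rabs_Re_le Sa).
  + apply (CV b Re Rabs_Re_le Sb).
  + apply (filter_imp (fun x => Rabs x < r)); [intros x Hx; now apply L|exact Loc].
- apply (PSeries_ext_recip (fun n => Im (a n)) (fun n => Im (b n)) j).
  + apply (CV a Im Rabs_Im_le Sa).
  + apply (CV b Im Rabs_Im_le Sb).
  + apply (filter_imp (fun x => Rabs x < r)); [intros x Hx; now apply L|exact Loc].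
Qed.

Section Lipschitz.

Variable t : C.

Hypothesis Ht : 0 < Re t.

Hypothesis HI : Rabs (Im t) <= PI.

Let z : C := Cexp (- t).

Let t0 : R := Re t.

Definition monomial_sum (j : nat) : C := Csum (fun n => RtoC (INR n ^ j / INR (fact j)) * z ^ n)%C.

Lemma Cmod_z : Cmod z = exp (- t0).
Proof. unfold z. rewrite Cmod_Cexp. reflexivity. Qed.

(** From (n d)^j / j! <= exp (n d): the power n^j / j! costs a part d of the exponential decay and a
    factor d^(-j). *)
Lemma monomial_bound d n j : 0 < d ->
  Cmod (RtoC (INR n ^ j / INR (fact j)) * z ^ n)%C <= / d ^ j * exp (- (t0 - d)) ^ n.
Proof.
intros Hd. rewrite Cmod_mult, Cmod_pow, Cmod_z, Cmod_R, Rabs_pos_eq by (apply pow_div_fact_pos, pos_INR).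
rewrite !exp_pow_INR.
apply Rle_trans with (/ d ^ j * exp (INR n * d) * exp (INR n * - t0)).
- apply Rmult_le_compat_r; [apply Rlt_le, exp_pos|].
  apply Rle_trans with (/ d ^ j * ((INR n * d) ^ j / INR (fact j))).
  + right. rewrite Rpow_mult_distr. field. split; [apply INR_fact_neq_0|apply pow_nonzero; lra].
  + apply Rmult_le_compat_l; [apply Rlt_le, Rinv_0_lt_compat, pow_lt; auto|].
    apply pow_div_fact_le. apply Rmult_le_pos; [apply pos_INR|lra].
- right. rewrite Rmult_assoc, <- exp_plus. do 2 f_equal. ring.
Qed.

Lemma ex_series_expd d : d < t0 -> ex_series (fun n => exp (- (t0 - d)) ^ n).
Proof.
intros Hd. apply ex_series_pow. split; [apply Rlt_le, exp_pos|].
rewrite <- exp_0. apply exp_increasing. lra.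
Qed.

Lemma monomial_side s : Rabs s < t0 ->
  summable (fun j => RtoC (s ^ j) * monomial_sum j)%C /\
  Csum (fun j => RtoC (s ^ j) * monomial_sum j)%C = (/ (1 - Cexp (- (t - RtoC s))))%C.
Proof.
intros Hs. pose proof (Rabs_pos s) as Ps.
(* Strictly between |s| and t0, so that both ratios |s| / d and exp (- (t0 - d)) are below 1. *)
set (d := (Rabs s + t0) / 2). assert (Hd : Rabs s < d < t0) by (unfold d; lra).
set (a := fun n j => (RtoC (s ^ j) * (RtoC (INR n ^ j / INR (fact j)) * z ^ n))%C).
assert (D : forall n j, Cmod (a n j) <= exp (- (t0 - d)) ^ n * (Rabs s / d) ^ j).
{ intros n j. unfold a. rewrite Cmod_mult, Cmod_R, <- RPow_abs.
  apply Rle_trans with (Rabs s ^ j * (/ d ^ j * exp (- (t0 - d)) ^ n)).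
  - apply Rmult_le_compat_l; [apply pow_le; lra|apply monomial_bound; lra].
  - right. unfold Rdiv. rewrite Rpow_mult_distr, pow_inv. ring. }
assert (D' : forall j n, Cmod (a n j) <= (Rabs s / d) ^ j * exp (- (t0 - d)) ^ n) by (intros; rewrite Rmult_comm; auto).
assert (E1 := ex_series_expd d (proj2 Hd)).
assert (Q : 0 <= Rabs s / d < 1).
{ split; [apply Rdiv_le_0_compat; lra|apply Rlt_div_l; lra]. }
assert (E2 := ex_series_pow _ Q).
assert (P1 : forall n, 0 <= exp (- (t0 - d)) ^ n) by (intros; apply pow_le, Rlt_le, exp_pos).
assert (P2 : forall n, 0 <= (Rabs s / d) ^ n) by (intros; now apply pow_le).
assert (Ej : forall j, Csum (fun n => a n j) = (RtoC (s ^ j) * monomial_sum j)%C).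
{ intros j. unfold a, monomial_sum. rewrite Csum_scal; auto.
  apply summable_le with (fun n => / d ^ j * exp (- (t0 - d)) ^ n).
  - intros n. apply monomial_bound; lra.
  - now apply (ex_series_scal_l (V := R_NormedModule)). }
split.
- apply summable_ext with (fun j => Csum (fun n => a n j)); [auto|].
  apply (rows_summable (fun j n => a n j) _ _ D'); auto.
- rewrite <- (Csum_ext _ _ Ej). rewrite <- (Csum_exchange a _ _ D) by auto.
  assert (Hw : Cmod (Cexp (- (t - RtoC s))) < 1).
  { rewrite Cmod_Cexp, <- exp_0. apply exp_increasing.
    change (- (t0 - s) < 0). pose proof (Rle_abs s). lra. }
  rewrite <- Csum_geom by auto. apply Csum_ext. intros n.
  unfold a. rewrite (Csum_ext _ (fun j => z ^ n * ((RtoC (INR n * s)) ^ j / RtoC (INR (fact j))))%C).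
  + rewrite Csum_scal by apply summable_Cexp. rewrite Cexp_series. unfold z.
    rewrite <- !Cexp_INR, <- Cexp_plus. f_equal. rewrite RtoC_mult. ring.
  + intros j. rewrite <- RtoC_pow, Rpow_mult_distr, RtoC_mult, RtoC_div by apply INR_fact_neq_0.
    unfold Cdiv. ring.
Qed.

Definition pole (m : nat) : R := 2 * PI * INR (m + 1).

Lemma pole_ge m : 6 * (INR m + 1) <= pole m.
Proof.
unfold pole. rewrite plus_INR. simpl (INR 1). pose proof (pos_INR m). pose proof PI2_3_2. nra.
Qed.

(** Here [Rabs (Im t) <= PI] enters: the nearest pole lies at height 2 pi, at least twice |Im t|, so
    t takes away at most half of |y|. *)
Lemma Cmod_pole y : pole 0 <= Rabs y -> Rabs y / 2 <= Cmod (t + imc y).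
Proof.
intros Hy. unfold pole in Hy. simpl in Hy. eapply Rle_trans; [|apply Rabs_Im_le].
simpl. pose proof (Rabs_triang_inv y (- Im t)) as T. rewrite Rabs_Ropp in T.
unfold Im in *. replace (y - - snd t) with (snd t + y) in T by ring. lra.
Qed.

Lemma Cmod_pole_t0 y : t0 <= Cmod (t + imc y).
Proof.
eapply Rle_trans; [|apply Rabs_Re_le]. eapply Rle_trans; [|apply Rle_abs].
unfold t0, Re. simpl. lra.
Qed.

(** Conjugate poles are paired because for j = 0 the sums over the upper and over the lower poles
    diverge separately. *)
Definition pair_term (m j : nat) : C :=
  (/ (t + imc (pole m)) ^ S j + / (t + imc (- pole m)) ^ S j)%C.

Lemma pole_neq_0 y : (t + imc y <> 0)%C.
Proof. apply Cmod_gt_0. pose proof (Cmod_pole_t0 y). unfold t0 in *. lra. Qed.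

Lemma pole_mono m : pole 0 <= pole m.
Proof.
unfold pole. apply Rmult_le_compat_l; [pose proof PI_RGT_0; lra|]. apply le_INR. lia.
Qed.

Lemma pole_lower m : 3 * (INR m + 1) <= Cmod (t + imc (pole m)) /\ 3 * (INR m + 1) <= Cmod (t + imc (- pole m)).
Proof.
pose proof (pole_ge m) as P. pose proof (pos_INR m) as Q. pose proof (pole_mono m) as M.
split.
- eapply Rle_trans; [|apply Cmod_pole]; rewrite Rabs_pos_eq; lra.
- eapply Rle_trans; [|apply Cmod_pole]; rewrite Rabs_Ropp, Rabs_pos_eq; lra.
Qed.

Lemma pair_term_0 m : pair_term m 0 = (2 * t / (t * t + RtoC (pole m ^ 2)))%C.
Proof.
unfold pair_term. simpl Cpow. pose proof (pole_neq_0 (pole m)). pose proof (pole_neq_0 (- pole m)).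
replace (t * t + RtoC (pole m ^ 2))%C with ((t + imc (pole m)) * (t + imc (- pole m)))%C.
- assert (E : (imc (- pole m) = - imc (pole m))%C) by (apply C_ext; simpl; ring).
  rewrite E in *. field. auto.
- destruct t as [u v]. unfold Cmult, Cplus, RtoC, imc; simpl. f_equal; ring.
Qed.

Lemma inv_pow_bound (x : R) (v : C) j : 0 < x -> x <= Cmod v -> v <> RtoC 0 ->
  Cmod (/ v ^ j) <= / x ^ j.
Proof.
intros Hx Hv Nv. rewrite Cmod_inv by now apply Cpow_nz. rewrite Cmod_pow.
apply Rinv_le_contravar; [now apply pow_lt|]. apply pow_incr; lra.
Qed.

Lemma pair_term_0_bound m : Cmod (pair_term m 0) <= Cmod t * / (INR m + 1) ^ 2.
Proof.
pose proof (pos_INR m) as Q. pose proof (pole_lower m) as [L1 L2].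
assert (E : pair_term m 0 = (2 * t * (/ (t + imc (pole m)) * / (t + imc (- pole m))))%C).
{ rewrite pair_term_0. pose proof (pole_neq_0 (pole m)). pose proof (pole_neq_0 (- pole m)).
  replace (t * t + RtoC (pole m ^ 2))%C with ((t + imc (pole m)) * (t + imc (- pole m)))%C.
  - field. auto.
  - destruct t as [u v]. unfold Cmult, Cplus, RtoC, imc; simpl. f_equal; ring. }
rewrite E, !Cmod_mult, !Cmod_inv, Cmod_R, Rabs_pos_eq by (try apply pole_neq_0; lra).
pose proof (Cmod_ge_0 t).
apply Rle_trans with (2 * Cmod t * (/ (3 * (INR m + 1)) * / (3 * (INR m + 1)))).
- apply Rmult_le_compat_l; [lra|]. apply Rmult_le_compat.
  + apply Rlt_le, Rinv_0_lt_compat; lra.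
  + apply Rlt_le, Rinv_0_lt_compat; lra.
  + apply Rinv_le_contravar; lra.
  + apply Rinv_le_contravar; lra.
- assert (0 < / (INR m + 1) ^ 2) by (apply Rinv_0_lt_compat, pow_lt; lra).
  replace (2 * Cmod t * (/ (3 * (INR m + 1)) * / (3 * (INR m + 1)))) with (2 / 9 * (Cmod t * / (INR m + 1) ^ 2)) by (field; lra).
  assert (0 <= Cmod t * / (INR m + 1) ^ 2) by (apply Rmult_le_pos; lra). lra.
Qed.

Lemma pair_term_S_bound m j : Cmod (pair_term m (S j)) <= 2 * / (INR m + 1) ^ 2.
Proof.
pose proof (pos_INR m) as Q. pose proof (pole_lower m) as [L1 L2].
unfold pair_term. eapply Rle_trans; [apply Cmod_triangle|].
assert (K : / (3 * (INR m + 1)) ^ S (S j) <= / (INR m + 1) ^ 2).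
{ apply Rinv_le_contravar; [apply pow_lt; lra|].
  apply Rle_trans with ((3 * (INR m + 1)) ^ 2); [apply pow_incr; lra|].
  apply Rle_pow; [lra|lia]. }
pose proof (inv_pow_bound (3 * (INR m + 1)) _ (S (S j)) ltac:(lra) L1 (pole_neq_0 _)).
pose proof (inv_pow_bound (3 * (INR m + 1)) _ (S (S j)) ltac:(lra) L2 (pole_neq_0 _)).
lra.
Qed.

(** Decay like t0^(-j) compensates the factor s^j for every |s| < t0; the bound uniform in j would
    not do so when |s| >= 1. *)
Lemma pair_term_S_bound_t0 m j : Cmod (pair_term m (S j)) <= 2 * / t0 ^ j * / (INR m + 1) ^ 2.
Proof.
pose proof (pos_INR m) as Q. pose proof (pole_lower m) as [L1 L2].
assert (K : forall v, v <> RtoC 0 -> 3 * (INR m + 1) <= Cmod v -> t0 <= Cmod v ->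
  Cmod (/ v ^ S (S j)) <= / t0 ^ j * / (INR m + 1) ^ 2).
{ intros v Nv V1 V2. rewrite Cmod_inv by now apply Cpow_nz. rewrite Cmod_pow.
  rewrite <- Rinv_mult. unfold t0 in *. apply Rinv_le_contravar.
  - apply Rmult_lt_0_compat; apply pow_lt; lra.
  - replace (S (S j)) with (j + 2)%nat by lia. rewrite pow_add.
    apply Rmult_le_compat; try (apply pow_le; lra); apply pow_incr; lra. }
unfold pair_term. eapply Rle_trans; [apply Cmod_triangle|].
pose proof (K _ (pole_neq_0 (pole m)) L1 (Cmod_pole_t0 _)).
pose proof (K _ (pole_neq_0 (- pole m)) L2 (Cmod_pole_t0 _)). lra.
Qed.

Definition pair_sum (j : nat) : C := Csum (fun m => pair_term m j).

Lemma pair_summable j : summable (fun m => pair_term m j).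
Proof.
destruct j as [|j].
- apply summable_le with (fun m => Cmod t * / (INR m + 1) ^ 2); [apply pair_term_0_bound|].
  apply (ex_series_scal_l (V := R_NormedModule)), inv_sq_series.
- apply summable_le with (fun m => 2 * / (INR m + 1) ^ 2); [intros; apply pair_term_S_bound|].
  apply (ex_series_scal_l (V := R_NormedModule)), inv_sq_series.
Qed.

Lemma pair_sum_bound j : Cmod (pair_sum j) <= 2 * Cmod t + 4.
Proof.
pose proof (Cmod_ge_0 t) as P. pose proof inv_sq_series as [E1 E2].
destruct j as [|j].
- apply Rle_trans with (Cmod t * 2); [|lra].
  apply Rle_trans with (Series (fun m => Cmod t * / (INR m + 1) ^ 2)).
  + apply Csum_Cmod_le; [apply pair_term_0_bound|now apply (ex_series_scal_l (V := R_NormedModule))].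
  + rewrite Series_scal_l. now apply Rmult_le_compat_l.
- apply Rle_trans with (2 * 2); [|lra].
  apply Rle_trans with (Series (fun m => 2 * / (INR m + 1) ^ 2)).
  + apply Csum_Cmod_le; [intros; apply pair_term_S_bound|now apply (ex_series_scal_l (V := R_NormedModule))].
  + rewrite Series_scal_l. apply Rmult_le_compat_l; lra.
Qed.

(** The Taylor coefficients in s of 1 / (1 - exp (s - t)) = 1/2 + coth ((t - s) / 2) / 2: the
    constant, the pole at 0, and the pairs of other poles. *)
Definition pole_coeff (j : nat) : C :=
  ((if (j =? 0)%nat then / 2 else 0) + / t ^ S j + pair_sum j)%C.

Lemma pole_side s : Rabs s < t0 ->
  summable (fun j => RtoC (s ^ j) * pole_coeff j)%C /\
  Csum (fun j => RtoC (s ^ j) * pole_coeff j)%C = (/ (1 - Cexp (- (t - RtoC s))))%C.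
Proof.
intros Hs. pose proof (Rabs_pos s) as Ps. pose proof (Cmod_ge_0 t) as Pt.
assert (Hu : 0 < Re (t - RtoC s)%C).
{ change (0 < t0 - s). pose proof (Rle_abs s). lra. }
set (u := (t - RtoC s)%C) in *.
set (a := fun m j => (RtoC (s ^ j) * pair_term m j)%C).
set (K := Cmod t + 2 * t0).
assert (PK : 0 <= K) by (unfold K, t0; lra).
assert (D : forall m j, Cmod (a m j) <= (K * / (INR m + 1) ^ 2) * (Rabs s / t0) ^ j).
{ intros m j. unfold a. rewrite Cmod_mult, Cmod_R, <- RPow_abs.
  pose proof (pos_INR m) as Q.
  assert (Q2 : 0 < / (INR m + 1) ^ 2) by (apply Rinv_0_lt_compat, pow_lt; lra).
  destruct j as [|j].
  - simpl (_ ^ 0). rewrite Rmult_1_l, Rmult_1_r. eapply Rle_trans; [apply pair_term_0_bound|].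
    apply Rmult_le_compat_r; [lra|]. unfold K, t0. lra.
  - apply Rle_trans with (Rabs s ^ S j * (2 * / t0 ^ j * / (INR m + 1) ^ 2)).
    + apply Rmult_le_compat_l; [apply pow_le; auto|apply pair_term_S_bound_t0].
    + replace (Rabs s ^ S j * (2 * / t0 ^ j * / (INR m + 1) ^ 2)) with
       ((2 * t0 * / (INR m + 1) ^ 2) * (Rabs s / t0) ^ S j).
      * apply Rmult_le_compat_r; [apply pow_le, Rdiv_le_0_compat; lra|].
        apply Rmult_le_compat_r; [lra|]. unfold K; lra.
      * unfold Rdiv. rewrite Rpow_mult_distr, pow_inv. simpl. field.
        assert (t0 <> 0) by lra. assert (t0 ^ j <> 0) by now apply pow_nonzero.
        repeat split; auto; lra. }
assert (D' : forall j m, Cmod (a m j) <= (Rabs s / t0) ^ j * (K * / (INR m + 1) ^ 2)) by (intros; rewrite Rmult_comm; auto).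
assert (Q : 0 <= Rabs s / t0 < 1).
{ split; [apply Rdiv_le_0_compat; lra|apply Rlt_div_l; lra]. }
assert (E2 := ex_series_pow _ Q).
assert (E1 : ex_series (fun m => K * / (INR m + 1) ^ 2)) by (apply (ex_series_scal_l (V := R_NormedModule)), inv_sq_series).
assert (P1 : forall n, 0 <= K * / (INR n + 1) ^ 2).
{ intros n. apply Rmult_le_pos; auto. apply Rlt_le, Rinv_0_lt_compat, pow_lt. pose proof (pos_INR n); lra. }
assert (P2 : forall n, 0 <= (Rabs s / t0) ^ n) by (intros; now apply pow_le).
assert (Ej : forall j, Csum (fun m => a m j) = (RtoC (s ^ j) * pair_sum j)%C).
{ intros j. unfold a. apply Csum_scal, pair_summable. }
assert (S3 : summable (fun j => RtoC (s ^ j) * pair_sum j)%C).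
{ apply summable_ext with (fun j => Csum (fun m => a m j)); auto.
  apply (rows_summable (fun j m => a m j) _ _ D'); auto. }
assert (Ht0 : Rabs s < Cmod t).
{ apply Rlt_le_trans with t0; auto. eapply Rle_trans; [apply Rle_abs|apply Rabs_Re_le]. }
destruct (geom_expansion t s Ht0) as [S2 G2].
destruct (Csum_finite (fun j => RtoC (s ^ j) * (if (j =? 0)%nat then / 2 else 0))%C 1) as [S1 G1].
{ intros n Hn. destruct (Nat.eqb_spec n 0); [lia|ring]. }
assert (E : forall j, (RtoC (s ^ j) * pole_coeff j = RtoC (s ^ j) * (if (j =? 0)%nat then / 2 else 0)
   + RtoC (s ^ j) * / t ^ S j + RtoC (s ^ j) * pair_sum j)%C).
{ intros j. unfold pole_coeff. ring. }
assert (S12 := summable_plus _ _ S1 S2).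
split.
- eapply summable_ext; [intros j; symmetry; apply E|]. now apply summable_plus.
- rewrite (Csum_ext _ _ E), Csum_plus, Csum_plus by auto. rewrite G1, G2, csum_1.
  rewrite <- (Csum_ext _ _ Ej), <- (Csum_exchange a _ _ D) by auto.
  assert (Er : forall m, Csum (a m) = (/ 2 * (4 * u / (u * u + RtoC ((2 * PI * INR (m + 1)) ^ 2))))%C).
  { intros m. fold (pole m).
    assert (B : forall y, Rabs s < Cmod (t + imc y)) by (intros y; pose proof (Cmod_pole_t0 y); lra).
    destruct (geom_expansion _ s (B (pole m))) as [Sp Gp].
    destruct (geom_expansion _ s (B (- pole m))) as [Sn Gn].
    unfold a, pair_term.
    rewrite (Csum_ext _ (fun j => RtoC (s ^ j) * / (t + imc (pole m)) ^ S j + RtoC (s ^ j) * / (t + imc (- pole m)) ^ S j)%C)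
      by (intros; ring).
    rewrite Csum_plus, Gp, Gn by auto.
    replace (t + imc (pole m) - RtoC s)%C with (u + imc (pole m))%C by (unfold u; ring).
    replace (t + imc (- pole m) - RtoC s)%C with (u + imc (- pole m))%C by (unfold u; ring).
    assert (N1 : (u + imc (pole m) <> 0)%C) by (apply Re_pos_neq_0; unfold Re in *; simpl in *; lra).
    assert (N2 : (u + imc (- pole m) <> 0)%C) by (apply Re_pos_neq_0; unfold Re in *; simpl in *; lra).
    replace (u * u + RtoC (pole m ^ 2))%C with ((u + imc (pole m)) * (u + imc (- pole m)))%C.
    - assert (E0 : (imc (- pole m) = - imc (pole m))%C) by (apply C_ext; simpl; ring).
      rewrite E0 in *. field. auto.
    - destruct u as [x y]. unfold Cmult, Cplus, RtoC, imc; simpl. f_equal; ring. }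
  rewrite (Csum_ext _ _ Er), Csum_scal by (apply summable_pf; [pose proof PI_RGT_0; lra|auto]).
  pose proof (cth_partial_fractions u Hu) as PF.
  assert (Nu := Re_pos_neq_0 u Hu).
  replace (Csum (fun n => (4 * u / (u * u + RtoC ((2 * PI * INR (n + 1)) ^ 2)))%C)) with (cth u - 2 / u)%C
    by (rewrite PF; ring).
  simpl. unfold cth. rewrite Cexp_opp. fold u.
  pose proof (Cexp_neq_1 u Hu). pose proof (Cexp_neq_0 u). field. auto.
Qed.

(* Both sides are the [j]-th coefficient in [s] of [1 / (1 - exp (s - t))]: on the left expand
   the geometric series, on the right the partial fractions of [coth]. *)
Theorem lipschitz j : monomial_sum j = pole_coeff j.
Proof.
apply (power_series_unique _ _ t0); [exact Ht|].
intros s Hs. destruct (monomial_side s Hs) as [A1 A2]. destruct (pole_side s Hs) as [B1 B2].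
repeat split; auto. now rewrite A2, B2.
Qed.

End Lipschitz.

(* [bessel A x] is [sqrt (A / x) * I_1 (2 * sqrt (A * x))], with [I_1] the modified Bessel
   function. *)
Definition bessel_coeff (A : R) (j : nat) : R := A ^ S j / (INR (fact j) * INR (fact (S j))).

Definition bessel (A x : R) : R := PSeries (bessel_coeff A) x.

Lemma ex_series_exp_tail x : ex_series (fun j => x ^ S j / INR (fact (S j))).
Proof. apply (ex_series_tail (fun n => x ^ n / INR (fact n)) 1), ex_series_exp. Qed.

Lemma Series_exp_tail x : Series (fun j => x ^ S j / INR (fact (S j))) = exp x - 1.
Proof.
pose proof (exp_Series x) as E. rewrite Series_incr_1 in E by apply ex_series_exp. simpl fact in E.
simpl INR in E. simpl pow in E. rewrite <- E. unfold Rminus.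
transitivity (Series (fun k => x ^ S k / INR (fact (S k)))); [reflexivity|]. simpl. lra.
Qed.

(** After exchanging the sums over n and j, the Lipschitz formula replaces the sum of n^j z^n / j!
    by 1 / t^(j+1) and a bounded remainder. The main parts add up to exp (A/t) - 1. In the bound, 1
    comes from this -1, A/2 from the constant 1/2 at j = 0, and the rest from the other poles. *)
Theorem comparator_gf (A : R) (t : C) : 0 < A -> 0 < Re t -> Rabs (Im t) <= PI ->
  summable (fun n => RtoC (bessel A (INR n)) * Cexp (- t) ^ n)%C /\
  Cmod (Csum (fun n => RtoC (bessel A (INR n)) * Cexp (- t) ^ n) - Cexp (RtoC A / t))%C
    <= 1 + A / 2 + (2 * Cmod t + 4) * exp A.
Proof.
intros HA Ht HI. set (z := Cexp (- t)). set (t0 := Re t) in *. set (d := t0 / 2).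
assert (Hd : 0 < d < t0) by (unfold d; lra).
pose proof (Re_pos_neq_0 t Ht) as Nt.
set (c := fun j => A ^ S j / INR (fact (S j))).
assert (Pc : forall j, 0 < c j).
{ intros j. apply Rdiv_lt_0_compat; [now apply pow_lt|apply INR_fact_lt_0]. }
set (a := fun n j => (RtoC (c j) * (RtoC (INR n ^ j / INR (fact j)) * z ^ n))%C).
assert (D : forall n j, Cmod (a n j) <= exp (- (t0 - d)) ^ n * (d * ((A / d) ^ S j / INR (fact (S j))))).
{ intros n j. unfold a. rewrite Cmod_mult, Cmod_R, Rabs_pos_eq by apply Rlt_le, Pc.
  apply Rle_trans with (c j * (/ d ^ j * exp (- (t0 - d)) ^ n)).
  - apply Rmult_le_compat_l; [apply Rlt_le, Pc|]. apply (monomial_bound t); lra.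
  - right. unfold c.
    replace ((A / d) ^ S j) with (A ^ S j * / (d * d ^ j))
      by (unfold Rdiv; rewrite Rpow_mult_distr, pow_inv; reflexivity).
    field.
    repeat split; try apply pow_nonzero; try lra. apply INR_fact_neq_0. }
assert (D' : forall j n, Cmod (a n j) <= (d * ((A / d) ^ S j / INR (fact (S j)))) * exp (- (t0 - d)) ^ n)
  by (intros; rewrite Rmult_comm; auto).
assert (E1 := ex_series_expd t d (proj2 Hd)). fold t0 in E1.
assert (E2 : ex_series (fun j => d * ((A / d) ^ S j / INR (fact (S j)))))
  by (apply (ex_series_scal_l (V := R_NormedModule)), ex_series_exp_tail).
assert (P1 : forall n, 0 <= exp (- (t0 - d)) ^ n) by (intros; apply pow_le, Rlt_le, exp_pos).
assert (P2 : forall j, 0 <= d * ((A / d) ^ S j / INR (fact (S j)))).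
{ intros j. apply Rmult_le_pos; [lra|]. apply pow_div_fact_pos. apply Rdiv_le_0_compat; lra. }
assert (En : forall n, Csum (a n) = (RtoC (bessel A (INR n)) * z ^ n)%C).
{ intros n. unfold a.
  rewrite (Csum_ext _ (fun j => z ^ n * RtoC (bessel_coeff A j * INR n ^ j))%C).
  - rewrite Csum_scal, Csum_RtoC.
    + unfold bessel, PSeries. ring.
    + apply summable_le with (fun j => A * ((A * INR n) ^ j / INR (fact j))).
      * intros j. assert (0 <= bessel_coeff A j).
        { unfold bessel_coeff. apply Rdiv_le_0_compat; [apply pow_le; lra|].
          apply Rmult_lt_0_compat; apply INR_fact_lt_0. }
        rewrite Cmod_R, Rabs_pos_eq by (apply Rmult_le_pos; [auto|apply pow_le, pos_INR]).
        rewrite Rpow_mult_distr. unfold bessel_coeff. simpl pow.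
        apply Rle_trans with (A * A ^ j * INR n ^ j / INR (fact j) * / INR (fact (S j))).
        { right. field. split; apply INR_fact_neq_0. }
        apply Rle_trans with (A * A ^ j * INR n ^ j / INR (fact j) * 1).
        { apply Rmult_le_compat_l.
          - apply Rdiv_le_0_compat; [|apply INR_fact_lt_0].
            apply Rmult_le_pos; [|apply pow_le, pos_INR]. apply Rmult_le_pos; [lra|apply pow_le; lra].
          - rewrite <- Rinv_1. apply Rinv_le_contravar; [lra|].
            replace 1 with (INR 1) by reflexivity. apply le_INR. pose proof (lt_O_fact (S j)). lia. }
        right. field. apply INR_fact_neq_0.
      * apply (ex_series_scal_l (V := R_NormedModule)), ex_series_exp.
  - intros j. unfold bessel_coeff, c. rewrite !RtoC_mult.
    replace (A ^ S j / (INR (fact j) * INR (fact (S j)))) with (A ^ S j / INR (fact (S j)) * / INR (fact j)).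
    + unfold Rdiv. rewrite !RtoC_mult. ring.
    + field. split; apply INR_fact_neq_0. }
assert (Ej : forall j, Csum (fun n => a n j) = (RtoC (c j) * pole_coeff t j)%C).
{ intros j. unfold a. rewrite <- (lipschitz t Ht HI). unfold monomial_sum. fold z.
  rewrite Csum_scal; auto. apply summable_le with (fun n => / d ^ j * exp (- (t0 - d)) ^ n).
  - intros n. apply (monomial_bound t); lra.
  - now apply (ex_series_scal_l (V := R_NormedModule)). }
assert (SR : summable (fun j => RtoC (c j) * pair_sum t j)%C).
{ apply summable_le with (fun j => (2 * Cmod t + 4) * c j).
  - intros j. rewrite Cmod_mult, Cmod_R, Rabs_pos_eq, Rmult_comm by apply Rlt_le, Pc.
    apply Rmult_le_compat_r; [apply Rlt_le, Pc|now apply pair_sum_bound].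
  - apply (ex_series_scal_l (V := R_NormedModule)), ex_series_exp_tail. }
split.
- apply summable_ext with (fun n => Csum (a n)); auto.
  now apply (rows_summable a _ _ D).
- rewrite <- (Csum_ext _ _ En), (Csum_exchange a _ _ D) by auto.
  rewrite (Csum_ext _ _ Ej).
  rewrite (Csum_ext _ (fun j => RtoC (c j) * (if (j =? 0)%nat then / 2 else 0)
    + (RtoC A / t) ^ S j / RtoC (INR (fact (S j))) + RtoC (c j) * pair_sum t j)%C).
  2:{ intros j. unfold pole_coeff.
      assert (Ec : (RtoC (c j) * / t ^ S j = (RtoC A / t) ^ S j / RtoC (INR (fact (S j))))%C).
      { unfold c, Cdiv. rewrite Cpow_mult_l, Cpow_inv, <- RtoC_pow by auto.
        unfold Rdiv. rewrite RtoC_mult, RtoC_inv by apply INR_fact_neq_0. ring. }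
      rewrite <- Ec. ring. }
  destruct (Csum_finite (fun j => RtoC (c j) * (if (j =? 0)%nat then / 2 else 0))%C 1) as [S1 G1].
  { intros n Hn. destruct (Nat.eqb_spec n 0); [lia|ring]. }
  assert (S2 : summable (fun j => (RtoC A / t) ^ S j / RtoC (INR (fact (S j))))%C)
    by apply (summable_tail (fun n => (RtoC A / t) ^ n / RtoC (INR (fact n)))%C 1), summable_Cexp.
  assert (S12 := summable_plus _ _ S1 S2).
  rewrite Csum_plus, Csum_plus, G1, csum_1, <- Cexp_series_tail1 by auto.
  simpl Nat.eqb. cbv iota.
  match goal with |- Cmod ?x <= _ => replace x with
    (- (1) + (RtoC (c O) * / 2 + Csum (fun j => RtoC (c j) * pair_sum t j)))%C by ring end.
  rewrite Rplus_assoc.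
  eapply Rle_trans; [apply Cmod_triangle|]. apply Rplus_le_compat; [rewrite Cmod_opp, Cmod_1; lra|].
  eapply Rle_trans; [apply Cmod_triangle|]. apply Rplus_le_compat.
  + rewrite Cmod_mult, Cmod_R, Cmod_inv, Cmod_R, !Rabs_pos_eq; try lra.
    * unfold c. simpl. lra.
    * apply Rlt_le, Pc.
    * intros E0; apply RtoC_inj in E0; lra.
  + apply Rle_trans with (Series (fun j => (2 * Cmod t + 4) * c j)).
    * apply Csum_Cmod_le.
      -- intros j. rewrite Cmod_mult, Cmod_R, Rabs_pos_eq, Rmult_comm by apply Rlt_le, Pc.
         apply Rmult_le_compat_r; [apply Rlt_le, Pc|now apply pair_sum_bound].
      -- apply (ex_series_scal_l (V := R_NormedModule)), ex_series_exp_tail.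
    * rewrite Series_scal_l. unfold c. rewrite Series_exp_tail.
      pose proof (Cmod_ge_0 t). apply Rmult_le_compat_l; lra.
Qed.

(** * The logarithmic derivative of the Bessel comparison function *)

Ltac to_real_eq := match goal with |- ?p = ?r => change (@eq R p r) end; cbv beta.

Section Bessel.

Variable A : R.

Hypothesis HA : 0 < A.

Let a : R := sqrt A.

Lemma sqrtA_pos : 0 < a.
Proof. now apply sqrt_lt_R0. Qed.

Lemma sqrtA_sq : a * a = A.
Proof. apply sqrt_sqrt. lra. Qed.

Lemma bessel_coeff_pos j : 0 < bessel_coeff A j.
Proof.
unfold bessel_coeff. apply Rdiv_lt_0_compat; [now apply pow_lt|].
apply Rmult_lt_0_compat; apply INR_fact_lt_0.
Qed.

Lemma bessel_coeff_rec n : INR (n + 1) * INR (n + 2) * bessel_coeff A (S n) = A * bessel_coeff A n.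
Proof.
unfold bessel_coeff. rewrite (fact_simpl (S n)), (fact_simpl n), !mult_INR.
replace (n + 1)%nat with (S n) by lia. replace (n + 2)%nat with (S (S n)) by lia. simpl pow.
field. repeat split; try apply INR_fact_neq_0; apply not_0_INR; lia.
Qed.

Lemma CV_bessel_coeff x : Rbar_lt (Rabs x) (CV_radius (bessel_coeff A)).
Proof.
pose proof (Rabs_pos x) as Px.
apply (CV_radius_gt _ (Rabs x + 1) (A * exp (A * (Rabs x + 1)))); [lra|].
intros j. rewrite Rabs_pos_eq by apply Rlt_le, bessel_coeff_pos.
apply Rle_trans with (A * ((A * (Rabs x + 1)) ^ j / INR (fact j))).
- rewrite Rpow_mult_distr. unfold bessel_coeff. simpl pow. set (r := (Rabs x + 1) ^ j).
  assert (Pr : 0 < r) by (apply pow_lt; lra). pose proof (INR_fact_lt_0 j) as P1.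
  pose proof (INR_fact_lt_0 (S j)) as P2.
  assert (1 <= INR (fact (S j))).
  { replace 1 with (INR 1) by reflexivity. apply le_INR. pose proof (lt_O_fact (S j)). lia. }
  assert (Pj : 0 < A ^ j) by now apply pow_lt.
  replace (A * A ^ j / (INR (fact j) * INR (fact (S j))) * r) with (A * (A ^ j * r / INR (fact j)) * / INR (fact (S j))) by (field; lra).
  rewrite <- (Rmult_1_r (A * (A ^ j * r / INR (fact j)))) at 2.
  apply Rmult_le_compat_l.
  + apply Rmult_le_pos; [lra|]. apply Rdiv_le_0_compat; [|auto]. apply Rmult_le_pos; lra.
  + rewrite <- Rinv_1. apply Rinv_le_contravar; lra.
- apply Rmult_le_compat_l; [lra|]. apply pow_div_fact_le. apply Rmult_le_pos; lra.
Qed.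

Definition bessel1 (x : R) : R := PSeries (PS_derive (bessel_coeff A)) x.

Definition bessel2 (x : R) : R := PSeries (PS_derive (PS_derive (bessel_coeff A))) x.

Lemma CV_bco1 x : Rbar_lt (Rabs x) (CV_radius (PS_derive (bessel_coeff A))).
Proof. rewrite CV_radius_derive. apply CV_bessel_coeff. Qed.

Lemma CV_bco2 x : Rbar_lt (Rabs x) (CV_radius (PS_derive (PS_derive (bessel_coeff A)))).
Proof. rewrite CV_radius_derive. apply CV_bco1. Qed.

Lemma is_derive_bessel x : is_derive (bessel A) x (bessel1 x).
Proof. apply is_derive_PSeries, CV_bessel_coeff. Qed.

Lemma is_derive_bessel1 x : is_derive bessel1 x (bessel2 x).
Proof. apply is_derive_PSeries, CV_bco1. Qed.

Lemma bessel_ode x : x * bessel2 x + 2 * bessel1 x = A * bessel A x.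
Proof.
unfold bessel1, bessel2, bessel. rewrite <- PSeries_incr_1. rewrite <- !PSeries_scal.
rewrite <- PSeries_plus.
- apply PSeries_ext. intros n. unfold PS_plus, PS_scal, PS_incr_1, PS_derive.
  change (plus ?x ?y) with (x + y). change (scal ?x ?y) with (x * y).
  rewrite <- bessel_coeff_rec. destruct n as [|n].
  + simpl. unfold zero; simpl. ring.
  + rewrite !S_INR, !plus_INR, !S_INR. simpl (INR 0).
    match goal with |- ?l = ?r => change (@eq R l r) end. ring.
- apply ex_pseries_incr_1. apply CV_radius_inside, CV_bco2.
- apply ex_pseries_scal; [apply Rmult_comm|]. apply CV_radius_inside, CV_bco1.
Qed.

Lemma PSeries_pos_ge (c : nat -> R) x N : (forall n, 0 <= c n) -> 0 <= x ->
  Rbar_lt (Rabs x) (CV_radius c) -> rsum (fun n => c n * x ^ n) N <= PSeries c x.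
Proof.
intros Hc Hx CV. apply rsum_le_Series.
- intros n. apply Rmult_le_pos; auto. now apply pow_le.
- apply CV_radius_inside in CV. apply ex_pseries_R in CV. exact CV.
Qed.

Lemma bessel_pos x : 0 <= x -> 0 < bessel A x.
Proof.
intros Hx. pose proof (PSeries_pos_ge (bessel_coeff A) x 1 (fun n => Rlt_le _ _ (bessel_coeff_pos n)) Hx (CV_bessel_coeff x)) as H.
simpl in H. pose proof (bessel_coeff_pos 0). unfold bessel. lra.
Qed.

Lemma bessel1_pos x : 0 <= x -> 0 < bessel1 x.
Proof.
intros Hx.
assert (P : forall n, 0 < PS_derive (bessel_coeff A) n).
{ intros n. unfold PS_derive. apply Rmult_lt_0_compat; [apply lt_0_INR; lia|apply bessel_coeff_pos]. }
pose proof (PSeries_pos_ge _ x 1 (fun n => Rlt_le _ _ (P n)) Hx (CV_bco1 x)) as H.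
simpl in H. pose proof (P O). unfold bessel1. lra.
Qed.

(** The leading asymptotics of [bessel A x] up to a constant factor, with logarithmic derivative
    [logder_low]. Multiplied by x^2 it is the integrating factor in [low_lt]. *)
Definition bessel_growth (x : R) : R := exp (2 * a * sqrt x - 3 / 4 * ln x).

Definition logder_low (x : R) : R := a / sqrt x - 3 / 4 / x.

Lemma is_derive_gfac x : 0 < x -> is_derive bessel_growth x (logder_low x * bessel_growth x).
Proof.
intros Hx. unfold bessel_growth, logder_low. pose proof (sqrt_lt_R0 x Hx). auto_derive; [lra|].
match goal with |- context [exp ?e] => set (E := exp e) end.
replace (exp (2 * a * sqrt x - 3 / 4 * ln x)) with E by (unfold E; f_equal; ring).
field. lra.
Qed.

Lemma is_derive_low x : 0 < x -> is_derive logder_low x (- a / (2 * (x * sqrt x)) + 3 / 4 / x ^ 2).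
Proof.
intros Hx. unfold logder_low. pose proof (sqrt_lt_R0 x Hx) as P.
assert (E : sqrt x * sqrt x = x) by (apply sqrt_sqrt; lra).
auto_derive; [repeat split; lra|].
rewrite E. field. lra.
Qed.

Lemma low_subsolution x : 0 < x ->
  x * (- a / (2 * (x * sqrt x)) + 3 / 4 / x ^ 2) + x * logder_low x ^ 2 + 2 * logder_low x - A = - (3 / 16 / x).
Proof.
intros Hx. unfold logder_low. pose proof (sqrt_lt_R0 x Hx) as P. rewrite <- sqrtA_sq.
assert (E : x = sqrt x * sqrt x) by (symmetry; apply sqrt_sqrt; lra).
set (q := sqrt x) in *. rewrite E. field. lra.
Qed.

Lemma MVT_gt (f f' : R -> R) x y : x < y -> (forall z, x <= z <= y -> is_derive f z (f' z)) ->
  exists c, x <= c <= y /\ f y - f x = f' c * (y - x).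
Proof.
intros H D. destruct (MVT_gen f x y f') as [c [Hc E]].
- intros z Hz. rewrite Rmin_left, Rmax_right in Hz by lra. apply D; lra.
- intros z Hz. rewrite Rmin_left, Rmax_right in Hz by lra. apply continuity_pt_filterlim.
  apply (ex_derive_continuous f). exists (f' z). apply D; lra.
- rewrite Rmin_left, Rmax_right in Hc by lra. now exists c.
Qed.

(* [logder_low] is a subsolution of the Riccati equation solved by [bessel1 / bessel A]; the function
   [W] below is the difference times an integrating factor. *)
Lemma low_lt x : 0 < x -> logder_low x * bessel A x < bessel1 x.
Proof.
intros Hx. pose proof sqrtA_pos as Pa. pose proof sqrtA_sq as Ea.
destruct (Rle_or_lt (logder_low x) 0) as [L|L].
{ pose proof (bessel1_pos x ltac:(lra)). pose proof (bessel_pos x ltac:(lra)). nra. }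
set (W := fun x => x ^ 2 * (bessel1 x - logder_low x * bessel A x) * bessel_growth x).
assert (DW : forall y, 0 < y -> is_derive W y (3 / 16 * bessel_growth y * bessel A y)).
{ intros y Hy.
  assert (D1 : is_derive (fun x => bessel1 x - logder_low x * bessel A x) y
     (bessel2 y - ((- a / (2 * (y * sqrt y)) + 3 / 4 / y ^ 2) * bessel A y + logder_low y * bessel1 y))).
  { apply (is_derive_minus bessel1 (fun x => logder_low x * bessel A x)); [apply is_derive_bessel1|].
    apply is_derive_mult_R; [now apply is_derive_low|apply is_derive_bessel]. }
  assert (D2 : is_derive (fun x => x ^ 2) y (2 * y)).
  { eapply is_derive_eq; [apply is_derive_Reals, (derivable_pt_lim_pow y 2)|simpl; ring]. }
  pose proof (is_derive_mult_R _ _ _ _ _ (is_derive_mult_R _ _ _ _ _ D2 D1) (is_derive_gfac y Hy)) as D3.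
  eapply is_derive_eq; [exact D3|]. cbv beta.
  pose proof (low_subsolution y Hy) as Sub. pose proof (bessel_ode y) as O.
  set (l' := - a / (2 * (y * sqrt y)) + 3 / 4 / y ^ 2) in *.
  set (B := bessel A y) in *. set (B1 := bessel1 y) in *. set (B2 := bessel2 y) in *. set (g := bessel_growth y).
  set (l := logder_low y) in *.
  to_real_eq.
  transitivity (g * y * (y * B2 + 2 * B1 - B * (y * l' + y * l ^ 2 + 2 * l))); [ring|].
  rewrite O. replace (y * l' + y * l ^ 2 + 2 * l) with (A - 3 / 16 / y) by lra. field. lra. }
(* The zero of [logder_low]. There W is positive because [bessel1] is, and W increases to the right
   of it; to the left the claim holds by signs. *)
set (x1 := (3 / (4 * a)) ^ 2).
assert (P1 : 0 < 3 / (4 * a)) by (apply Rdiv_lt_0_compat; lra).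
assert (Px1 : 0 < x1) by (apply pow_lt; auto).
assert (Sx1 : sqrt x1 = 3 / (4 * a)) by (apply sqrt_pow2; lra).
assert (L1 : logder_low x1 = 0).
{ unfold logder_low. rewrite Sx1. unfold x1. field. lra. }
assert (Sx := sqrt_lt_R0 x Hx). assert (Ex : sqrt x * sqrt x = x) by (apply sqrt_sqrt; lra).
assert (Lx : x1 < x).
{ unfold logder_low in L. rewrite <- Ex in L at 2. set (q := sqrt x) in *.
  replace (a / q - 3 / 4 / (q * q)) with ((a * q - 3 / 4) / (q * q)) in L by (field; lra).
  assert (0 < a * q - 3 / 4).
  { apply Rmult_lt_reg_r with (/ (q * q)); [apply Rinv_0_lt_compat; nra|]. unfold Rdiv in L. lra. }
  assert (3 / (4 * a) < q).
  { apply Rlt_div_l; lra. }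
  rewrite <- Ex. unfold x1. simpl. rewrite Rmult_1_r. apply Rmult_le_0_lt_compat; lra. }
destruct (MVT_gt W (fun y => 3 / 16 * bessel_growth y * bessel A y) x1 x Lx) as [c [Hc E]].
{ intros z Hz. apply DW. lra. }
assert (W1 : 0 < W x1).
{ unfold W. rewrite L1. pose proof (bessel1_pos x1 ltac:(lra)).
  apply Rmult_lt_0_compat; [apply Rmult_lt_0_compat; [now apply pow_lt|lra]|apply exp_pos]. }
assert (Pc : 0 < 3 / 16 * bessel_growth c * bessel A c).
{ apply Rmult_lt_0_compat; [apply Rmult_lt_0_compat; [lra|apply exp_pos]|apply bessel_pos; lra]. }
assert (Wx : 0 < W x) by (assert (0 < 3 / 16 * bessel_growth c * bessel A c * (x - x1)) by (apply Rmult_lt_0_compat; lra); lra).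
unfold W in Wx. pose proof (exp_pos (2 * a * sqrt x - 3 / 4 * ln x)) as Pg. fold (bessel_growth x) in Pg.
assert (Px2 : 0 < x ^ 2) by now apply pow_lt.
destruct (Rlt_or_le (logder_low x * bessel A x) (bessel1 x)) as [Q|Q]; auto. exfalso.
assert (x ^ 2 * (bessel1 x - logder_low x * bessel A x) <= 0) by nra. nra.
Qed.

Definition logder (x : R) : R := bessel1 x / bessel A x.

Lemma logder_gt_low x : 0 < x -> logder_low x < logder x.
Proof.
intros Hx. unfold logder. apply Rlt_div_r; [apply bessel_pos; lra|]. now apply low_lt.
Qed.

Lemma is_derive_ln_bessel x : 0 < x -> is_derive (fun x => ln (bessel A x)) x (logder x).
Proof.
intros Hx. pose proof (bessel_pos x ltac:(lra)) as P.
eapply is_derive_eq.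
- apply (is_derive_comp_R ln (bessel A) x (/ bessel A x) (bessel1 x)); [|apply is_derive_bessel].
  now apply is_derive_ln.
- unfold logder, Rdiv. to_real_eq. ring.
Qed.

Definition logder1 (x : R) : R := (A - 2 * logder x) / x - logder x ^ 2.

Lemma is_derive_logder x : 0 < x -> is_derive logder x (logder1 x).
Proof.
intros Hx. pose proof (bessel_pos x ltac:(lra)) as P.
eapply is_derive_eq.
- apply (is_derive_div bessel1 (bessel A) x); [apply is_derive_bessel1|apply is_derive_bessel|lra].
- unfold logder1, logder. pose proof (bessel_ode x) as O.
  replace (bessel2 x) with ((A * bessel A x - 2 * bessel1 x) / x) by (rewrite <- O; field; lra).
  to_real_eq. field. lra.
Qed.

(** The differentiated Riccati equation with u' eliminated: the factor [u ^ 2 + 2 * u / x - A / x]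
    is -u'. No derivative of u is left, so a lower bound for u alone controls the sign. *)
Definition logder2 (x : R) : R :=
  let u := logder x in
  (3 / x + 2 * u) * (u ^ 2 + 2 * u / x - A / x) - u ^ 2 / x.

Lemma is_derive_logder1 x : 0 < x -> is_derive logder1 x (logder2 x).
Proof.
intros Hx. pose proof (is_derive_logder x Hx) as D.
unfold logder1. eapply is_derive_eq.
- apply (is_derive_minus (fun x => (A - 2 * logder x) / x) (fun x => logder x ^ 2)).
  + apply (is_derive_div (fun x => A - 2 * logder x) (fun x => x) x (0 - 2 * logder1 x) 1); [|apply (is_derive_id x)|lra].
    apply (is_derive_minus (fun _ => A) (fun x => 2 * logder x)); [apply (is_derive_const A)|].
    apply (is_derive_scal logder x 2 _ D).
  + apply (is_derive_pow logder 2 x _ D).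
- unfold minus, plus, opp; simpl. unfold logder2, logder1. to_real_eq. field. lra.
Qed.

(** The mean value theorem three times: to the second difference of f, then to the first difference
    of f1, then to f2. *)
Lemma third_difference (f f1 f2 f3 : R -> R) x :
  0 < x -> (forall y, 0 < y -> is_derive f y (f1 y)) -> (forall y, 0 < y -> is_derive f1 y (f2 y)) ->
  (forall y, 0 < y -> is_derive f2 y (f3 y)) ->
  exists c, x <= c <= x + 3 /\ f (x + 3) - 3 * f (x + 2) + 3 * f (x + 1) - f x = f3 c.
Proof.
intros Hx D1 D2 D3.
assert (Dsh : forall (g g' : R -> R) d, 0 <= d -> (forall y, 0 < y -> is_derive g y (g' y)) ->
   forall y, 0 < y -> is_derive (fun z => g (z + d)) y (g' (y + d))).
{ intros g g' d Hd Dg y Hy. eapply is_derive_eq.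
  - apply (is_derive_comp_R g (fun z => z + d) y (g' (y + d)) 1); [apply Dg; lra|]. auto_derive; [auto|ring].
  - to_real_eq. ring. }
destruct (MVT_gt (fun y => f (y + 2) - 2 * f (y + 1) + f y)
   (fun y => f1 (y + 2) - 2 * f1 (y + 1) + f1 y) x (x + 1) ltac:(lra)) as [c1 [H1 E1]].
{ intros z Hz. apply (is_derive_plus (fun y => f (y + 2) - 2 * f (y + 1)) f); [|apply D1; lra].
  apply (is_derive_minus (fun y => f (y + 2)) (fun y => 2 * f (y + 1))).
  - apply Dsh; auto; lra.
  - apply (is_derive_scal (fun y => f (y + 1)) z 2). apply Dsh; auto; lra. }
destruct (MVT_gt (fun y => f1 (y + 1) - f1 y) (fun y => f2 (y + 1) - f2 y) c1 (c1 + 1) ltac:(lra)) as [c2 [H2 E2]].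
{ intros z Hz. apply (is_derive_minus (fun y => f1 (y + 1)) f1); [|apply D2; lra]. apply Dsh; auto; lra. }
destruct (MVT_gt f2 f3 c2 (c2 + 1) ltac:(lra)) as [c3 [H3 E3]].
{ intros z Hz. apply D3; lra. }
exists c3. split; [lra|].
replace (x + 1 + 2) with (x + 3) in E1 by ring. replace (x + 1 + 1) with (x + 2) in E1 by ring.
replace (c1 + 1 + 1) with (c1 + 2) in E2 by ring.
lra.
Qed.

(** The expression is increasing in u from [logder_low] on: for u = l + d with d > 0 the excess is a
    sum of nonnegative terms, provided that [sl >= 0], and this follows from [2 <= a * sqrt x]. The
    bound is the value at l. *)
Lemma logder2_lower x : 0 < x -> 2 <= a * sqrt x ->
  3 / 8 * a * (/ sqrt x) ^ 5 - 63 / 32 * (/ sqrt x) ^ 6 <= logder2 x.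
Proof.
intros Hx H2. pose proof (logder_gt_low x Hx) as L. pose proof sqrtA_pos as Pa.
pose proof (sqrt_lt_R0 x Hx) as Ps. assert (Ex : sqrt x * sqrt x = x) by (apply sqrt_sqrt; lra).
unfold logder2. set (u := logder x) in *. unfold logder_low in L.
set (q := sqrt x) in *. set (z := / q).
assert (Pz : 0 < z) by (apply Rinv_0_lt_compat; auto).
assert (Hz : 2 * z <= a) by (unfold z; apply Rle_div_l; lra).
assert (Iz : / x = z * z) by (unfold z; rewrite <- Ex; field; lra).
unfold Rdiv in *. rewrite Iz in *. fold z in L. rewrite <- sqrtA_sq. fold a.
set (l := a * z - 3 * / 4 * (z * z)) in *.
assert (Pl : 0 < l) by (unfold l; nra).
set (d := u - l). assert (Pd : 0 < d) by (unfold d; lra).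
replace u with (l + d) by (unfold d; ring).
set (sl := l ^ 2 + 2 * l * (z * z) - a * a * (z * z)).
assert (Esl : sl = 1 / 2 * a * z ^ 3 - 15 / 16 * z ^ 4) by (unfold sl, l; field).
assert (Psl : 0 <= sl).
{ rewrite Esl. replace (1 / 2 * a * z ^ 3 - 15 / 16 * z ^ 4) with (z ^ 3 * (1 / 2 * a - 15 / 16 * z)) by ring.
  apply Rmult_le_pos; [apply pow_le; lra|lra]. }
assert (El : (3 * (z * z) + 2 * l) * sl - l ^ 2 * (z * z) = 3 * / 8 * a * z ^ 5 - 63 * / 32 * z ^ 6)
  by (rewrite Esl; unfold l; field).
rewrite <- El.
replace ((l + d) ^ 2 + 2 * (l + d) * (z * z) - a * a * (z * z)) with (sl + d * (2 * l + d + 2 * (z * z)))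
  by (unfold sl; ring).
assert (Pzz : 0 < z * z) by nra.
assert (K : (3 * (z * z) + 2 * (l + d)) * (sl + d * (2 * l + d + 2 * (z * z))) - (l + d) ^ 2 * (z * z)
  - ((3 * (z * z) + 2 * l) * sl - l ^ 2 * (z * z)) =
  2 * d * sl + 2 * (l + d) * (d * (2 * l + d + 2 * (z * z))) + 6 * (z * z) * (z * z) * d + 2 * (z * z) * (d * (2 * l + d))) by ring.
assert (0 <= 2 * d * sl) by (repeat apply Rmult_le_pos; lra).
assert (0 <= 2 * (l + d) * (d * (2 * l + d + 2 * (z * z)))) by (repeat apply Rmult_le_pos; lra).
assert (0 <= 6 * (z * z) * (z * z) * d) by (repeat apply Rmult_le_pos; lra).
assert (0 <= 2 * (z * z) * (d * (2 * l + d))) by (repeat apply Rmult_le_pos; lra).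
lra.
Qed.

(** The inequality [logder_low < logder] integrated from 1 to x. *)
Lemma bessel_lower x : 1 <= x -> bessel A 1 * exp (- (2 * a)) * bessel_growth x <= bessel A x.
Proof.
intros Hx. destruct (Req_dec x 1) as [E|E].
{ subst. unfold bessel_growth. rewrite sqrt_1, ln_1, Rmult_assoc, <- exp_plus.
  replace (- (2 * a) + (2 * a * 1 - 3 / 4 * 0)) with 0 by ring. rewrite exp_0. lra. }
destruct (MVT_gt (fun y => ln (bessel A y) - (2 * a * sqrt y - 3 / 4 * ln y))
  (fun y => logder y - logder_low y) 1 x ltac:(lra)) as [c [Hc Ec]].
{ intros z Hz. apply (is_derive_minus (fun y => ln (bessel A y)) (fun y => 2 * a * sqrt y - 3 / 4 * ln y)).
  - apply is_derive_ln_bessel; lra.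
  - pose proof (sqrt_lt_R0 z ltac:(lra)). unfold logder_low. auto_derive; [lra|]. field. lra. }
pose proof (logder_gt_low c ltac:(lra)) as L.
assert (0 <= (logder c - logder_low c) * (x - 1)) by (apply Rmult_le_pos; lra).
rewrite sqrt_1, ln_1 in Ec. pose proof (bessel_pos 1 ltac:(lra)) as P1. pose proof (bessel_pos x ltac:(lra)) as Px.
rewrite <- (exp_ln (bessel A x)) by auto. rewrite <- (exp_ln (bessel A 1)) at 1 by auto.
unfold bessel_growth. rewrite <- !exp_plus. apply exp_le_exp. lra.
Qed.

End Bessel.

(** * Estimate of the coefficients *)

Lemma root_point t0 N l : (l < N)%nat -> exists th, Rabs th <= PI /\
  Cexp (- (t0, th))%C = (RtoC (exp (- t0)) * rootu N ^ l)%C.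
Proof.
intros Hl. assert (HN : 0 < INR N) by (apply lt_0_INR; lia).
pose proof PI_RGT_0 as HPI. set (y := 2 * PI * INR l / INR N).
assert (Hy : 0 <= y < 2 * PI).
{ unfold y. pose proof (pos_INR l). assert (INR l < INR N) by now apply lt_INR. split.
  - apply Rdiv_le_0_compat; nra.
  - apply Rlt_div_l; nra. }
assert (E : forall th, cos th = cos y -> sin th = - sin y ->
  Cexp (- (t0, th))%C = (RtoC (exp (- t0)) * rootu N ^ l)%C).
{ intros th E1 E2. rewrite rootu_pow. fold y. unfold Cexp, RtoC, Cmult. simpl.
  rewrite cos_neg, sin_neg, E1, E2, exp_0. f_equal; ring. }
destruct (Rle_or_lt y PI) as [L|L].
- exists (- y). split; [rewrite Rabs_Ropp, Rabs_pos_eq; lra|]. apply E; [apply cos_neg|apply sin_neg].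
- exists (2 * PI - y). split; [rewrite Rabs_pos_eq; lra|].
  apply E.
  + rewrite cos_minus, cos_2PI, sin_2PI. ring.
  + rewrite sin_minus, cos_2PI, sin_2PI. ring.
Qed.

Lemma Cmod_rootu_pow N l : Cmod (rootu N ^ l)%C = 1.
Proof. rewrite rootu_pow, Cmod_Cexp. simpl. apply exp_0. Qed.

Lemma sum_roots_shift N m n : (n < N)%nat -> (m < N)%nat ->
  csum (fun l => ((rootu N ^ l) ^ m * (rootu N ^ l) ^ (N - n)))%C N =
  if (m =? n)%nat then RtoC (INR N) else 0%C.
Proof.
intros Hn Hm.
rewrite (csum_ext _ (fun l => (rootu N ^ (m + (N - n))) ^ l)%C).
2:{ intros l _. rewrite <- Cpow_add_r, <- !Cpow_mult_r. f_equal. lia. }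
assert (RN := rootu_pow_N N ltac:(lia)).
destruct (Nat.eqb_spec m n) as [E|E].
- subst. replace (n + (N - n))%nat with N by lia. rewrite RN.
  rewrite (csum_ext _ (fun _ => 1%C)) by (intros; apply Cpow_1_l). rewrite csum_const. ring.
- destruct (Nat.lt_ge_cases (m + (N - n)) N) as [L|L].
  + apply sum_roots. lia.
  + replace (m + (N - n))%nat with (N + (m - n))%nat by lia.
    rewrite Cpow_add_r, RN, Cmult_1_l. apply sum_roots. lia.
Qed.

Lemma csum_delta (f : nat -> C) N n : (n < N)%nat ->
  csum (fun m => if (m =? n)%nat then f m else 0%C) N = f n.
Proof.
intros H. induction N as [|N IH]; [lia|]. simpl.
destruct (Nat.eq_dec n N) as [->|E].
- rewrite Nat.eqb_refl. rewrite (csum_ext _ (fun _ => 0%C)).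
  + rewrite csum_const. ring.
  + intros m Hm. destruct (Nat.eqb_spec m N); [lia|reflexivity].
- rewrite IH by lia. destruct (Nat.eqb_spec N n); [lia|ring].
Qed.

(* Cauchy's estimate, with averages over [N]-th roots of unity, [N -> oo], instead of an
   integral. *)
Lemma coefficient_bound (d : nat -> R) t0 B n :
  ex_series (fun m => Rabs (d m) * exp (- t0) ^ m) ->
  (forall th, Rabs th <= PI -> Cmod (Csum (fun m => RtoC (d m) * Cexp (- (t0, th)) ^ m))%C <= B) ->
  Rabs (d n) * exp (- t0) ^ n <= B.
Proof.
intros Ed HB. set (r := exp (- t0)) in *. assert (Pr : 0 < r) by apply exp_pos.
apply le_epsilon. intros eps He.
destruct (tail_small _ eps Ed He) as [N0 K].
set (N := max N0 (S n)). specialize (K N ltac:(lia)).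
assert (HN : 0 < INR N) by (apply lt_0_INR; lia).
set (a := fun l m => (RtoC (d m) * (RtoC r * rootu N ^ l) ^ m)%C).
assert (Ca : forall l m, Cmod (a l m) = Rabs (d m) * r ^ m).
{ intros l m. unfold a. rewrite Cmod_mult, Cmod_pow, Cmod_mult, !Cmod_R, Cmod_rootu_pow.
  rewrite (Rabs_pos_eq r) by lra. now rewrite Rmult_1_r. }
assert (Sa : forall l, summable (a l)).
{ intros l. unfold summable. apply ex_series_ext with (2 := Ed). intros; now rewrite Ca. }
assert (HB' : forall l, (l < N)%nat -> Cmod (csum (a l) N) <= B + eps).
{ intros l Hl. destruct (root_point t0 N l Hl) as [th [Hth Eth]].
  specialize (HB th Hth). rewrite Eth in HB. fold r in HB. fold (a l) in HB.
  assert (T : Cmod (Csum (a l) - csum (a l) N) <= eps).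
  { eapply Rle_trans; [apply (Csum_tail_le (a l) (fun m => Rabs (d m) * r ^ m))|]; auto.
    - intros m. rewrite Ca. lra.
    - eapply Rle_trans; [apply Rle_abs|]; auto. }
  replace (csum (a l) N) with (Csum (a l) + - (Csum (a l) - csum (a l) N))%C by ring.
  eapply Rle_trans; [apply Cmod_triangle|]. rewrite Cmod_opp. lra. }
assert (E : csum (fun l => csum (a l) N * (rootu N ^ l) ^ (N - n))%C N =
   (RtoC (INR N) * RtoC (d n * r ^ n))%C).
{ rewrite (csum_ext _ (fun l => csum (fun m => (rootu N ^ l) ^ (N - n) * a l m) N)%C).
  2:{ intros l _. rewrite csum_scal. ring. }
  rewrite csum_switch.
  rewrite (csum_ext _ (fun m => if (m =? n)%nat then RtoC (INR N) * RtoC (d m * r ^ m) else 0)%C).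
  - apply (csum_delta (fun m => RtoC (INR N) * RtoC (d m * r ^ m))%C); lia.
  - intros m Hm.
    rewrite (csum_ext _ (fun l => RtoC (d m * r ^ m) * ((rootu N ^ l) ^ m * (rootu N ^ l) ^ (N - n)))%C).
    + rewrite csum_scal, sum_roots_shift by lia. destruct (m =? n)%nat; ring.
    + intros l _. unfold a. rewrite Cpow_mult_l, RtoC_mult, RtoC_pow. ring. }
assert (F : INR N * (Rabs (d n) * r ^ n) <= INR N * (B + eps)).
{ replace (INR N * (Rabs (d n) * r ^ n)) with (Cmod (RtoC (INR N) * RtoC (d n * r ^ n))).
  2:{ rewrite Cmod_mult, !Cmod_R, Rabs_mult, (Rabs_pos_eq (INR N)), (Rabs_pos_eq (r ^ n)); auto; try lra.
      apply pow_le; lra. }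
  rewrite <- E. eapply Rle_trans; [apply csum_Cmod|].
  rewrite <- rsum_const. apply rsum_le. intros l Hl.
  rewrite Cmod_mult, Cmod_pow, Cmod_rootu_pow, pow1, Rmult_1_r. auto. }
apply Rmult_le_reg_l with (INR N); auto.
Qed.

Lemma Cexp_neg_pow (t : C) j : (Cexp (- t) ^ j)%C = Cexp (- (RtoC (INR j) * t)).
Proof. rewrite <- Cexp_INR. f_equal. ring. Qed.

Lemma log_fk_expansion k (t : C) : (1 <= k)%nat -> 0 < Re t ->
  log_fk k (Cexp (- t)) =
  (RtoC (2 * (1 - / INR k) * Zodd) / t + RtoC (kap k) - Eps t + Eps (RtoC (INR k) * t))%C.
Proof.
intros Hk Ht. rewrite <- coth_sum_expansion by auto. unfold log_fk. apply Csum_ext. intros i.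
pose proof (oddR_ge_1 i) as HJ. pose proof (INR_k k Hk) as Kk.
assert (Q : forall s, 0 < Re s -> (Cexp (- s) / (1 - Cexp (- s)) = (cth s - 1) / 2)%C).
{ intros s Hs. rewrite Cexp_opp. unfold cth. pose proof (Cexp_neq_1 s Hs). pose proof (Cexp_neq_0 s).
  field. auto. }
fold (oddR i). rewrite !Cexp_neg_pow. fold (oddR i).
rewrite !Q.
- replace (2 / oddR i) with (2 * / oddR i) by reflexivity. rewrite RtoC_mult.
  replace (RtoC (INR k) * (RtoC (oddR i) * t))%C with (RtoC (oddR i) * (RtoC (INR k) * t))%C by ring.
  field.
- rewrite !Re_scal_l. assert (0 < oddR i * Re t) by (apply Rmult_lt_0_compat; lra).
  apply Rmult_lt_0_compat; lra.
- rewrite Re_scal_l. apply Rmult_lt_0_compat; lra.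
Qed.

Lemma PI_upper : PI <= 3.29.
Proof.
pose proof (proj2 (PI_ineq 3)) as H. unfold tg_alt, PI_tg in H. simpl in H. lra.
Qed.

Lemma PI_lower : 3 <= PI.
Proof. pose proof PI2_3_2. lra. Qed.

(** The value is pi^2 / 8, about 1.2337, but these bounds suffice. Ten terms are evaluated, and the
    remaining ones are compared with the telescoping 1/(4x) - 1/(4(x + 1)). *)
Lemma Zodd_bounds : 1.2 <= Zodd <= 1.24.
Proof.
assert (P : forall n, 0 <= / oddR n ^ 2).
{ intros n. pose proof (oddR_ge_1 n). apply Rlt_le, Rinv_0_lt_compat, pow_lt. lra. }
assert (E10 : 1.2 <= rsum (fun i => / oddR i ^ 2) 10 <= 1.24 - / 40).
{ unfold oddR. cbn [rsum]. rewrite !INR_IZR_INZ. simpl. lra. }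
split.
- eapply Rle_trans; [apply E10|]. apply rsum_le_Series; [auto|apply ex_series_Zodd].
- apply (Series_le_bound _ 1.24 P). intros N.
  assert (K : forall M, rsum (fun i => / oddR i ^ 2) (10 + M) <= 1.24 - / (4 * (INR M + 10))).
  { intros M. induction M as [|M IH].
    - rewrite Nat.add_0_r. simpl INR. lra.
    - rewrite Nat.add_succ_r. cbn [rsum]. rewrite S_INR.
      assert (EJ : oddR (10 + M) = 2 * (INR M + 10) + 1).
      { unfold oddR. rewrite plus_INR, mult_INR, plus_INR. rewrite (INR_IZR_INZ 10). simpl. lra. }
      rewrite EJ. pose proof (pos_INR M) as PM. set (x := INR M + 10) in *.
      replace (INR M + 1 + 10) with (x + 1) by (unfold x; ring).
      assert (/ (2 * x + 1) ^ 2 <= / (4 * x) - / (4 * (x + 1))).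
      { replace (/ (4 * x) - / (4 * (x + 1))) with (/ (4 * x * (x + 1))) by (field; unfold x; lra).
        apply Rinv_le_contravar; unfold x; nra. }
      lra. }
  apply Rle_trans with (rsum (fun i => / oddR i ^ 2) (10 + N)).
  + apply rsum_le_mono; [auto|lia].
  + eapply Rle_trans; [apply K|]. pose proof (pos_INR N).
    assert (0 < / (4 * (INR N + 10))) by (apply Rinv_0_lt_compat; lra). lra.
Qed.

(** * Size of the generating function away from the real axis *)

Definition Xk (k : nat) (w : C) : C := (w / (1 - w) - w ^ k / (1 - w ^ k))%C.

(** The power series of [Xk k] has coefficients 0 and 1, by [regular_geom]. *)
Lemma Xk_Re_le k w : (1 <= k)%nat -> Cmod w < 1 -> Re (Xk k w) <= Re (Xk k (RtoC (Cmod w))).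
Proof.
intros Hk Hw. pose proof (Cmod_ge_0 w) as Pw.
assert (Hr : Cmod (RtoC (Cmod w)) < 1) by (rewrite Cmod_R, Rabs_pos_eq; auto).
assert (SS : forall v, Cmod v < 1 -> summable (fun m => regular k m * v ^ S m)%C).
{ intros v Hv. apply summable_le with (fun m => Cmod v ^ S m).
  - intros m. rewrite Cmod_mult, Cmod_pow. rewrite <- (Rmult_1_l (_ ^ S m)) at 2.
    apply Rmult_le_compat_r; [apply pow_le, Cmod_ge_0|apply Cmod_regular].
  - apply (ex_series_tail (fun n => Cmod v ^ n) 1), ex_series_pow. split; [apply Cmod_ge_0|auto]. }
unfold Xk. rewrite <- !regular_geom by auto.
apply (is_lim_seq_le (rsum (fun m => Re (regular k m * w ^ S m)%C))
   (rsum (fun m => Re (regular k m * RtoC (Cmod w) ^ S m)%C))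
   (Re (Csum (fun m => regular k m * w ^ S m)%C)) (Re (Csum (fun m => regular k m * RtoC (Cmod w) ^ S m)%C))).
- intros N. apply rsum_le. intros m _. unfold regular. destruct (S m mod k =? 0)%nat.
  + rewrite !Cmult_0_l. lra.
  + rewrite !Cmult_1_l, <- RtoC_pow. change (Re (RtoC (Cmod w ^ S m))) with (Cmod w ^ S m). rewrite <- Cmod_pow.
    eapply Rle_trans; [apply Rle_abs|apply Rabs_Re_le].
- apply rsum_lim. now apply summable_Re, SS.
- apply rsum_lim. now apply summable_Re, SS.
Qed.

(* Away from the real axis only the first term ([i = 0]) of the logarithm is used; the others
   are bounded by their values at [Cmod z]. *)
Lemma log_fk_Re_le k z : (1 <= k)%nat -> Cmod z < 1 ->
  Re (log_fk k z) <= Re (log_fk k (RtoC (Cmod z))) + 2 * (Re (Xk k z) - Re (Xk k (RtoC (Cmod z)))).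
Proof.
intros Hk Hz. pose proof (Cmod_ge_0 z) as Pz. set (r := RtoC (Cmod z)).
assert (Hr : Cmod r < 1) by (unfold r; rewrite Cmod_R, Rabs_pos_eq; auto).
set (T := fun v i => (RtoC (2 / oddR i) * Xk k (v ^ (2 * i + 1)))%C).
assert (SS : forall v, Cmod v < 1 -> summable (T v)) by (intros; now apply log_fk_summable).
assert (Dec : forall i, 0 <= Re (T r i) - Re (T z i)).
{ intros i. unfold T. rewrite !Re_scal_l.
  assert (0 < 2 / oddR i) by (pose proof (oddR_ge_1 i); apply Rdiv_lt_0_compat; lra).
  assert (Hw : Cmod (z ^ (2 * i + 1))%C < 1) by (rewrite Nat.add_1_r; now apply Cmod_pow_S_lt_1).
  pose proof (Xk_Re_le k _ Hk Hw) as L. rewrite Cmod_pow, RtoC_pow in L. fold r in L.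
  nra. }
change (Re (Csum (T z)) <= Re (Csum (T r)) + 2 * (Re (Xk k z) - Re (Xk k r))).
pose proof (summable_Re _ (SS _ Hz)) as Sz. pose proof (summable_Re _ (SS _ Hr)) as Sr.
assert (Sd : ex_series (fun i => Re (T r i) - Re (T z i))) by now apply (ex_series_minus (V := R_NormedModule)).
pose proof (rsum_le_Series _ 1 Dec Sd) as L. cbn [rsum] in L.
rewrite Series_minus in L by auto.
assert (E0 : forall v, Re (T v O) = 2 * Re (Xk k v)).
{ intros v. unfold T. rewrite Re_scal_l. replace (v ^ (2 * 0 + 1))%C with v by (simpl; ring).
  unfold oddR. simpl. unfold Rdiv. rewrite Rinv_1. ring. }
rewrite !E0 in L.
change (Re (Csum (T r))) with (Series (fun i => Re (T r i))).
change (Re (Csum (T z))) with (Series (fun i => Re (T z i))). lra.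
Qed.

Lemma Re_inv_1_minus (w : C) : Re (/ (1 - w))%C = (1 - Re w) / ((1 - Re w) ^ 2 + Im w ^ 2).
Proof.
destruct w as [u v]. simpl. replace (0 + - v) with (- v) by ring. unfold Rdiv, Rminus. do 2 f_equal. ring.
Qed.

Lemma div_1_minus (w : C) : (1 - w <> 0)%C -> (w / (1 - w) = / (1 - w) - 1)%C.
Proof. intros H. field. auto. Qed.

(** The map w / (1 - w) sends the unit disc to the half-plane Re > -1/2. *)
Lemma Re_geom_lower (w : C) : Cmod w < 1 -> - / 2 <= Re (w / (1 - w))%C.
Proof.
intros Hw. pose proof (C1_minus_neq_0 w Hw) as NZ. rewrite div_1_minus by auto.
change (- / 2 <= Re (/ (1 - w))%C - 1). rewrite Re_inv_1_minus.
pose proof (Cmod2_alt w) as E. pose proof (Cmod_ge_0 w).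
assert (Cmod w ^ 2 <= 1) by (rewrite <- (pow1 2); apply pow_incr; lra).
pose proof (Rabs_Re_le w) as L. pose proof (Rle_abs (Re w)).
assert (D : 0 < (1 - Re w) ^ 2 + Im w ^ 2).
{ assert (0 < (1 - Re w) ^ 2) by (apply pow_lt; lra). pose proof (pow2_ge_0 (Im w)). lra. }
assert (/ 2 <= (1 - Re w) / ((1 - Re w) ^ 2 + Im w ^ 2)); [|lra].
apply Rle_div_r; auto. nra.
Qed.

(** On the unit circle the real part is exactly -1/2. At radius r = exp (- t0) the excess is at most
    (1 - r) / (4 r S) with S = sin (th/2)^2, and Jordan's inequality gives S >= (th / pi)^2. *)
Lemma Re_geom_upper t0 th : 0 < t0 -> Rabs th <= PI -> th <> 0 ->
  Re (Cexp (- (t0, th)) / (1 - Cexp (- (t0, th))))%C <=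
  - / 2 + (exp t0 - 1) * PI ^ 2 / (4 * th ^ 2).
Proof.
intros Ht Hth Nth. set (w := Cexp (- (t0, th))%C). set (r := exp (- t0)).
assert (Pr : 0 < r) by apply exp_pos.
assert (Hr : r < 1) by (unfold r; rewrite <- exp_0; apply exp_increasing; lra).
assert (Mw : Cmod w < 1) by (unfold w; rewrite Cmod_Cexp; exact Hr).
pose proof (C1_minus_neq_0 w Mw) as NZ. rewrite div_1_minus by auto.
change (Re (/ (1 - w))%C - 1 <= - / 2 + (exp t0 - 1) * PI ^ 2 / (4 * th ^ 2)). rewrite Re_inv_1_minus.
pose proof PI_RGT_0 as HPI.
set (S := sin (th / 2) ^ 2).
assert (PS : (th / PI) ^ 2 <= S).
{ assert (L : Rabs th / PI <= sin (Rabs th / 2)).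
  { replace (Rabs th / PI) with (2 / PI * (Rabs th / 2)) by (field; lra).
    apply sin_ge_linear. pose proof (Rabs_pos th). lra. }
  assert (E1 : (th / PI) ^ 2 = (Rabs th / PI) ^ 2).
  { unfold Rdiv. rewrite !Rpow_mult_distr, <- (pow2_abs th). reflexivity. }
  assert (E2 : S = sin (Rabs th / 2) ^ 2).
  { unfold S. unfold Rabs. destruct (Rcase_abs th); auto.
    replace (- th / 2) with (- (th / 2)) by field. rewrite sin_neg. ring. }
  rewrite E1, E2. apply pow_incr. split; auto. apply Rdiv_le_0_compat; [apply Rabs_pos|auto]. }
assert (Pth : 0 < th ^ 2) by (pose proof (pow2_gt_0 th Nth); lra).
assert (PS0 : 0 < S).
{ eapply Rlt_le_trans; [|apply PS]. apply pow2_gt_0. unfold Rdiv. apply Rmult_integral_contrapositive.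
  split; auto. apply Rinv_neq_0_compat. lra. }
assert (Ew : Re w = r * (1 - 2 * S)).
{ unfold w, Cexp, S. simpl. rewrite cos_neg. replace (cos th) with (cos (2 * (th / 2))) by (f_equal; field).
  rewrite cos_2a_sin. fold r. ring. }
assert (Em : Re w ^ 2 + Im w ^ 2 = r ^ 2).
{ rewrite <- Cmod2_alt. unfold w. rewrite Cmod_Cexp. reflexivity. }
assert (ED : (1 - Re w) ^ 2 + Im w ^ 2 = (1 - r) ^ 2 + 4 * r * S).
{ replace ((1 - Re w) ^ 2 + Im w ^ 2) with (1 - 2 * Re w + (Re w ^ 2 + Im w ^ 2)) by ring.
  rewrite Em, Ew. ring. }
rewrite ED. rewrite Ew.
assert (P4 : 0 < 4 * r * S) by (apply Rmult_lt_0_compat; lra).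
assert (Pd : 0 <= (1 - r) ^ 2) by apply pow2_ge_0.
assert (B1 : (1 - r * (1 - 2 * S)) / ((1 - r) ^ 2 + 4 * r * S) <= / 2 + (1 - r) / (4 * r * S)).
{ apply Rle_div_l; [lra|].
  replace ((/ 2 + (1 - r) / (4 * r * S)) * ((1 - r) ^ 2 + 4 * r * S)) with
    (/ 2 * (1 - r) ^ 2 + 2 * r * S + (1 - r) / (4 * r * S) * (1 - r) ^ 2 + (1 - r)) by (field; lra).
  assert (0 <= (1 - r) / (4 * r * S) * (1 - r) ^ 2).
  { apply Rmult_le_pos; auto. apply Rdiv_le_0_compat; lra. }
  lra. }
assert (B2 : (1 - r) / (4 * r * S) <= (exp t0 - 1) * PI ^ 2 / (4 * th ^ 2)).
{ assert (Er : exp t0 = / r) by (unfold r; rewrite exp_Ropp, Rinv_inv; auto).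
  rewrite Er.
  replace ((/ r - 1) * PI ^ 2 / (4 * th ^ 2)) with ((1 - r) / (4 * r * (th / PI) ^ 2)) by (field; lra).
  apply Rmult_le_compat_l; [lra|]. apply Rinv_le_contravar.
  - apply Rmult_lt_0_compat; [lra|]. apply pow2_gt_0. unfold Rdiv. apply Rmult_integral_contrapositive.
    split; auto. apply Rinv_neq_0_compat. lra.
  - apply Rmult_le_compat_l; lra. }
lra.
Qed.

Lemma exp_le_inv x : 0 <= x < 1 -> exp x <= / (1 - x).
Proof.
intros Hx. pose proof (exp_ineq1_le (- x)) as H. rewrite exp_Ropp in H.
rewrite <- (Rinv_inv (exp x)). apply Rinv_le_contravar; lra.
Qed.

(** Both fractions have the form 1 / (exp x - 1), which lies between 1/x - 1 and 1/x; the lower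
    bound is used at x = t0, the upper one at x = k t0. *)
Lemma Xk_real_lower k t0 : (2 <= k)%nat -> 0 < t0 < 1 ->
  (1 - / INR k) / t0 - 1 <= Re (Xk k (RtoC (exp (- t0)))).
Proof.
intros Hk Ht. assert (K : 2 <= INR k) by (replace 2 with (INR 2) by reflexivity; now apply le_INR).
set (r := exp (- t0)). assert (Pr : 0 < r) by apply exp_pos.
assert (Hr : r < 1) by (unfold r; rewrite <- exp_0; apply exp_increasing; lra).
assert (Prk : 0 < r ^ k < 1).
{ split; [now apply pow_lt|]. apply pow_lt_1_compat; [lra|lia]. }
assert (E : Re (Xk k (RtoC r)) = r / (1 - r) - r ^ k / (1 - r ^ k)).
{ unfold Xk. rewrite <- RtoC_pow.
  rewrite <- !RtoC_minus, <- !RtoC_div, <- RtoC_minus by lra. reflexivity. }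
rewrite E.
assert (B1 : / t0 - 1 <= r / (1 - r)).
{ assert (Er : r = / exp t0) by (unfold r; now rewrite exp_Ropp).
  pose proof (exp_pos t0). assert (1 < exp t0) by (rewrite <- exp_0; apply exp_increasing; lra).
  replace (r / (1 - r)) with (/ (exp t0 - 1)) by (rewrite Er; field; lra).
  replace (/ t0 - 1) with (/ (/ (1 - t0) - 1)) by (field; lra).
  apply Rinv_le_contravar; [lra|]. pose proof (exp_le_inv t0). lra. }
assert (B2 : r ^ k / (1 - r ^ k) <= / INR k / t0).
{ assert (Er : r ^ k = / exp (INR k * t0)).
  { unfold r. rewrite exp_pow_INR, <- exp_Ropp. f_equal. ring. }
  assert (0 < INR k * t0) by (apply Rmult_lt_0_compat; lra).
  pose proof (exp_ineq1 (INR k * t0)). pose proof (exp_pos (INR k * t0)).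
  replace (r ^ k / (1 - r ^ k)) with (/ (exp (INR k * t0) - 1)) by (rewrite Er; field; lra).
  replace (/ INR k / t0) with (/ (INR k * t0)) by (field; lra).
  apply Rinv_le_contravar; lra. }
replace ((1 - / INR k) / t0) with (/ t0 - / INR k / t0) by (field; lra). lra.
Qed.

(** This is (pi^2 / 4) (1 - 1/k). *)
Definition Ak (k : nat) : R := 2 * (1 - / INR k) * Zodd.

Lemma le_div p q c : c > 0 -> p * c <= q -> p <= q / c.
Proof. intros H. apply (Rle_div_r p q c H). Qed.

Lemma div_le p q c : c > 0 -> p <= q * c -> p / c <= q.
Proof. intros H. apply (Rle_div_l p q c H). Qed.

Lemma k_bounds k : (2 <= k <= 9)%nat -> 2 <= INR k <= 9.
Proof.
intros Hk. split.
- replace 2 with (INR 2) by reflexivity. now apply le_INR.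
- replace 9 with (INR 9) by (simpl; ring). now apply le_INR.
Qed.

Lemma exp_1_lower : 2.7 <= exp 1.
Proof.
pose proof (rsum_le_Series (fun n => 1 ^ n / INR (fact n)) 5 (fun n => pow_div_fact_pos 1 n ltac:(lra)) (ex_series_exp 1)) as H.
rewrite exp_Series in H. simpl in H. lra.
Qed.

Lemma exp_10_lower : 20000 <= exp 10.
Proof.
replace 10 with (INR 10 * 1) by (simpl; ring). rewrite <- exp_pow_INR.
apply Rle_trans with (2.7 ^ 10); [simpl; lra|]. apply pow_incr. pose proof exp_1_lower. lra.
Qed.

(** * Estimates on the two parts of the circle *)

Section Estimate.

Variable k : nat.

Hypothesis Hk : (2 <= k <= 9)%nat.

Let K : R := INR k.

Let y : R := 1 - / K.

Let A : R := Ak k.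

Let a : R := sqrt A.

Lemma HK : 2 <= K <= 9.
Proof. now apply k_bounds. Qed.

Lemma y_bounds : / 2 <= y <= 8 / 9.
Proof.
pose proof HK as H. unfold y. split.
- assert (/ K <= / 2) by (apply Rinv_le_contravar; lra). lra.
- assert (/ 9 <= / K) by (apply Rinv_le_contravar; lra). lra.
Qed.

Lemma A_eq : A = 2 * y * Zodd.
Proof. reflexivity. Qed.

Lemma A_bounds : 2.4 * y <= A <= 2.48 * y.
Proof. pose proof Zodd_bounds. pose proof y_bounds. rewrite A_eq. split; nra. Qed.

Lemma a_sq : a * a = A.
Proof. apply sqrt_sqrt. pose proof A_bounds. pose proof y_bounds. lra. Qed.

Lemma a_bounds : 1.0954 <= a <= 1.49.
Proof.
pose proof A_bounds. pose proof y_bounds. pose proof a_sq. pose proof (sqrt_pos A) as P. fold a in P.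
split; nra.
Qed.

(** Away from the real axis the exponent [a * v] drops by [2 * (y - 0.035) * v / a], up to a
    constant. The smallest k is the worst case, and 0.83 is close to the best rate available at k =
    2. *)
Lemma far_rate : 0.83 * a <= 2 * (y - 0.035).
Proof.
pose proof A_bounds as HA. pose proof y_bounds as Hy. pose proof a_sq as E. pose proof a_bounds as Ha.
apply Rsqr_incr_0_var; unfold Rsqr; [|lra]. nra.
Qed.

(** Near the real axis the error has exponent at most [0.6 * (y - / 2) * v / a]. This keeps it below
    [(a - 0.83) * v], with [0.26 * v] to spare for constant factors. *)
Lemma near_rate : 0.26 * a <= a * a - 0.83 * a - 0.6 * (y - / 2).
Proof.
pose proof A_bounds as HA. pose proof y_bounds as Hy. pose proof a_sq as E. pose proof a_bounds as Ha. nra.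
Qed.

(** Here 18 = 2 * 3^2 is a lower bound for 2 pi^2, so that 18/K is the decay rate of the correction
    in [zed_le]. The case k = 9 is the tightest and leaves little room. *)
Lemma A_minus : A - 18 / K <= 0.6 * (y - / 2).
Proof.
pose proof A_bounds as HA. pose proof y_bounds as Hy.
assert (E : 18 / K = 18 * (1 - y)) by (unfold y, Rdiv; ring). rewrite E. lra.
Qed.

(** In the application v = sqrt n, and 40 <= v means n >= 1600. The value t0 = a / v minimises A /
    t0 + n t0, where both terms equal a v. *)
Variable v : R.

Hypothesis Hv : 40 <= v.

Let t0 : R := a / v.

Let T : R := v / a.

Lemma T_eq : T = / t0.
Proof. unfold T, t0. pose proof a_bounds. field. lra. Qed.

Lemma T_lower : 26 <= T.
Proof. unfold T. pose proof a_bounds. apply le_div; lra. Qed.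

Lemma t0_pos : 0 < t0 <= / 26.
Proof.
pose proof T_lower. assert (P : 0 < t0) by (unfold t0; pose proof a_bounds; apply Rdiv_lt_0_compat; lra).
split; auto. rewrite <- (Rinv_inv t0), <- T_eq. apply Rinv_le_contravar; lra.
Qed.

Lemma rho_eq th : rho (t0, th) = t0 / (t0 ^ 2 + th ^ 2).
Proof. reflexivity. Qed.

Lemma rho_le th : rho (t0, th) <= T.
Proof.
pose proof t0_pos as P. assert (Pt2 : 0 < t0 ^ 2) by (apply pow_lt; lra). rewrite rho_eq, T_eq. pose proof (pow2_ge_0 th).
apply div_le; [lra|]. apply Rmult_le_reg_l with t0; [lra|].
rewrite <- Rmult_assoc, Rinv_r by lra. nra.
Qed.

(** The circle is cut at |th| = 9 t0, where [rho] has fallen from T to T / (1 + 9^2) = T / 82. *)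
Lemma rho_near th : Rabs th <= 9 * t0 -> T / 82 <= rho (t0, th).
Proof.
intros H. pose proof t0_pos as P. assert (Pt2 : 0 < t0 ^ 2) by (apply pow_lt; lra). rewrite rho_eq, T_eq.
assert (th ^ 2 <= (9 * t0) ^ 2).
{ rewrite <- (pow2_abs th). apply pow_incr. split; [apply Rabs_pos|auto]. }
pose proof (pow2_ge_0 th).
apply le_div; [lra|]. apply Rmult_le_reg_l with t0; [lra|].
replace (t0 * (/ t0 / 82 * (t0 ^ 2 + th ^ 2))) with ((t0 ^ 2 + th ^ 2) / 82) by (field; lra). nra.
Qed.

Lemma rho_far th : 9 * t0 < Rabs th -> rho (t0, th) <= T / 82.
Proof.
intros H. pose proof t0_pos as P. assert (Pt2 : 0 < t0 ^ 2) by (apply pow_lt; lra). rewrite rho_eq, T_eq.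
assert ((9 * t0) ^ 2 <= th ^ 2).
{ rewrite <- (pow2_abs th). apply pow_incr. lra. }
apply div_le; [lra|]. apply Rmult_le_reg_l with t0; [lra|].
replace (t0 * (/ t0 / 82 * (t0 ^ 2 + th ^ 2))) with ((t0 ^ 2 + th ^ 2) / 82) by (field; lra). nra.
Qed.

Definition delta (t : C) : C := (- Eps t + Eps (RtoC K * t))%C.

Lemma rho_scal t : 0 < Re t -> rho (RtoC K * t)%C = rho t / K.
Proof.
intros Ht. pose proof HK. unfold rho.
replace (/ (RtoC K * t))%C with (RtoC (/ K) * / t)%C.
- rewrite Re_scal_l. unfold Rdiv. ring.
- rewrite RtoC_inv by lra. field. split; [now apply Re_pos_neq_0|]. intros E; apply RtoC_inj in E; lra.
Qed.

Lemma delta_bound t w : 0 < Re t -> zed (RtoC K * t)%C <= w -> w < 1 ->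
  Cmod (delta t) <= 2 * zed (RtoC K * t)%C / (1 - w) ^ 2.
Proof.
intros Ht Hw Hw1. pose proof HK as HK.
assert (Hkt : 0 < Re (RtoC K * t)%C) by (rewrite Re_scal_l; nra).
pose proof (zed_bounds _ Ht) as [Z1 Z2]. pose proof (zed_bounds _ Hkt) as [Z3 Z4].
set (zk := zed (RtoC K * t)%C) in *.
assert (L : zed t <= zk).
{ unfold zk, zed. apply exp_le_exp. rewrite rho_scal by auto. pose proof (rho_pos t Ht).
  assert (0 < PI ^ 2) by (apply pow_lt; apply PI_RGT_0).
  assert (rho t / K <= rho t) by (apply div_le; nra). nra. }
assert (M : forall x, 0 < x <= zk -> x / (1 - x) ^ 2 <= zk / (1 - w) ^ 2).
{ intros x Hx. apply Rmult_le_compat; try lra.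
  - apply Rlt_le, Rinv_0_lt_compat, pow_lt. lra.
  - apply Rinv_le_contravar; [apply pow_lt; lra|]. apply pow_incr. lra. }
unfold delta. eapply Rle_trans; [apply Cmod_triangle|]. rewrite Cmod_opp.
pose proof (Eps_bound t Ht). pose proof (Eps_bound _ Hkt). fold zk in H0.
pose proof (M (zed t) ltac:(lra)). pose proof (M zk ltac:(lra)).
replace (2 * zk / (1 - w) ^ 2) with (zk / (1 - w) ^ 2 + zk / (1 - w) ^ 2) by (field; lra). lra.
Qed.

Lemma zed_le t : 0 < Re t -> zed (RtoC K * t)%C <= exp (- (18 / K * rho t)).
Proof.
intros Ht. pose proof HK as HK. unfold zed. apply exp_le_exp. rewrite rho_scal by auto.
pose proof (rho_pos t Ht). pose proof PI_lower.
assert (9 <= PI ^ 2) by (apply Rle_trans with (3 ^ 2); [simpl; lra|apply pow_incr; lra]).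
replace (18 / K * rho t) with (18 * (rho t / K)) by (field; lra).
assert (0 < rho t / K) by (apply Rdiv_lt_0_compat; lra). nra.
Qed.

Definition fnorm (t : C) : C := (RtoC (exp (- kap k)) * Csum (gterm (pk k) (Cexp (- t))))%C.

Lemma Cmod_Cexp_neg_lt_1 t : 0 < Re t -> Cmod (Cexp (- t)) < 1.
Proof.
intros Ht. rewrite Cmod_Cexp, <- exp_0. apply exp_increasing. change (- Re t < 0). lra.
Qed.

Lemma fnorm_eq t : 0 < Re t -> fnorm t = Cexp (RtoC A / t + delta t).
Proof.
intros Ht. unfold fnorm.
rewrite (proj2 (fk_exp k (Cexp (- t)) ltac:(lia) (Cmod_Cexp_neg_lt_1 t Ht))).
rewrite log_fk_expansion by (auto; lia). rewrite <- Cexp_RtoC, <- Cexp_plus. f_equal.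
change (2 * (1 - / INR k) * Zodd) with A. fold K. unfold delta. rewrite RtoC_opp. ring.
Qed.

Lemma Re_Adiv t : Re (RtoC A / t)%C = A * rho t.
Proof. apply Re_scal_div. Qed.

Lemma big_exp : 20000 <= exp ((a - 0.83) * v).
Proof.
eapply Rle_trans; [apply exp_10_lower|]. apply exp_le_exp. pose proof a_bounds. nra.
Qed.

(** The error is exp (A/t) (exp (delta) - 1). The modulus of delta is a constant times
    [zk <= exp (- (18 / K * rho t))], and that factor is merged with exp (A rho) before [rho] is
    estimated from above. *)
Lemma near_bound th : Rabs th <= 9 * t0 ->
  Cmod (fnorm (t0, th) - Cexp (RtoC A / (t0, th))) <= 0.5 * exp ((a - 0.83) * v).
Proof.
intros Hth. set (t := (t0, th)). pose proof t0_pos as [P0 P1]. pose proof HK as HK.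
assert (Ht : 0 < Re t) by exact P0.
pose proof (rho_near th Hth) as R1. pose proof (rho_le th) as R2. fold t in R1, R2.
pose proof T_lower as HT. pose proof (zed_le t Ht) as HZ.
assert (H18 : 2 <= 18 / K) by (apply le_div; lra).
(* As [18 / K >= 2] and [rho t >= 26 / 82], the exponent is at least 0.634 = 8 * 0.07925 in absolute
   value. *)
assert (HZ2 : exp (- (18 / K * rho t)) <= 0.55).
{ rewrite exp_Ropp, <- (Rinv_inv 0.55). apply Rinv_le_contravar; [lra|].
  apply Rle_trans with ((1 + 0.07925) ^ 8); [simpl; lra|].
  apply Rle_trans with (exp 0.07925 ^ 8).
  - apply pow_incr. split; [lra|apply exp_ineq1_le].
  - rewrite exp_pow_INR. apply exp_le_exp. simpl. nra. }
pose proof (delta_bound t 0.55 Ht ltac:(lra) ltac:(lra)) as D.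
set (zk := zed (RtoC K * t)%C) in *. set (d := delta t) in *.
assert (Pz : 0 < zk) by apply exp_pos.
assert (D1 : Cmod d <= 9.9 * zk).
{ eapply Rle_trans; [apply D|]. apply div_le; lra. }
assert (D2 : exp (Cmod d) <= 729).
{ apply Rle_trans with (exp (INR 6 * 1)).
  - apply exp_le_exp. simpl. lra.
  - rewrite <- exp_pow_INR. apply Rle_trans with (3 ^ 6); [|simpl; lra]. apply pow_incr.
    split; [apply Rlt_le, exp_pos|apply exp_le_3]. }
rewrite fnorm_eq, Cexp_plus by auto. fold d.
replace (Cexp (RtoC A / t) * Cexp d - Cexp (RtoC A / t))%C with (Cexp (RtoC A / t) * (Cexp d - 1))%C by ring.
rewrite Cmod_mult, Cmod_Cexp, Re_Adiv.
pose proof (Cexp_minus_1_bound d) as B. pose proof (Cmod_ge_0 d) as Pd.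
assert (B2 : Cmod (Cexp d - 1) <= 9.9 * zk * 729).
{ eapply Rle_trans; [apply B|]. apply Rmult_le_compat; try lra. apply Rlt_le, exp_pos. }
pose proof (rho_pos t Ht) as Pr.
assert (B3 : exp (A * rho t) * zk <= exp (0.6 * (y - / 2) * T)).
{ apply Rle_trans with (exp (A * rho t) * exp (- (18 / K * rho t))).
  - apply Rmult_le_compat_l; [apply Rlt_le, exp_pos|auto].
  - rewrite <- exp_plus. apply exp_le_exp. pose proof A_minus. pose proof y_bounds.
    apply Rle_trans with (0.6 * (y - / 2) * rho t).
    + replace (A * rho t + - (18 / K * rho t)) with ((A - 18 / K) * rho t) by ring.
      apply Rmult_le_compat_r; lra.
    + apply Rmult_le_compat_l; lra. }
(* The slack [0.26 * v >= 10] of [near_rate] yields the factor 20000, and 9.9 * 729 is below half of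
   it. *)
assert (B4 : exp (0.6 * (y - / 2) * T) * 20000 <= exp ((a - 0.83) * v)).
{ apply Rle_trans with (exp (0.6 * (y - / 2) * T) * exp 10).
  - apply Rmult_le_compat_l; [apply Rlt_le, exp_pos|apply exp_10_lower].
  - rewrite <- exp_plus. apply exp_le_exp. pose proof near_rate as N. pose proof a_bounds as Ha.
    unfold T. replace (0.6 * (y - / 2) * (v / a) + 10) with ((0.6 * (y - / 2) * v + 10 * a) / a) by (field; lra).
    apply div_le; [lra|].
    assert (0.26 * a * v <= (a * a - 0.83 * a - 0.6 * (y - / 2)) * v) by (apply Rmult_le_compat_r; lra).
    nra. }
apply Rle_trans with (exp (A * rho t) * (9.9 * zk * 729)).
- apply Rmult_le_compat_l; [apply Rlt_le, exp_pos|auto].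
- pose proof (exp_pos ((a - 0.83) * v)). lra.
Qed.

Lemma Aexp_far th : 9 * t0 < Rabs th -> Cmod (Cexp (RtoC A / (t0, th))) <= 0.01 * exp ((a - 0.83) * v).
Proof.
intros H. rewrite Cmod_Cexp, Re_Adiv. pose proof (rho_far th H) as R. pose proof a_bounds as Ha.
pose proof a_sq as E. pose proof A_bounds as HA. pose proof y_bounds as Hy.
apply Rle_trans with (exp (a / 82 * v)).
- apply exp_le_exp. apply Rle_trans with (A * (T / 82)).
  + apply Rmult_le_compat_l; lra.
  + right. unfold T. rewrite <- E. field. lra.
- apply Rle_trans with (0.01 * (exp (a / 82 * v) * exp 5)).
  + assert (100 <= exp 5).
    { replace 5 with (INR 5 * 1) by (simpl; ring). rewrite <- exp_pow_INR.
      apply Rle_trans with (2.7 ^ 5); [simpl; lra|]. apply pow_incr. pose proof exp_1_lower. lra. }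
    pose proof (exp_pos (a / 82 * v)). nra.
  + apply Rmult_le_compat_l; [lra|]. rewrite <- exp_plus. apply exp_le_exp. nra.
Qed.

Lemma comparator_bound th : Rabs th <= PI ->
  Cmod (Csum (fun n => RtoC (bessel A (INR n)) * Cexp (- (t0, th)) ^ n) - Cexp (RtoC A / (t0, th)))%C
   <= 0.02 * exp ((a - 0.83) * v).
Proof.
intros Hth. pose proof t0_pos as [P0 P1]. pose proof A_bounds as HA. pose proof y_bounds as Hy.
eapply Rle_trans; [apply (comparator_gf A (t0, th)); [lra|exact P0|exact Hth]|].
assert (Ct : Cmod (t0, th) <= 4).
{ replace (t0, th) with (RtoC t0 + imc th)%C by (apply C_ext; simpl; ring).
  eapply Rle_trans; [apply Cmod_triangle|]. rewrite Cmod_R, Rabs_pos_eq by lra.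
  assert (Ei : Cmod (imc th) = Rabs th).
  { unfold Cmod, imc. simpl. rewrite <- sqrt_Rsqr_abs. f_equal. unfold Rsqr. ring. }
  rewrite Ei. pose proof PI_upper. lra. }
assert (HE : exp A <= 27).
{ apply Rle_trans with (exp (INR 3 * 1)).
  - apply exp_le_exp. simpl. lra.
  - rewrite <- exp_pow_INR. apply Rle_trans with (3 ^ 3); [|simpl; lra]. apply pow_incr.
    split; [apply Rlt_le, exp_pos|apply exp_le_3]. }
pose proof big_exp. pose proof (exp_pos A). pose proof (Cmod_ge_0 (t0, th)). nra.
Qed.

(** Only the real part of the logarithm matters. From |z| to z its first term falls by about
    [2 * y * T]: the value of [Xk] is at least [y * T - 1] at |z| and at most [0.035 * T] at z. The
    factor 9.1 bounds exp (2 + 0.001), where 2 is twice the loss 1 in [Xk_real_lower]. *)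
Lemma far_bound th : Rabs th <= PI -> 9 * t0 < Rabs th ->
  Cmod (fnorm (t0, th)) <= 9.1 * exp ((a - 0.83) * v).
Proof.
intros Hpi Hfar. set (t := (t0, th)). pose proof t0_pos as [P0 P1]. pose proof HK as HK.
assert (Ht : 0 < Re t) by exact P0. pose proof T_lower as HT. pose proof T_eq as ET.
pose proof a_bounds as Ha. pose proof a_sq as Ea.
set (r := RtoC (exp (- t0))).
assert (Er : r = Cexp (- RtoC t0)) by (unfold r; rewrite <- Cexp_RtoC, RtoC_opp; reflexivity).
assert (Hrt : 0 < Re (RtoC t0)) by exact P0.
unfold fnorm. rewrite (proj2 (fk_exp k (Cexp (- t)) ltac:(lia) (Cmod_Cexp_neg_lt_1 t Ht))).
rewrite <- Cexp_RtoC, <- Cexp_plus, Cmod_Cexp.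
change (Re (RtoC (- kap k) + log_fk k (Cexp (- t)))%C) with (- kap k + Re (log_fk k (Cexp (- t)))).
pose proof (log_fk_Re_le k (Cexp (- t)) ltac:(lia) (Cmod_Cexp_neg_lt_1 t Ht)) as L.
assert (Mz : Cmod (Cexp (- t)) = exp (- t0)) by (rewrite Cmod_Cexp; reflexivity).
rewrite Mz in L. fold r in L.
assert (L1 : Re (log_fk k r) <= A * T + kap k + 0.001).
{ rewrite Er, log_fk_expansion by (auto; lia). change (2 * (1 - / INR k) * Zodd) with A. fold K.
  replace (RtoC A / RtoC t0 + RtoC (kap k) - Eps (RtoC t0) + Eps (RtoC K * RtoC t0))%C
    with (RtoC A / RtoC t0 + (RtoC (kap k) + delta (RtoC t0)))%C by (unfold delta; ring).
  change (Re (RtoC A / RtoC t0)%C + (kap k + Re (delta (RtoC t0))) <= A * T + kap k + 0.001).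
  rewrite Re_Adiv.
  assert (Rr : rho (RtoC t0) = T).
  { rewrite ET. change (t0 / (t0 ^ 2 + 0 ^ 2) = / t0). field. lra. }
  pose proof (zed_le _ Hrt) as HZ. rewrite Rr in *.
  assert (H18 : 2 <= 18 / K) by (apply le_div; lra).
  assert (HZ2 : exp (- (18 / K * T)) <= 0.0001).
  { rewrite exp_Ropp, <- (Rinv_inv 0.0001). apply Rinv_le_contravar; [lra|].
    apply Rle_trans with (exp 10); [pose proof exp_10_lower; lra|]. apply exp_le_exp. nra. }
  pose proof (delta_bound _ 0.0001 Hrt ltac:(lra) ltac:(lra)) as D.
  set (zk := zed (RtoC K * RtoC t0)%C) in *.
  assert (Cmod (delta (RtoC t0)) <= 0.001).
  { eapply Rle_trans; [apply D|]. apply div_le; lra. }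
  pose proof (Rabs_Re_le (delta (RtoC t0))). pose proof (Rle_abs (Re (delta (RtoC t0)))). lra. }
assert (L2 : y * T - 1 <= Re (Xk k r)).
{ pose proof (Xk_real_lower k t0 ltac:(lia) ltac:(lra)) as X. fold r in X. fold K in X. fold y in X.
  rewrite ET. exact X. }
(* The -1/2 of [Re_geom_upper] cancels the one of [Re_geom_lower]. What remains is at most 1.04 *
   10.83 / (4 * 81) < 0.035 times T, with 10.83 for pi^2 and 81 from |th| > 9 t0. *)
assert (L3 : Re (Xk k (Cexp (- t))) <= 0.035 * T).
{ unfold Xk.
  assert (Hw : Cmod (Cexp (- t) ^ k)%C < 1).
  { destruct k as [|k']; [lia|]. now apply Cmod_pow_S_lt_1, Cmod_Cexp_neg_lt_1. }
  pose proof (Re_geom_lower _ Hw) as G1.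
  assert (Nth : th <> 0) by (intros E0; rewrite E0, Rabs_R0 in Hfar; lra).
  pose proof (Re_geom_upper t0 th P0 Hpi Nth) as G2. fold t in G2.
  change (Re (Cexp (- t) / (1 - Cexp (- t)))%C - Re (Cexp (- t) ^ k / (1 - Cexp (- t) ^ k))%C <= 0.035 * T).
  assert (G3 : (exp t0 - 1) * PI ^ 2 / (4 * th ^ 2) <= 0.035 * T); [|lra].
  assert (Q1 : exp t0 - 1 <= 1.04 * t0).
  { pose proof (exp_le_inv t0 ltac:(lra)) as Q.
    assert (/ (1 - t0) <= 1 + 1.04 * t0); [|lra].
    rewrite <- (Rinv_inv (1 + 1.04 * t0)). apply Rinv_le_contravar; [apply Rinv_0_lt_compat; lra|].
    apply Rmult_le_reg_r with (1 + 1.04 * t0); [lra|]. rewrite Rinv_l by lra. nra. }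
  assert (Q2 : PI ^ 2 <= 10.83).
  { apply Rle_trans with (3.29 ^ 2); [|simpl; lra]. apply pow_incr. pose proof PI_upper. pose proof PI_lower. lra. }
  assert (Q3 : 81 * t0 ^ 2 <= th ^ 2).
  { replace (81 * t0 ^ 2) with ((9 * t0) ^ 2) by ring. rewrite <- (pow2_abs th). apply pow_incr. lra. }
  assert (Pt2 : 0 < t0 ^ 2) by (apply pow_lt; lra).
  pose proof (exp_ineq1_le t0) as Q4. pose proof (pow2_ge_0 PI) as Q5.
  apply div_le; [lra|].
  apply Rle_trans with (1.04 * t0 * 10.83).
  - apply Rmult_le_compat; lra.
  - apply Rle_trans with (0.035 * T * (4 * (81 * t0 ^ 2))).
    + rewrite ET. assert (/ t0 * t0 ^ 2 = t0) by (field; lra). lra.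
    + apply Rmult_le_compat_l; lra. }
assert (Main : - kap k + Re (log_fk k (Cexp (- t))) <= (a - 0.83) * v + (2 + 0.001)).
{ assert (EAT : A * T = a * v) by (unfold T; rewrite <- Ea; field; lra).
  assert (FR : 0.83 * v <= 2 * (y - 0.035) * T).
  { pose proof far_rate as F. unfold T.
    replace (2 * (y - 0.035) * (v / a)) with (2 * (y - 0.035) * v / a) by (field; lra).
    apply le_div; [lra|]. nra. }
  lra. }
eapply Rle_trans; [apply exp_le_exp, Main|]. rewrite exp_plus, Rmult_comm.
apply Rmult_le_compat_r; [apply Rlt_le, exp_pos|].
rewrite exp_plus.
assert (E2 : exp 2 <= 9).
{ replace 2 with (INR 2 * 1) by (simpl; ring). rewrite <- exp_pow_INR.
  apply Rle_trans with (3 ^ 2); [|simpl; lra]. apply pow_incr. split; [apply Rlt_le, exp_pos|apply exp_le_3]. }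
assert (E3 : exp 0.001 <= 1.01).
{ eapply Rle_trans; [apply exp_le_inv; lra|]. rewrite <- (Rinv_inv 1.01). apply Rinv_le_contravar; lra. }
pose proof (exp_pos 2). pose proof (exp_pos 0.001). nra.
Qed.

End Estimate.

(** Dividing by [exp (- t0) ^ n], which is exp (- a v), adds the second [a] to the exponent. The 10
    covers 0.5 + 0.02 near the real axis and 9.1 + 0.01 + 0.02 elsewhere. *)
Theorem pk_estimate k n : (2 <= k <= 9)%nat -> (1600 <= n)%nat ->
  Rabs (exp (- kap k) * INR (pk k n) - bessel (Ak k) (INR n)) <=
  10 * exp ((2 * sqrt (Ak k) - 0.83) * sqrt (INR n)).
Proof.
intros Hk Hn. set (v := sqrt (INR n)). set (a := sqrt (Ak k)).
assert (Hn' : 1600 <= INR n).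
{ replace 1600 with (INR 1600) by (rewrite INR_IZR_INZ; reflexivity). now apply le_INR. }
assert (Hv : 40 <= v).
{ unfold v. replace 40 with (sqrt (40 * 40)) by (apply sqrt_square; lra). apply sqrt_le_1_alt. lra. }
assert (Ev : v * v = INR n) by (apply sqrt_sqrt; lra).
pose proof (a_bounds k Hk) as Ha. fold a in Ha.
set (t0 := a / v). pose proof (t0_pos k Hk v Hv) as [P0 P1]. fold a in P0, P1. fold t0 in P0, P1.
set (d := fun m => exp (- kap k) * INR (pk k m) - bessel (Ak k) (INR m)).
assert (HA : 0 < Ak k).
{ pose proof (A_bounds k Hk). pose proof (y_bounds k Hk). lra. }
assert (Sm : forall th, Rabs th <= PI ->
   summable (fun m => RtoC (d m) * Cexp (- (t0, th)) ^ m)%C /\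
   Csum (fun m => RtoC (d m) * Cexp (- (t0, th)) ^ m)%C =
   (fnorm k (t0, th) - Csum (fun m => RtoC (bessel (Ak k) (INR m)) * Cexp (- (t0, th)) ^ m))%C).
{ intros th Hth. assert (Ht : 0 < Re (t0, th)) by exact P0.
  destruct (fk_exp k (Cexp (- (t0, th))) ltac:(lia) (Cmod_Cexp_neg_lt_1 _ Ht)) as [S1 _].
  destruct (comparator_gf (Ak k) (t0, th) HA Ht Hth) as [S2 _].
  assert (E : forall m, (RtoC (d m) * Cexp (- (t0, th)) ^ m = RtoC (exp (- kap k)) * gterm (pk k) (Cexp (- (t0, th))) m
     - RtoC (bessel (Ak k) (INR m)) * Cexp (- (t0, th)) ^ m)%C).
  { intros m. unfold d, gterm. rewrite RtoC_minus, RtoC_mult. ring. }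
  split.
  - eapply summable_ext; [intros m; symmetry; apply E|]. apply summable_minus; auto. now apply summable_scal.
  - rewrite (Csum_ext _ _ E), Csum_minus, Csum_scal by (auto; now apply summable_scal). reflexivity. }
assert (B : Rabs (d n) * exp (- t0) ^ n <= 10 * exp ((a - 0.83) * v)).
{ apply coefficient_bound.
  - destruct (Sm 0) as [S0 _]; [rewrite Rabs_R0; pose proof PI_RGT_0; lra|].
    apply ex_series_ext with (2 := S0). intros m. rewrite Cmod_mult, Cmod_R, Cmod_pow, Cmod_Cexp. reflexivity.
  - intros th Hth. rewrite (proj2 (Sm th Hth)).
    pose proof (comparator_bound k Hk v Hv th Hth) as C1. fold a in C1. fold t0 in C1.
    pose proof (exp_pos ((a - 0.83) * v)) as Pe.
    set (G := Csum (fun m => RtoC (bessel (Ak k) (INR m)) * Cexp (- (t0, th)) ^ m)%C) in *.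
    set (X := Cexp (RtoC (Ak k) / (t0, th))%C) in *.
    destruct (Rle_or_lt (Rabs th) (9 * t0)) as [L|L].
    + pose proof (near_bound k Hk v Hv th L) as N. fold a in N. fold t0 in N. fold X in N.
      replace (fnorm k (t0, th) - G)%C with ((fnorm k (t0, th) - X) + - (G - X))%C by ring.
      eapply Rle_trans; [apply Cmod_triangle|]. rewrite Cmod_opp. lra.
    + pose proof (far_bound k Hk v Hv th Hth L) as N. fold a in N. fold t0 in N.
      pose proof (Aexp_far k Hk v Hv th L) as M. fold a in M. fold t0 in M. fold X in M.
      replace (fnorm k (t0, th) - G)%C with ((fnorm k (t0, th) + - X) + - (G - X))%C by ring.
      eapply Rle_trans; [apply Cmod_triangle|].
      pose proof (Cmod_triangle (fnorm k (t0, th)) (- X)) as Tr. rewrite !Cmod_opp in *. lra. }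
rewrite exp_pow_INR in B.
assert (En : INR n * - t0 = - (a * v)) by (rewrite <- Ev; unfold t0; field; lra).
rewrite En, exp_Ropp in B. fold (d n).
replace ((2 * a - 0.83) * v) with ((a - 0.83) * v + a * v) by ring. rewrite exp_plus.
pose proof (exp_pos (a * v)) as Pe.
apply Rmult_le_reg_r with (/ exp (a * v)); [now apply Rinv_0_lt_compat|].
replace (10 * (exp ((a - 0.83) * v) * exp (a * v)) * / exp (a * v)) with (10 * exp ((a - 0.83) * v)) by (field; lra).
exact B.
Qed.

(** * Convexity for large n *)

(** The constant is 10 * 27 / (2 * 6 * 0.0295) rounded up, as [relative_error] needs it. At v = 40
    the claim rests on 2.7^33; beyond, on (1 + x)^7 <= exp (7 x). *)
Lemma exp_beats_pow7 v : 40 <= v -> 763 * v ^ 7 <= exp (0.83 * v).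
Proof.
intros Hv. set (x := (v - 40) / 40).
assert (Hx : 0 <= x) by (apply Rdiv_le_0_compat; lra).
assert (Ev : v = 40 * (1 + x)) by (unfold x; field).
assert (E1 : (1 + x) ^ 7 <= exp (INR 7 * x)).
{ rewrite <- exp_pow_INR. apply pow_incr. split; [lra|apply exp_ineq1_le]. }
assert (E2 : 763 * 40 ^ 7 <= exp 33).
{ replace 33 with (INR 33 * 1) by (rewrite INR_IZR_INZ; simpl; ring). rewrite <- exp_pow_INR.
  apply Rle_trans with (2.7 ^ 33); [simpl; lra|]. apply pow_incr. pose proof exp_1_lower. lra. }
rewrite Ev, Rpow_mult_distr.
apply Rle_trans with (exp 33 * exp (INR 7 * x)).
- rewrite <- Rmult_assoc. apply Rmult_le_compat; auto.
  + apply Rmult_le_pos; [lra|apply pow_le; lra].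
  + apply pow_le; lra.
- rewrite <- exp_plus. apply exp_le_exp. simpl. lra.
Qed.

Lemma bessel_one_lower k : (2 <= k <= 9)%nat -> 2 <= bessel (Ak k) 1.
Proof.
intros Hk. pose proof (A_bounds k Hk) as HA. pose proof (y_bounds k Hk) as Hy.
assert (PA : 0 < Ak k) by lra.
pose proof (PSeries_pos_ge (bessel_coeff (Ak k)) 1 3 (fun n => Rlt_le _ _ (bessel_coeff_pos _ PA n)) ltac:(lra) (CV_bessel_coeff _ PA 1)) as H.
unfold bessel. eapply Rle_trans; [|exact H]. unfold bessel_coeff. simpl. set (A := Ak k) in *.
assert (1.2 <= A) by lra.
assert (1.44 <= A * A) by nra. assert (1.728 <= A * (A * A)) by nra. lra.
Qed.

(** By [bessel_lower] the comparison value is at least (2/27) exp (2 a v) / v^(3/2) with v = sqrt n,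
    so the relative error is at most a multiple of v^(3/2) exp (- 0.83 v). The constant 0.0295 lies
    below an eighth of the 0.35 in [log_convexity_gap]. *)
Lemma relative_error k n : (2 <= k <= 9)%nat -> (1600 <= n)%nat ->
  Rabs (exp (- kap k) * INR (pk k n) - bessel (Ak k) (INR n)) <=
  0.0295 / sqrt (INR n) ^ 5 * bessel (Ak k) (INR n).
Proof.
intros Hk Hn. eapply Rle_trans; [now apply pk_estimate|].
pose proof (a_bounds k Hk) as Ha. pose proof (bessel_one_lower k Hk) as B1.
assert (PA : 0 < Ak k) by (pose proof (A_bounds k Hk); pose proof (y_bounds k Hk); lra).
set (A := Ak k) in *. set (a := sqrt A) in *.
assert (Hn' : 1600 <= INR n).
{ replace 1600 with (INR 1600) by (rewrite INR_IZR_INZ; reflexivity). now apply le_INR. }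
set (v := sqrt (INR n)) in *.
assert (Ev : v * v = INR n) by (apply sqrt_sqrt; lra).
assert (Hv : 40 <= v).
{ unfold v. replace 40 with (sqrt (40 * 40)) by (apply sqrt_square; lra). apply sqrt_le_1_alt. lra. }
pose proof (bessel_lower A PA (INR n) ltac:(lra)) as BL. fold a in BL.
assert (E27 : / 27 <= exp (- (2 * a))).
{ rewrite exp_Ropp. apply Rinv_le_contravar; [apply exp_pos|].
  apply Rle_trans with (exp (INR 3 * 1)); [apply exp_le_exp; simpl; lra|].
  rewrite <- exp_pow_INR. apply Rle_trans with (3 ^ 3); [|simpl; lra]. apply pow_incr.
  split; [apply Rlt_le, exp_pos|apply exp_le_3]. }
unfold bessel_growth in BL. fold a v in BL.
set (s := sqrt v). assert (Es : s * s = v) by (apply sqrt_sqrt; lra).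
assert (Ps : 0 < s) by (apply sqrt_lt_R0; lra).
assert (Hs : 6 <= s).
{ unfold s. replace 6 with (sqrt (6 * 6)) by (apply sqrt_square; lra). apply sqrt_le_1_alt. lra. }
assert (Eln : exp (2 * a * v - 3 / 4 * ln (INR n)) = exp (2 * a * v) / (v * s)).
{ assert (L : 3 / 4 * ln (INR n) = ln (v * s)).
  { rewrite <- Ev, <- Es. rewrite !ln_mult; try lra; try (apply Rmult_lt_0_compat; lra). }
  unfold Rminus. rewrite L, exp_plus, exp_Ropp, exp_ln; [reflexivity|apply Rmult_lt_0_compat; lra]. }
rewrite Eln in BL.
assert (Pvs : 0 < v * s) by (apply Rmult_lt_0_compat; lra).
assert (Pe : 0 < exp (2 * a * v)) by apply exp_pos.
assert (Pv5 : 0 < v ^ 5) by (apply pow_lt; lra).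
assert (BL2 : 2 / 27 * (exp (2 * a * v) / (v * s)) <= bessel A (INR n)).
{ eapply Rle_trans; [|exact BL]. apply Rmult_le_compat_r; [apply Rdiv_le_0_compat; lra|].
  apply Rle_trans with (2 * / 27); [lra|]. apply Rmult_le_compat; lra. }
apply Rle_trans with (0.0295 / v ^ 5 * (2 / 27 * (exp (2 * a * v) / (v * s)))).
2:{ apply Rmult_le_compat_l; [apply Rdiv_le_0_compat; lra|exact BL2]. }
replace ((2 * a - 0.83) * v) with (2 * a * v + - (0.83 * v)) by ring.
rewrite exp_plus, exp_Ropp.
pose proof (exp_beats_pow7 v Hv) as X. pose proof (exp_pos (0.83 * v)) as Pq.
set (Q := exp (0.83 * v)) in *. set (W := exp (2 * a * v)) in *.
assert (Key : 10 * (v ^ 5 * (v * s) * 27) <= 0.0295 * 2 * Q).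
{ assert (v * s <= v * v / 6) by nra.
  assert (v ^ 5 * (v * s) <= v ^ 5 * (v * v / 6)) by (apply Rmult_le_compat_l; lra).
  replace (v ^ 7) with (v ^ 5 * (v * v)) in X by ring. lra. }
apply Rmult_le_reg_r with (Q * (v ^ 5 * (v * s) * 27) * / W).
{ repeat apply Rmult_lt_0_compat; try lra. now apply Rinv_0_lt_compat. }
replace (10 * (W * / Q) * (Q * (v ^ 5 * (v * s) * 27) * / W)) with (10 * (v ^ 5 * (v * s) * 27)).
2:{ field. lra. }
replace (0.0295 / v ^ 5 * (2 / 27 * (W / (v * s))) * (Q * (v ^ 5 * (v * s) * 27) * / W)) with (0.0295 * 2 * Q).
2:{ set (e := 0.0295). field. repeat split; lra. }
exact Key.
Qed.

(** The third difference of ln b is [logder2] at some c in [x, x + 3]. There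
    [3 / 8 * a - 63 / 32 / 40 >= 0.36], and passing from c to x costs a factor of at most 1.02,
    which leaves 0.35. *)
Lemma log_convexity_gap k n : (2 <= k <= 9)%nat -> (1601 <= n)%nat ->
  let b m := bessel (Ak k) (INR m) in
  b (n - 1)%nat * b (n + 1)%nat ^ 3 * (1 + 0.35 / sqrt (INR (n - 1)) ^ 5) <= b n ^ 3 * b (n + 2)%nat.
Proof.
intros Hk Hn b. pose proof (a_bounds k Hk) as Ha.
assert (PA : 0 < Ak k) by (pose proof (A_bounds k Hk); pose proof (y_bounds k Hk); lra).
set (A := Ak k) in *. set (a := sqrt A) in *. set (x := INR (n - 1)).
assert (Hx : 1600 <= x).
{ unfold x. replace 1600 with (INR 1600) by (rewrite INR_IZR_INZ; reflexivity). apply le_INR; lia. }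
assert (E1 : INR n = x + 1) by (unfold x; rewrite minus_INR by lia; simpl; ring).
assert (E2 : INR (n + 1) = x + 2) by (rewrite plus_INR, E1; simpl; ring).
assert (E3 : INR (n + 2) = x + 3) by (rewrite plus_INR, E1; simpl; ring).
destruct (third_difference (fun y => ln (bessel A y)) (logder A) (logder1 A) (logder2 A) x) as [c [Hc Ec]].
{ lra. }
{ intros; now apply is_derive_ln_bessel. }
{ intros; now apply is_derive_logder. }
{ intros; now apply is_derive_logder1. }
assert (Pc : 0 < c) by lra.
set (w := sqrt x). set (q := sqrt c).
assert (Hw : 40 <= w).
{ unfold w. replace 40 with (sqrt (40 * 40)) by (apply sqrt_square; lra). apply sqrt_le_1_alt. lra. }
assert (Hq : w <= q) by (apply sqrt_le_1_alt; lra).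
assert (Ew : w * w = x) by (apply sqrt_sqrt; lra).
assert (Eq : q * q = c) by (apply sqrt_sqrt; lra).
pose proof (logder2_lower A PA c Pc) as L. fold a q in L. specialize (L ltac:(nra)).
assert (Pw5 : 0 < w ^ 5) by (apply pow_lt; lra). assert (Pq5 : 0 < q ^ 5) by (apply pow_lt; lra).
assert (D : 0.35 / w ^ 5 <= logder2 A c).
{ eapply Rle_trans; [|exact L].
  assert (Iq : / q <= / 40) by (apply Rinv_le_contravar; lra).
  assert (Pi : 0 < / q) by (apply Rinv_0_lt_compat; lra).
  assert (Pi5 : 0 < (/ q) ^ 5) by now apply pow_lt.
  apply Rle_trans with (0.36 * (/ q) ^ 5).
  2:{ replace (3 / 8 * a * (/ q) ^ 5 - 63 / 32 * (/ q) ^ 6) with ((3 / 8 * a - 63 / 32 * / q) * (/ q) ^ 5) by ring.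
      apply Rmult_le_compat_r; lra. }
  rewrite pow_inv.
  assert (R : q ^ 5 <= 1.02 * w ^ 5).
  { assert (q <= 1.001 * w).
    { apply Rsqr_incr_0_var; unfold Rsqr; [|lra]. rewrite Eq.
      replace (1.001 * w * (1.001 * w)) with (1.001 * 1.001 * (w * w)) by ring. rewrite Ew. lra. }
    apply Rle_trans with ((1.001 * w) ^ 5); [apply pow_incr; lra|].
    rewrite Rpow_mult_distr. apply Rmult_le_compat_r; [lra|]. simpl. lra. }
  apply Rmult_le_reg_r with (w ^ 5 * q ^ 5); [now apply Rmult_lt_0_compat|].
  apply Rle_trans with (0.35 * q ^ 5); [|apply Rle_trans with (0.36 * w ^ 5); [lra|]].
  - right. set (e := 0.35). field. lra.
  - right. set (e := 0.36). field. lra. }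
assert (Pb : forall m, 0 < b m) by (intros m; apply bessel_pos; [auto|apply pos_INR]).
assert (EL : ln (b (n + 2)%nat) - 3 * ln (b (n + 1)%nat) + 3 * ln (b n) - ln (b (n - 1)%nat) = logder2 A c).
{ unfold b. rewrite E1, E2, E3. fold x. exact Ec. }
assert (Eexp : b n ^ 3 * b (n + 2)%nat = b (n - 1)%nat * b (n + 1)%nat ^ 3 * exp (logder2 A c)).
{ rewrite <- EL.
  replace (ln (b (n + 2)%nat) - 3 * ln (b (n + 1)%nat) + 3 * ln (b n) - ln (b (n - 1)%nat))
    with (ln (b (n + 2)%nat) + - (INR 3 * ln (b (n + 1)%nat)) + INR 3 * ln (b n) + - ln (b (n - 1)%nat)) by (simpl; ring).
  rewrite !exp_plus, !exp_Ropp, <- !exp_pow_INR, !exp_ln by auto.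
  pose proof (Pb (n - 1)%nat). pose proof (Pb (n + 1)%nat). field. split; lra. }
rewrite Eexp. apply Rmult_le_compat_l.
- apply Rmult_le_pos; [apply Rlt_le, Pb|apply pow_le, Rlt_le, Pb].
- fold w. eapply Rle_trans; [|apply exp_ineq1_le]. lra.
Qed.

(* AM-GM: the outer terms add up to at least [2 * sqrt (q0 * q1 ^ 3 * q2 * q3)]. *)
Lemma convex_from_gap q0 q1 q2 q3 : 0 < q0 -> 0 < q1 -> 0 < q2 -> 0 < q3 ->
  q0 * q2 ^ 3 < q1 ^ 3 * q3 -> 0 < q2 * q1 ^ 2 - 2 * q0 * q2 ^ 2 + q0 * q1 * q3.
Proof.
intros P0 P1 P2 P3 H.
set (X := q2 * q1 ^ 2). set (Y := q0 * q1 * q3). set (Z := q0 * q2 ^ 2).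
assert (PX : 0 < X) by (apply Rmult_lt_0_compat; [lra|now apply pow_lt]).
assert (PY : 0 < Y) by (repeat apply Rmult_lt_0_compat; lra).
assert (PZ : 0 < Z) by (apply Rmult_lt_0_compat; [lra|now apply pow_lt]).
assert (K : Z * Z < X * Y).
{ unfold X, Y, Z. replace (q0 * q2 ^ 2 * (q0 * q2 ^ 2)) with (q0 * q2 * (q0 * q2 ^ 3)) by ring.
  replace (q2 * q1 ^ 2 * (q0 * q1 * q3)) with (q0 * q2 * (q1 ^ 3 * q3)) by ring.
  apply Rmult_lt_compat_l; auto. apply Rmult_lt_0_compat; lra. }
assert (S : (2 * Z) * (2 * Z) < (X + Y) * (X + Y)).
{ pose proof (pow2_ge_0 (X - Y)). nra. }
assert (2 * Z < X + Y).
{ destruct (Rlt_or_le (2 * Z) (X + Y)) as [L|L]; auto. exfalso.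
  assert ((X + Y) * (X + Y) <= 2 * Z * (2 * Z)) by (apply Rmult_le_compat; lra). lra. }
unfold X, Y, Z in *. lra.
Qed.

(** The inequality is homogeneous of degree 3, so the factor exp (- kap) is harmless. A relative
    error eta = 0.0295 om enters four times on each side of the gap and costs about 8 eta, less than
    0.35 om. *)
Theorem pk_large k n : (2 <= k <= 9)%nat -> (1601 <= n)%nat ->
  let p m := INR (pk k m) in
  0 < p (n + 1)%nat * p n ^ 2 - 2 * p (n - 1)%nat * p (n + 1)%nat ^ 2 + p (n - 1)%nat * p n * p (n + 2)%nat.
Proof.
intros Hk Hn p. set (b := fun m => bessel (Ak k) (INR m)).
set (q := fun m => exp (- kap k) * p m).
assert (PA : 0 < Ak k) by (pose proof (A_bounds k Hk); pose proof (y_bounds k Hk); lra).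
assert (Pb : forall m, 0 < b m) by (intros m; apply bessel_pos; [auto|apply pos_INR]).
set (w := sqrt (INR (n - 1))).
assert (Hw : 40 <= w).
{ unfold w. replace 40 with (sqrt (40 * 40)) by (apply sqrt_square; lra). apply sqrt_le_1_alt.
  replace (40 * 40) with (INR 1600) by (rewrite INR_IZR_INZ; simpl; lra). apply le_INR; lia. }
set (om := / w ^ 5).
assert (Hom : 0 < om <= 0.0001).
{ unfold om. split; [apply Rinv_0_lt_compat, pow_lt; lra|].
  rewrite <- (Rinv_inv 0.0001). apply Rinv_le_contravar; [lra|].
  apply Rle_trans with (40 ^ 5); [simpl; lra|]. apply pow_incr. lra. }
set (eta := 0.0295 * om).
assert (Q : forall m, (n - 1 <= m)%nat -> (1 - eta) * b m <= q m <= (1 + eta) * b m).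
{ intros m Hm. pose proof (relative_error k m Hk ltac:(lia)) as R. fold (p m) in R. fold (q m) in R. fold (b m) in R.
  assert (L : 0.0295 / sqrt (INR m) ^ 5 <= eta).
  { unfold eta, om, Rdiv. apply Rmult_le_compat_l; [lra|]. apply Rinv_le_contravar; [apply pow_lt; lra|].
    apply pow_incr. split; [lra|]. apply sqrt_le_1_alt. now apply le_INR. }
  assert (L2 : 0.0295 / sqrt (INR m) ^ 5 * b m <= eta * b m) by (apply Rmult_le_compat_r; [apply Rlt_le, Pb|auto]).
  assert (R2 : Rabs (q m - b m) <= eta * b m) by lra.
  apply Rabs_le_between in R2. lra. }
assert (Heta : 0 < eta < 0.01) by (unfold eta; lra).
pose proof (log_convexity_gap k n Hk Hn) as G. cbv zeta in G.
change (b (n - 1)%nat * b (n + 1)%nat ^ 3 * (1 + 0.35 * om) <= b n ^ 3 * b (n + 2)%nat) in G.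
pose proof (Q (n - 1)%nat ltac:(lia)) as [_ Q0]. pose proof (Q n ltac:(lia)) as [Q1 _].
pose proof (Q (n + 1)%nat ltac:(lia)) as [_ Q2]. pose proof (Q (n + 2)%nat ltac:(lia)) as [Q3 _].
assert (Pq : forall m, (n - 1 <= m)%nat -> 0 < q m).
{ intros m Hm. eapply Rlt_le_trans; [|apply (Q m Hm)]. apply Rmult_lt_0_compat; [lra|apply Pb]. }
set (B0 := b (n - 1)%nat) in *. set (B1 := b n) in *. set (B2 := b (n + 1)%nat) in *. set (B3 := b (n + 2)%nat) in *.
assert (PB0 : 0 < B0) by apply Pb. assert (PB1 : 0 < B1) by apply Pb.
assert (PB2 : 0 < B2) by apply Pb. assert (PB3 : 0 < B3) by apply Pb.
assert (Up : q (n - 1)%nat * q (n + 1)%nat ^ 3 <= (1 + eta) ^ 4 * (B0 * B2 ^ 3)).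
{ replace ((1 + eta) ^ 4 * (B0 * B2 ^ 3)) with (((1 + eta) * B0) * ((1 + eta) * B2) ^ 3) by ring.
  apply Rmult_le_compat; auto.
  - apply Rlt_le, Pq; lia.
  - apply pow_le, Rlt_le, Pq; lia.
  - apply pow_incr. split; auto. apply Rlt_le, Pq; lia. }
assert (Lo : (1 - eta) ^ 4 * (B1 ^ 3 * B3) <= q n ^ 3 * q (n + 2)%nat).
{ replace ((1 - eta) ^ 4 * (B1 ^ 3 * B3)) with (((1 - eta) * B1) ^ 3 * ((1 - eta) * B3)) by ring.
  assert (0 < (1 - eta) * B1) by (apply Rmult_lt_0_compat; lra).
  assert (0 < (1 - eta) * B3) by (apply Rmult_lt_0_compat; lra).
  apply Rmult_le_compat; try lra.
  - apply pow_le; lra.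
  - apply pow_incr; lra. }
assert (PM : 0 < B0 * B2 ^ 3) by (apply Rmult_lt_0_compat; [auto|now apply pow_lt]).
set (M := B0 * B2 ^ 3) in *.
assert (N : (1 + eta) ^ 4 < (1 - eta) ^ 4 * (1 + 0.35 * om)).
{ assert (U : (1 + eta) ^ 4 <= 1 + 4.1 * eta).
  { replace ((1 + eta) ^ 4) with (1 + eta * (4 + 6 * eta + 4 * (eta * eta) + eta * eta * eta)) by ring.
    assert (eta * eta <= 0.01 * eta) by nra. assert (eta * eta * eta <= 0.01 * eta) by nra. nra. }
  assert (L : 1 - 4 * eta <= (1 - eta) ^ 4).
  { replace ((1 - eta) ^ 4) with (((1 - eta) ^ 2) ^ 2) by ring.
    assert (1 - 2 * eta <= (1 - eta) ^ 2) by nra.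
    assert ((1 - 2 * eta) ^ 2 <= ((1 - eta) ^ 2) ^ 2) by (apply pow_incr; lra). nra. }
  assert ((1 - 4 * eta) * (1 + 0.35 * om) <= (1 - eta) ^ 4 * (1 + 0.35 * om)) by (apply Rmult_le_compat_r; lra).
  assert (1 + 4.1 * eta < (1 - 4 * eta) * (1 + 0.35 * om)); [|lra].
  unfold eta. nra. }
assert (Gap : q (n - 1)%nat * q (n + 1)%nat ^ 3 < q n ^ 3 * q (n + 2)%nat).
{ apply Rle_lt_trans with ((1 + eta) ^ 4 * M); auto.
  apply Rlt_le_trans with ((1 - eta) ^ 4 * (1 + 0.35 * om) * M).
  - now apply Rmult_lt_compat_r.
  - eapply Rle_trans; [|exact Lo]. rewrite Rmult_assoc. apply Rmult_le_compat_l; [apply pow_le; lra|]. lra. }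
pose proof (convex_from_gap _ _ _ _ (Pq (n - 1)%nat ltac:(lia)) (Pq n ltac:(lia)) (Pq (n + 1)%nat ltac:(lia)) (Pq (n + 2)%nat ltac:(lia)) Gap) as Cx.
assert (PE : 0 < exp (- kap k)) by apply exp_pos.
apply Rmult_lt_reg_l with (exp (- kap k) ^ 3); [now apply pow_lt|]. rewrite Rmult_0_r.
eapply Rlt_le_trans; [exact Cx|]. right. unfold q. ring.
Qed.

(** * Computation by Gauss's recurrence *)

Local Open Scope Z_scope.

(* Coefficient of [q ^ n] in [1 + 2 * sum_(j >= 1) (-1)^j q^(k j^2)]. *)
Definition theta (k n : N) : Z :=
  let s := N.sqrt (n / k) in
  if (k * (s * s) =? n)%N then
    match s with N0 => 1 | _ => if N.odd s then -2 else 2 end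
  else 0.

(* Alternating sum of the entries of [l] at square distances: [c] is the distance to the next
   such entry and [g] the gap after it, which grows by [2]. *)
Fixpoint walk (l : list Z) (c g : nat) : Z :=
  match l with
  | nil => 0
  | x :: l' => match c with
               | O => x - walk l' g (S (S g))
               | S c' => walk l' c' g
               end
  end.

(** The recurrence p(n) = theta_k(n) - 2 sum_(j >= 1) (-1)^j p(n - j^2). The head of the list is at
    distance 1, already a square, hence the counter 0; two entries separate it from distance 4,
    hence the gap 2. *)
Definition next_value (k n : N) (l : list Z) : Z := theta k n + 2 * walk l 0 2.

Definition positive_gap (a b c d : Z) : bool := 2 * (a * (c * c)) <? b * (b * c + a * d).

(* Only the leading bits are compared, with the lower side rounded up and the upper side
   rounded down. *)
Definition gap_test (a b c d : Z) : bool :=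
  let s := Z.log2 a - 40 in
  if s <=? 0 then positive_gap a b c d
  else
    let lo x := Z.shiftr x s in
    let hi x := Z.shiftr x s + 1 in
    2 * (hi a * (hi c * hi c)) <? lo b * (lo b * lo c + lo a * lo d).

(* [l] holds the values at [n - 1, ..., 0]. *)
Fixpoint gap_run (fuel : nat) (k n start : N) (l : list Z) : bool :=
  match fuel with
  | O => true
  | S f =>
      let x := next_value k n l in
      match l with
      | c :: b :: a :: _ => if (start <=? n)%N then (if gap_test a b c x then gap_run f k (N.succ n) start (x :: l) else false)
                            else gap_run f k (N.succ n) start (x :: l)
      | _ => gap_run f k (N.succ n) start (x :: l)
      end
  end.

Close Scope Z_scope.

(** * Gauss's identity *)

Fixpoint qprod (z : C) (n : nat) : C :=
  match n with
  | O => 1%C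
  | S m => (qprod z m * ((1 + z ^ S m) / (1 - z ^ S m)))%C
  end.

Definition sgn (j : nat) : C := ((- (1)) ^ j)%C.

(* Shanks's finite form of Gauss's identity for [sum (-1)^j z^(j^2)]. *)
Definition shanks_term (z : C) (n s : nat) : C :=
  (sgn s * qprod z s * z ^ (s * (n + 1)) * (2 / (1 + z ^ s)))%C.

Definition gauss_partial (z : C) (n : nat) : C :=
  (1 + csum (fun j => 2 * sgn (S j) * z ^ (S j * S j)) n)%C.

Lemma C1_plus_pow_neq_0 z s : Cmod z < 1 -> (1 + z ^ s <> 0)%C.
Proof.
intros Hz. destruct s as [|s].
- simpl. replace (1 + 1)%C with (RtoC 2) by (rewrite <- RtoC_plus; f_equal; ring).
  intros E; apply RtoC_inj in E; lra.
- replace (z ^ S s)%C with (- - z ^ S s)%C by ring. apply C1_minus_neq_0. rewrite Cmod_opp.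
  now apply Cmod_pow_S_lt_1.
Qed.

Lemma C1_minus_pow_neq_0 z s : Cmod z < 1 -> (1 - z ^ S s <> 0)%C.
Proof. intros Hz. now apply C1_minus_neq_0, Cmod_pow_S_lt_1. Qed.

(** For fixed n the sum telescopes in N. At N = n it carries [shanks_identity] from n to n + 1: its
    right-hand side then has exponent n (n + 1) + (n + 1) = (n + 1)^2, the next square. *)
Lemma shanks_telescope z n N : Cmod z < 1 -> z <> 0%C ->
  csum (fun s => shanks_term z (S n) s * ((1 - z ^ S n) / (1 + z ^ S n)) - shanks_term z n s)%C (S N) =
  (- (2 * z ^ S n / (1 + z ^ S n)) * sgn N * qprod z N * z ^ (N * S n))%C.
Proof.
intros Hz Nz. pose proof (C1_plus_pow_neq_0 z (S n) Hz) as H1.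
induction N as [|N IH].
- rewrite csum_1. unfold shanks_term, sgn. simpl (qprod z 0). simpl (0 * _)%nat. simpl (_ ^ 0)%C.
  field. auto.
- match goal with |- csum ?f _ = _ => change (csum f (S (S N))) with (csum f (S N) + f (S N))%C end. rewrite IH. clear IH.
  unfold shanks_term.
  pose proof (C1_plus_pow_neq_0 z (S N) Hz) as H2. pose proof (C1_minus_pow_neq_0 z N Hz) as H3.
  replace (sgn (S N)) with (- sgn N)%C by (unfold sgn; rewrite Cpow_S; ring).
  change (qprod z (S N)) with (qprod z N * ((1 + z ^ S N) / (1 - z ^ S N)))%C.
  replace (z ^ (S N * (S n + 1)))%C with (z ^ (N * S n) * z ^ S n * z ^ S N)%C
    by (rewrite <- !Cpow_add_r; f_equal; lia).
  replace (z ^ (S N * (n + 1)))%C with (z ^ (N * S n) * z ^ S n)%C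
    by (rewrite <- !Cpow_add_r; f_equal; lia).
  replace (z ^ (S N * S n))%C with (z ^ (N * S n) * z ^ S n)%C
    by (rewrite <- !Cpow_add_r; f_equal; lia).
  set (u := (z ^ S n)%C) in *. set (v := (z ^ S N)%C) in *. field. auto.
Qed.

Lemma qprod_neq_0 z n : Cmod z < 1 -> qprod z n <> 0%C.
Proof.
intros Hz. induction n as [|n IH].
- intros E; apply RtoC_inj in E; lra.
- change (qprod z (S n)) with (qprod z n * ((1 + z ^ S n) / (1 - z ^ S n)))%C.
  apply Cmult_neq_0; auto. unfold Cdiv. apply Cmult_neq_0; [now apply C1_plus_pow_neq_0|].
  pose proof (C1_minus_pow_neq_0 z n Hz) as H. intros E. apply (C1_minus_pow_neq_0 z n Hz).
  replace (1 - z ^ S n)%C with ((1 - z ^ S n) * (1 - z ^ S n) * / (1 - z ^ S n))%C by (field; auto).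
  rewrite <- Cmult_assoc, (Cmult_comm (1 - z ^ S n) (/ _)), E. ring.
Qed.

Lemma shanks_identity z n : Cmod z < 1 -> z <> 0%C ->
  (qprod z n * gauss_partial z n = csum (shanks_term z n) (S n))%C.
Proof.
intros Hz Nz. induction n as [|n IH].
- rewrite csum_1. unfold gauss_partial, shanks_term, sgn. simpl. field.
- pose proof (shanks_telescope z n n Hz Nz) as T. unfold Cminus in T.
  rewrite csum_plus, csum_opp in T. rewrite <- IH in T.
  rewrite (csum_ext (fun s => shanks_term z (S n) s * ((1 - z ^ S n) / (1 + z ^ S n)))%C
    (fun s => ((1 - z ^ S n) / (1 + z ^ S n)) * shanks_term z (S n) s)%C) in T by (intros; ring).
  rewrite csum_scal in T.
  change (csum (shanks_term z (S n)) (S (S n))) with (csum (shanks_term z (S n)) (S n) + shanks_term z (S n) (S n))%C.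
  pose proof (C1_plus_pow_neq_0 z (S n) Hz) as H2. pose proof (C1_minus_pow_neq_0 z n Hz) as H3.
  pose proof (qprod_neq_0 z n Hz) as H4.
  set (X := csum (shanks_term z (S n)) (S n)) in *.
  unfold gauss_partial in *. unfold shanks_term.
  match goal with |- context [csum ?f (S n)] => change (csum f (S n)) with (csum f n + f n)%C end.
  cbv beta.
  change (qprod z (S n)) with (qprod z n * ((1 + z ^ S n) / (1 - z ^ S n)))%C.
  replace (sgn (S n)) with (- sgn n)%C by (unfold sgn; rewrite Cpow_S; ring).
  replace (z ^ (n * S n))%C with (z ^ (n * S n))%C in T by reflexivity.
  replace (z ^ (S n * (S n + 1)))%C with (z ^ (n * S n) * z ^ S n * z ^ S n)%C
    by (rewrite <- !Cpow_add_r; f_equal; lia).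
  replace (z ^ (S n * S n))%C with (z ^ (n * S n) * z ^ S n)%C
    by (rewrite <- !Cpow_add_r; f_equal; lia).
  set (u := (z ^ S n)%C) in *. set (w := (z ^ (n * S n))%C) in *.
  set (c := csum (fun j => 2 * sgn (S j) * z ^ (S j * S j))%C n) in *.
  assert (EX : X = ((1 + u) / (1 - u) * (qprod z n * (1 + c) - 2 * u / (1 + u) * sgn n * qprod z n * w))%C).
  { replace (qprod z n * (1 + c) - 2 * u / (1 + u) * sgn n * qprod z n * w)%C with ((1 - u) / (1 + u) * X)%C.
    - field. auto.
    - transitivity (((1 - u) / (1 + u) * X + - (qprod z n * (1 + c))) + qprod z n * (1 + c))%C; [ring|].
      rewrite T. ring. }
  rewrite EX. field. auto.
Qed.

Lemma qprod_gf z M : Cmod z < 1 ->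
  summable (gterm (cpart 0 M) z) /\ Csum (gterm (cpart 0 M) z) = qprod z M.
Proof.
intros Hz. induction M as [|M [IS IE]].
- destruct (cpart_gf 0 0 z Hz) as [Ss E]. split; auto. rewrite E. simpl. apply Cexp_0.
- change (cpart 0 (S M)) with (add_part (S M) (cpart 0 M)).
  destruct (step_gf (S M) (cpart 0 M) z ltac:(lia) Hz IS) as [Ss E]. split; auto.
  rewrite E, IE. change (qprod z (S M)) with (qprod z M * ((1 + z ^ S M) / (1 - z ^ S M)))%C. ring.
Qed.

Definition overpartition_gf (z : C) : C := Csum (gterm (pk 0) z).

(** By [qprod_gf] the product counts overpartitions with bounded parts, so the series of all
    overpartitions dominates it coefficientwise. *)
Lemma qprod_bound z : Cmod z < 1 -> exists B, 0 <= B /\ forall s, Cmod (qprod z s) <= B.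
Proof.
intros Hz. destruct (pk_gf 0 z Hz) as [Ss _].
exists (Series (fun n => Cmod (gterm (pk 0) z n))). split.
- apply Series_nonneg; auto. intros; apply Cmod_ge_0.
- intros s. rewrite <- (proj2 (qprod_gf z s Hz)). apply Csum_Cmod_le; auto.
  intros n. rewrite !Cmod_gterm. apply Rmult_le_compat_r; [apply pow_le, Cmod_ge_0|]. apply le_INR, cpart_le_pk.
Qed.

Lemma Cmod_sgn j : Cmod (sgn j) = 1.
Proof. unfold sgn. rewrite Cmod_pow, Cmod_opp, Cmod_1. apply pow1. Qed.

(** The term s = 0 is exactly 1. All others contain z^(s (n + 1)) with s >= 1, and their remaining
    factors are bounded, so together they are O(|z|^(n+1)). *)
Lemma shanks_limit z : Cmod z < 1 -> Clim (fun n => csum (shanks_term z n) (S n)) 1%C.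
Proof.
intros Hz. destruct (qprod_bound z Hz) as [B [PB HB]]. pose proof (Cmod_ge_0 z) as Pz. set (r := Cmod z) in *.
set (c := B * (2 / (1 - r)) * / (1 - r)).
apply Clim_0_squeeze with (fun n => c * r ^ S n).
- intros n. change (S n) with (1 + n)%nat at 1. rewrite csum_split, csum_1.
  assert (E0 : shanks_term z n 0 = 1%C).
  { unfold shanks_term, sgn. simpl. field. }
  rewrite E0. replace (1 + csum (fun i => shanks_term z n (1 + i)) n - 1)%C with (csum (fun i => shanks_term z n (1 + i)) n) by ring.
  eapply Rle_trans; [apply csum_Cmod|].
  apply Rle_trans with (rsum (fun i => (B * (2 / (1 - r)) * r ^ S n) * r ^ i) n).
  + apply rsum_le. intros i _. unfold shanks_term.
    rewrite !Cmod_mult, Cmod_sgn, Cmod_pow, Cmod_div, Cmod_R, (Rabs_pos_eq 2), Rmult_1_l by (try lra; now apply C1_plus_pow_neq_0).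
    fold r.
    assert (D : 1 - r <= Cmod (1 + z ^ (1 + i))).
    { pose proof (Cmod_triangle_inv 1 (z ^ (1 + i))) as T. rewrite Cmod_1, Cmod_pow in T. fold r in T.
      assert (r ^ (1 + i) <= r).
      { simpl. rewrite <- (Rmult_1_r r) at 3. apply Rmult_le_compat_l; auto. rewrite <- (pow1 i). apply pow_incr; lra. }
      lra. }
    assert (W : r ^ ((1 + i) * (n + 1)) <= r ^ S n * r ^ i).
    { rewrite <- pow_add. replace ((1 + i) * (n + 1))%nat with ((S n + i) + i * n)%nat by lia. rewrite pow_add.
      rewrite <- (Rmult_1_r (r ^ (S n + i))) at 2. apply Rmult_le_compat_l; [now apply pow_le|].
      rewrite <- (pow1 (i * n)). apply pow_incr; lra. }
    assert (V : 2 / Cmod (1 + z ^ (1 + i)) <= 2 / (1 - r)).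
    { apply Rmult_le_compat_l; [lra|]. apply Rinv_le_contravar; lra. }
    apply Rle_trans with (B * (r ^ S n * r ^ i) * (2 / (1 - r))).
    * apply Rmult_le_compat.
      -- apply Rmult_le_pos; [apply Cmod_ge_0|now apply pow_le].
      -- apply Rdiv_le_0_compat; lra.
      -- apply Rmult_le_compat; auto; [apply Cmod_ge_0|now apply pow_le].
      -- exact V.
    * right. ring.
  + rewrite rsum_scal. unfold c.
    assert (Rs : rsum (fun i => r ^ i) n <= / (1 - r)).
    { rewrite <- Series_geom by (rewrite Rabs_pos_eq; lra). apply rsum_le_Series; [intros; now apply pow_le|].
      apply ex_series_pow; lra. }
    apply Rle_trans with (B * (2 / (1 - r)) * r ^ S n * / (1 - r)); [|right; ring].
    apply Rmult_le_compat_l; auto. apply Rmult_le_pos; [|now apply pow_le].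
    apply Rmult_le_pos; auto. apply Rdiv_le_0_compat; lra.
- replace (Finite 0) with (Rbar_mult c 0) by (simpl; f_equal; ring).
  apply (is_lim_seq_scal_l (fun n => r ^ S n)).
  apply (is_lim_seq_incr_1 (fun n => r ^ n)). apply is_lim_seq_geom. rewrite Rabs_pos_eq; auto.
Qed.

Lemma overpartition_gf_neq_0 z : Cmod z < 1 -> overpartition_gf z <> 0%C.
Proof. intros Hz. unfold overpartition_gf. destruct (pk_gf 0 z Hz) as [_ [_ E]]. rewrite E. apply Cexp_neq_0. Qed.

Lemma gauss_limit z : Cmod z < 1 -> z <> 0%C -> Clim (gauss_partial z) (/ overpartition_gf z)%C.
Proof.
intros Hz Nz.
apply Clim_ext with (fun n => csum (shanks_term z n) (S n) * / qprod z n)%C.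
- intros n. rewrite <- shanks_identity by auto. field. now apply qprod_neq_0.
- match goal with |- Clim ?F _ => cut (Clim F (1 * / overpartition_gf z)%C) end.
  { intros H. now rewrite Cmult_1_l in H. }
  apply Clim_mult; [now apply shanks_limit|]. apply Clim_inv; [now apply overpartition_gf_neq_0|].
  apply Clim_ext with (fun M => Csum (gterm (cpart 0 M) z)).
  + intros M. now apply qprod_gf.
  + now apply pk_gf.
Qed.

(** * Theta coefficients and the recurrence for the counts *)

Definition theta_at_square (j : nat) : Z := match j with O => 1%Z | _ => if Nat.odd j then (-2)%Z else 2%Z end.

Definition theta_coeff (k n : nat) : Z := theta (N.of_nat k) (N.of_nat n).

Lemma N_odd_of_nat j : N.odd (N.of_nat j) = Nat.odd j.
Proof.
induction j as [|j IH]; [reflexivity|].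
rewrite Nat2N.inj_succ, N.odd_succ, Nat.odd_succ, <- N.negb_odd, <- Nat.negb_odd. now rewrite IH.
Qed.

Lemma theta_coeff_square k j : (1 <= k)%nat -> theta_coeff k (k * (j * j)) = theta_at_square j.
Proof.
intros Hk. unfold theta_coeff, theta. rewrite !Nat2N.inj_mul.
assert (D : (N.of_nat k * (N.of_nat j * N.of_nat j) / N.of_nat k = N.of_nat j * N.of_nat j)%N)
  by (rewrite N.mul_comm; apply N.div_mul; lia).
rewrite D, N.sqrt_square, N.eqb_refl.
destruct j as [|j]; [reflexivity|].
unfold theta_at_square. rewrite <- N_odd_of_nat. destruct (N.of_nat (S j)) eqn:E; [lia|reflexivity].
Qed.

Lemma theta_coeff_neq_0 k n : theta_coeff k n <> 0%Z -> exists j, (n = k * (j * j))%nat.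
Proof.
unfold theta_coeff, theta. destruct (N.eqb_spec (N.of_nat k * (N.sqrt (N.of_nat n / N.of_nat k) * N.sqrt (N.of_nat n / N.of_nat k))) (N.of_nat n)) as [E|E].
- intros _. exists (N.to_nat (N.sqrt (N.of_nat n / N.of_nat k))). lia.
- intros H; now elim H.
Qed.

Lemma theta_coeff_bound k n : (Z.abs (theta_coeff k n) <= 2)%Z.
Proof.
unfold theta_coeff, theta. set (s := N.sqrt _). destruct (_ =? _)%N; [|lia].
destruct s; [lia|]. destruct (N.odd _); lia.
Qed.

Lemma theta_coeff_0 k n : (forall j, n <> k * (j * j))%nat -> theta_coeff k n = 0%Z.
Proof.
intros H. destruct (Z.eq_dec (theta_coeff k n) 0) as [E|E]; auto.
destruct (theta_coeff_neq_0 k n E) as [j Hj]. now elim (H j).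
Qed.

Definition theta_term (k : nat) (z : C) (n : nat) : C := (RtoC (IZR (theta_coeff k n)) * z ^ n)%C.

Lemma theta_term_summable k z : Cmod z < 1 -> summable (theta_term k z).
Proof.
intros Hz. apply summable_le with (fun n => 2 * Cmod z ^ n).
- intros n. unfold theta_term. rewrite Cmod_mult, Cmod_R, Cmod_pow.
  apply Rmult_le_compat_r; [apply pow_le, Cmod_ge_0|].
  rewrite <- abs_IZR. apply IZR_le, theta_coeff_bound.
- apply (ex_series_scal_l (V := R_NormedModule)), ex_series_pow. split; [apply Cmod_ge_0|auto].
Qed.

Lemma theta_at_square_sgn j : RtoC (IZR (theta_at_square (S j))) = (2 * sgn (S j))%C.
Proof.
unfold theta_at_square. assert (E : sgn (S j) = if Nat.odd (S j) then (- (1))%C else 1%C).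
{ generalize (S j) as m. intros m. induction m as [|m IH]; [reflexivity|].
  unfold sgn in *. rewrite Cpow_S, IH, Nat.odd_succ, <- Nat.negb_odd. destruct (Nat.odd m); simpl; ring. }
rewrite E. destruct (Nat.odd (S j)); rewrite ?opp_IZR; [|ring].
rewrite <- RtoC_opp, <- RtoC_mult. f_equal. ring.
Qed.

Lemma theta_term_partial z n : csum (theta_term 1 z) (n * n + 1) = gauss_partial z n.
Proof.
induction n as [|n IH].
- simpl. unfold gauss_partial, theta_term. simpl csum.
  assert (E : theta_coeff 1 0 = 1%Z) by reflexivity. rewrite E. simpl. ring.
- replace (S n * S n + 1)%nat with ((n * n + 1) + (2 * n + 1))%nat by lia.
  rewrite csum_split, IH, csum_split, csum_1.
  rewrite (csum_ext _ (fun _ => 0%C)).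
  + rewrite csum_const. unfold gauss_partial.
    change (csum ?f (S n)) with (csum f n + f n)%C.
    unfold theta_term. replace (n * n + 1 + (2 * n + 0))%nat with (S n * S n)%nat by lia.
    assert (E : theta_coeff 1 (S n * S n) = theta_at_square (S n)).
    { rewrite <- (theta_coeff_square 1 (S n)) by lia. f_equal. lia. }
    rewrite E, theta_at_square_sgn. ring.
  + intros i Hi. unfold theta_term. rewrite theta_coeff_0; [ring|].
    intros j Hj. assert (n < j)%nat by nia. assert (j < S n)%nat by nia. lia.
Qed.

Lemma gauss_series z : Cmod z < 1 -> (Csum (theta_term 1 z) * overpartition_gf z = 1)%C.
Proof.
intros Hz. destruct (Ceq_dec z 0) as [E|E].
- subst. unfold overpartition_gf.
  assert (K : forall u : nat -> C, (forall n, u (S n) = 0%C) -> Csum u = u O).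
  { intros u Hu. destruct (Csum_finite u 1) as [_ F].
    - intros n Hn. destruct n; [lia|apply Hu].
    - rewrite F. apply csum_1. }
  rewrite !K.
  + unfold theta_term, gterm. assert (E1 : theta_coeff 1 0 = 1%Z) by reflexivity.
    assert (E2 : pk 0 0 = 1%nat) by reflexivity. rewrite E1, E2. simpl. ring.
  + intros n. unfold gterm. simpl. ring.
  + intros n. unfold theta_term. simpl. ring.
- assert (L : Csum (theta_term 1 z) = (/ overpartition_gf z)%C).
  { apply Clim_unique with (fun n => csum (theta_term 1 z) (n * n + 1)).
    - apply (Clim_subseq (csum (theta_term 1 z)) _ (fun n => n * n + 1)%nat); [intros; nia|].
      now apply Clim_csum, theta_term_summable.
    - apply Clim_ext with (gauss_partial z); [intros; now rewrite theta_term_partial|now apply gauss_limit]. }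
  rewrite L. field. now apply overpartition_gf_neq_0.
Qed.

Lemma theta_term_pow k z : (1 <= k)%nat -> Cmod z < 1 -> Csum (theta_term k z) = Csum (theta_term 1 (z ^ k)%C).
Proof.
intros Hk Hz. rewrite (Csum_blocks _ k Hk (theta_term_summable k z Hz)). apply Csum_ext. intros m.
destruct k as [|k']; [lia|]. rewrite (csum_split _ 1 k' : csum _ (S k') = _).
rewrite csum_1, (csum_ext _ (fun _ => 0%C)).
- rewrite csum_const, Nat.add_0_r. unfold theta_term. rewrite Cpow_mult_r.
  assert (E : theta_coeff (S k') (S k' * m) = theta_coeff 1 m).
  { destruct (Z.eq_dec (theta_coeff 1 m) 0) as [E0|E0].
    - rewrite E0. apply theta_coeff_0. intros j Hj. assert (m = 1 * (j * j))%nat by nia. subst m.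
      rewrite theta_coeff_square in E0 by lia. unfold theta_at_square in E0. destruct j; [lia|]. destruct (Nat.odd (S j)); lia.
    - destruct (theta_coeff_neq_0 1 m E0) as [j Hj]. subst m. rewrite theta_coeff_square by lia.
      rewrite Nat.mul_1_l. apply theta_coeff_square. lia. }
  rewrite E. ring.
- intros i Hi. unfold theta_term. rewrite theta_coeff_0; [ring|].
  intros j Hj. assert (m < j * j)%nat by nia. nia.
Qed.

Lemma regular_0 m : regular 0 m = 1%C.
Proof. reflexivity. Qed.

Lemma pk_gf_quotient k z : (1 <= k)%nat -> Cmod z < 1 ->
  (Csum (gterm (pk k) z) * overpartition_gf (z ^ k) = overpartition_gf z)%C.
Proof.
intros Hk Hz.
assert (Hzk : Cmod (z ^ k)%C < 1) by (destruct k; [lia|now apply Cmod_pow_S_lt_1]).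
destruct (pk_gf k z Hz) as [_ [_ E1]]. destruct (pk_gf 0 z Hz) as [_ [_ E2]].
destruct (pk_gf 0 _ Hzk) as [_ [_ E3]]. unfold overpartition_gf. rewrite E1, E2, E3, <- Cexp_plus. f_equal.
destruct (log_part_sum k z Hz) as [S1 _]. destruct (log_part_sum 0 z Hz) as [S2 _].
set (b := fun m => (log_part 0 z m - log_part k z m)%C).
assert (S3 : summable b) by now apply summable_minus.
assert (Eb : Csum b = Csum (log_part 0 (z ^ k)%C)).
{ rewrite (Csum_blocks b k Hk S3). apply Csum_ext. intros m.
  destruct k as [|k']; [lia|]. cbn [csum]. rewrite (csum_ext _ (fun _ => 0%C)).
  - rewrite csum_const. unfold b, log_part. rewrite !regular_0. unfold regular.
    assert (Em : S (S k' * m + k') = (S m * S k')%nat) by lia. rewrite Em.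
    rewrite Nat.Div0.mod_mul, Nat.eqb_refl, <- Cpow_mult_r, (Nat.mul_comm (S k')). ring.
  - intros i Hi. unfold b, log_part. rewrite regular_0. unfold regular.
    assert (Ei : (S (S k' * m + i) mod S k' = S i)%nat).
    { replace (S (S k' * m + i)) with (S i + m * S k')%nat by lia.
      rewrite Nat.Div0.mod_add. apply Nat.mod_small. lia. }
    rewrite Ei. simpl (S i =? 0)%nat. cbv iota. ring. }
rewrite <- Eb. unfold b. rewrite Csum_minus by auto. ring.
Qed.

Lemma Csum_gterm_PSeries (u : nat -> R) x :
  Csum (fun n => RtoC (u n) * RtoC x ^ n)%C = RtoC (PSeries u x).
Proof.
unfold PSeries. rewrite <- Csum_RtoC. apply Csum_ext. intros n. now rewrite RtoC_mult, RtoC_pow.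
Qed.

Lemma CV_summable (u : nat -> R) x : Rabs x < 1 ->
  (forall z, Cmod z < 1 -> summable (fun n => RtoC (u n) * z ^ n)%C) -> Rbar_lt (Rabs x) (CV_radius u).
Proof.
intros Hx H. pose proof (Rabs_pos x) as P. set (r := (Rabs x + 1) / 2).
assert (Hr : Rabs x < r < 1) by (unfold r; lra).
assert (Sr : summable (fun n => RtoC (u n) * RtoC r ^ n)%C) by (apply H; rewrite Cmod_R, Rabs_pos_eq; lra).
apply (CV_radius_gt u r (Series (fun n => Cmod (RtoC (u n) * RtoC r ^ n)%C))); [lra|].
intros n. eapply Rle_trans; [|apply (summable_term_bound _ n Sr)].
rewrite Cmod_mult, Cmod_pow, !Cmod_R, (Rabs_pos_eq r); lra.
Qed.

(** The generating function of [pk k] is P(z) / P(z^k), with P that of all overpartitions, and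
    Gauss's identity is theta(z) P(z) = 1. Hence it equals theta(z^k) / theta(z); multiplied by
    theta(z), coefficients are compared. *)
Theorem pk_convolution k n : (1 <= k)%nat ->
  rsum (fun i => INR (pk k i) * IZR (theta_coeff 1 (n - i))) (S n) = IZR (theta_coeff k n).
Proof.
intros Hk. set (u := fun i => INR (pk k i)). set (e := fun i => IZR (theta_coeff 1 i)). set (ek := fun i => IZR (theta_coeff k i)).
assert (Cu : forall x, Rabs x < 1 -> Rbar_lt (Rabs x) (CV_radius u)).
{ intros x Hx. apply CV_summable; auto. intros z Hz. apply (pk_gf k z Hz). }
assert (Ce : forall x, Rabs x < 1 -> Rbar_lt (Rabs x) (CV_radius e)).
{ intros x Hx. apply CV_summable; auto. intros z Hz. now apply (theta_term_summable 1). }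
assert (Cek : forall x, Rabs x < 1 -> Rbar_lt (Rabs x) (CV_radius ek)).
{ intros x Hx. apply CV_summable; auto. intros z Hz. now apply (theta_term_summable k). }
assert (E : forall x, Rabs x < 1 -> PSeries (PS_mult u e) x = PSeries ek x).
{ intros x Hx. rewrite PSeries_mult by auto. apply RtoC_inj. rewrite RtoC_mult.
  rewrite <- !Csum_gterm_PSeries.
  assert (Hz : Cmod (RtoC x) < 1) by now rewrite Cmod_R.
  assert (Hzk : Cmod (RtoC x ^ k)%C < 1) by (destruct k; [lia|now apply Cmod_pow_S_lt_1]).
  change (Csum (gterm (pk k) (RtoC x)) * Csum (theta_term 1 (RtoC x)) = Csum (theta_term k (RtoC x)))%C.
  rewrite (theta_term_pow k) by auto.
  pose proof (pk_gf_quotient k _ Hk Hz) as Q. pose proof (gauss_series _ Hz) as G1. pose proof (gauss_series _ Hzk) as G2.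
  pose proof (overpartition_gf_neq_0 _ Hzk) as N2.
  revert Q G1 G2 N2.
  generalize (Csum (gterm (pk k) (RtoC x))) (overpartition_gf (RtoC x ^ k)%C) (overpartition_gf (RtoC x)) (Csum (theta_term 1 (RtoC x))) (Csum (theta_term 1 (RtoC x ^ k)%C)).
  intros P g h t t' Q G1 G2 N2. subst h.
  transitivity (P * t * (t' * g))%C; [rewrite G2; ring|].
  transitivity (t * (P * g) * t')%C; [ring|rewrite G1; ring]. }
assert (P0 : Rabs 0 < 1) by (rewrite Rabs_R0; lra).
assert (F : PS_mult u e n = ek n).
{ apply PSeries_ext_recip.
  (* Uniqueness of coefficients needs just some positive radius of convergence; the Cauchy product
     converges at 1/2. *)
  - apply Rbar_lt_le_trans with (/ 2); [simpl; lra|].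
    apply Rbar_not_lt_le. intros Hlt. assert (H2 : Rabs (/ 2) = / 2) by (apply Rabs_pos_eq; lra).
    apply (CV_disk_outside (PS_mult u e) (/ 2)); [now rewrite H2|].
    apply ex_series_lim_0, ex_pseries_R. apply ex_pseries_mult; [apply Cu|apply Ce]; lra.
  - rewrite <- Rabs_R0. now apply Cek.
  - exists (mkposreal 1 Rlt_0_1). intros y Hy. apply E.
    unfold ball in Hy; simpl in Hy. unfold AbsRing_ball, abs, minus, plus, opp in Hy; simpl in Hy.
    rewrite Ropp_0, Rplus_0_r in Hy. exact Hy. }
unfold PS_mult in F. rewrite <- sum_n_Reals, <- rsum_S_n in F. exact F.
Qed.

(** * Correctness of the computation *)

Local Open Scope Z_scope.

Fixpoint hist (k n : nat) : list Z :=
  match n with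
  | O => nil
  | S m => Z.of_nat (pk k m) :: hist k m
  end.

Fixpoint theta_dot (l : list Z) (d : nat) : Z :=
  match l with
  | nil => 0
  | x :: l' => x * theta_coeff 1 d + theta_dot l' (S d)
  end.

Lemma theta_at_square_S j : (1 <= j)%nat -> theta_at_square (S j) = - theta_at_square j.
Proof.
intros Hj. destruct j as [|j]; [lia|]. unfold theta_at_square.
rewrite (Nat.odd_succ (S j)), <- Nat.negb_odd. now destruct (Nat.odd (S j)).
Qed.

(** The invariant of [walk]: the head is at distance i, the next square is j^2 = i + c, and by the
    last hypothesis no square lies in between. After j^2, 2 j entries precede (j + 1)^2. The
    alternation of signs lets the sign at j be factored out. *)
Lemma theta_dot_walk l j c i : (1 <= j)%nat -> (i + c = j * j)%nat -> ((j - 1) * (j - 1) < i)%nat ->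
  theta_dot l i = theta_at_square j * walk l c (2 * j).
Proof.
revert j c i. induction l as [|x l IH]; intros j c i Hj Hc Hi; [simpl; lia|].
cbn [theta_dot walk]. destruct c as [|c].
- assert (E : theta_coeff 1 i = theta_at_square j).
  { rewrite <- (theta_coeff_square 1 j) by lia. f_equal. lia. }
  rewrite E, (IH (S j) (2 * j)%nat (S i)) by (try lia; nia).
  rewrite theta_at_square_S by auto. replace (S (S (2 * j))) with (2 * S j)%nat by lia. ring.
- rewrite theta_coeff_0, (IH j c (S i)) by (try lia; intros q Hq; assert (j - 1 < q)%nat by nia; assert (q < j)%nat by nia; lia).
  ring.
Qed.

Lemma theta_dot_hist k n d :
  IZR (theta_dot (hist k n) (S d)) = rsum (fun i => INR (pk k i) * IZR (theta_coeff 1 (n + d - i)))%R n.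
Proof.
revert d. induction n as [|n IH]; intros d; [reflexivity|].
cbn [hist theta_dot rsum]. rewrite plus_IZR, mult_IZR, <- INR_IZR_INZ, IH, Rplus_comm.
f_equal.
- apply rsum_ext. intros i Hi. do 3 f_equal. lia.
- do 3 f_equal. lia.
Qed.

Lemma next_value_hist k n : (1 <= k)%nat ->
  next_value (N.of_nat k) (N.of_nat n) (hist k n) = Z.of_nat (pk k n).
Proof.
intros Hk. pose proof (pk_convolution k n Hk) as H. cbn [rsum] in H.
pose proof (theta_dot_hist k n 0) as T.
rewrite (theta_dot_walk _ 1 0 1) in T by lia.
change (theta_at_square 1) with (-2) in T. unfold next_value. fold (theta_coeff k n).
apply eq_IZR. rewrite plus_IZR, mult_IZR, <- INR_IZR_INZ, <- H.
rewrite mult_IZR in T. rewrite Nat.sub_diag. change (theta_coeff 1 0) with 1.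
rewrite (rsum_ext _ (fun i => INR (pk k i) * IZR (theta_coeff 1 (n + 0 - i)))%R) by (intros i Hi; do 3 f_equal; lia).
rewrite <- T. change (2 * 1)%nat with 2%nat. lra.
Qed.

Definition gap (a b c d : Z) : Prop := 2 * (a * (c * c)) < b * (b * c + a * d).

(** Both sides are homogeneous of degree 3, so truncation to multiples of t = 2^s produces the
    common factor t^3, which cancels. *)
Lemma gap_test_sound a b c d : 0 <= a -> 0 <= b -> 0 <= c -> 0 <= d -> gap_test a b c d = true -> gap a b c d.
Proof.
intros Ha Hb Hc Hd. unfold gap_test, gap. destruct (Z.leb_spec (Z.log2 a - 40) 0) as [L|L].
- unfold positive_gap. apply Z.ltb_lt.
- set (s := Z.log2 a - 40) in *. cbv zeta. intros H; apply Z.ltb_lt in H. revert H.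
  rewrite !Z.shiftr_div_pow2 by lia. set (t := 2 ^ s). assert (Pt : 0 < t) by (apply Z.pow_pos_nonneg; lia).
  assert (B : forall x, 0 <= x -> 0 <= x / t /\ t * (x / t) <= x < t * (x / t + 1)).
  { intros x Hx. split; [now apply Z.div_pos|]. split; [now apply Z.mul_div_le|now apply Z.mul_succ_div_gt]. }
  destruct (B a Ha) as [A1 A2]. destruct (B b Hb) as [B1 B2]. destruct (B c Hc) as [C1 C2]. destruct (B d Hd) as [D1 D2].
  clearbody t. revert A1 A2 B1 B2 C1 C2 D1 D2.
  generalize (a / t) (b / t) (c / t) (d / t). intros a' b' c' d' A1 A2 B1 B2 C1 C2 D1 D2 H.
  apply Z.le_lt_trans with (2 * ((t * (a' + 1)) * ((t * (c' + 1)) * (t * (c' + 1))))).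
  + apply Z.mul_le_mono_nonneg_l; [lia|]. apply Z.mul_le_mono_nonneg; [lia|lia|nia|].
    apply Z.mul_le_mono_nonneg; lia.
  + apply Z.lt_le_trans with ((t * b') * ((t * b') * (t * c') + (t * a') * (t * d'))).
    * replace (2 * (t * (a' + 1) * (t * (c' + 1) * (t * (c' + 1))))) with ((t * t * t) * (2 * ((a' + 1) * ((c' + 1) * (c' + 1))))) by ring.
      replace (t * b' * (t * b' * (t * c') + t * a' * (t * d'))) with ((t * t * t) * (b' * (b' * c' + a' * d'))) by ring.
      apply Z.mul_lt_mono_pos_l; [nia|auto].
    * apply Z.mul_le_mono_nonneg; [nia|lia|nia|].
      apply Z.add_le_mono; apply Z.mul_le_mono_nonneg; nia.
Qed.

Lemma gap_run_sound k start fuel n : (1 <= k)%nat ->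
  gap_run fuel (N.of_nat k) (N.of_nat n) (N.of_nat start) (hist k n) = true ->
  forall m, (n <= m + 3 < n + fuel)%nat -> (start <= m + 3)%nat ->
  gap (Z.of_nat (pk k m)) (Z.of_nat (pk k (m + 1))) (Z.of_nat (pk k (m + 2))) (Z.of_nat (pk k (m + 3))).
Proof.
intros Hk. revert n. induction fuel as [|fuel IH]; intros n H m Hm Hs; [lia|].
cbn [gap_run] in H. rewrite next_value_hist in H by auto.
assert (R : gap_run fuel (N.of_nat k) (N.of_nat (S n)) (N.of_nat start) (hist k (S n)) = true).
{ rewrite Nat2N.inj_succ. cbn [hist].
  destruct (hist k n) as [|c [|b [|a l]]]; auto.
  destruct (_ <=? _)%N; [destruct (gap_test _ _ _ _); [auto|discriminate]|auto]. }
destruct (Nat.eq_dec (m + 3) n) as [E|E]; [|apply (IH (S n) R); lia].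
subst n. rewrite (Nat.add_comm m 3) in H. cbn [Nat.add hist] in H.
rewrite (Nat.add_comm m 1), (Nat.add_comm m 2), (Nat.add_comm m 3). cbn [Nat.add].
destruct (N.leb_spec (N.of_nat start) (N.of_nat (S (S (S m))))) as [L|L]; [|lia].
destruct (gap_test _ _ _ _) eqn:Ec; [|discriminate].
apply gap_test_sound in Ec; auto; lia.
Qed.

(** The start is [Nbar k + 2] because the inequality at n involves values up to index n + 2. With
    1604 steps the last index is 1603, so all n <= 1601 are covered. *)
Lemma gap_run_2 : gap_run 1604 2 0 77 nil = true. Proof. vm_compute. reflexivity. Qed.

Lemma gap_run_3 : gap_run 1604 3 0 19 nil = true. Proof. vm_compute. reflexivity. Qed.

Lemma gap_run_4 : gap_run 1604 4 0 35 nil = true. Proof. vm_compute. reflexivity. Qed.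

Lemma gap_run_5 : gap_run 1604 5 0 32 nil = true. Proof. vm_compute. reflexivity. Qed.

Lemma gap_run_6 : gap_run 1604 6 0 12 nil = true. Proof. vm_compute. reflexivity. Qed.

Lemma gap_run_7 : gap_run 1604 7 0 26 nil = true. Proof. vm_compute. reflexivity. Qed.

Lemma gap_run_8 : gap_run 1604 8 0 29 nil = true. Proof. vm_compute. reflexivity. Qed.

Lemma gap_run_9 : gap_run 1604 9 0 12 nil = true. Proof. vm_compute. reflexivity. Qed.

Require Import Defs.

Lemma pk_gap k n : (2 <= k <= 9)%nat -> (Nbar k <= n)%nat ->
  gap (Z.of_nat (pk k (n - 1))) (Z.of_nat (pk k n)) (Z.of_nat (pk k (n + 1))) (Z.of_nat (pk k (n + 2))).
Proof.
intros Hk Hn. destruct (Nat.le_gt_cases 1601 n) as [L|L].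
- pose proof (pk_large k n Hk L) as H. cbv zeta in H. unfold gap. apply lt_IZR.
  rewrite !mult_IZR, plus_IZR, !mult_IZR, <- !INR_IZR_INZ. nra.
- assert (R : gap_run 1604 (N.of_nat k) (N.of_nat 0) (N.of_nat (Nbar k + 2)) (hist k 0) = true).
  { assert (E : (k = 2 \/ k = 3 \/ k = 4 \/ k = 5 \/ k = 6 \/ k = 7 \/ k = 8 \/ k = 9)%nat) by lia.
    clear L Hn Hk.
    repeat destruct E as [E|E]; subst k;
    [exact gap_run_2|exact gap_run_3|exact gap_run_4|exact gap_run_5|exact gap_run_6|exact gap_run_7|exact gap_run_8|exact gap_run_9]. }
  (* All [Nbar k] with 2 <= k <= 9 are positive, so [n - 1] is not truncated. *)
  assert (N0 : (1 <= n)%nat).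
  { destruct n; [|lia]. do 10 (destruct k; [simpl in Hn; lia|]). lia. }
  pose proof (gap_run_sound k (Nbar k + 2) 1604 0 ltac:(lia) R (n - 1)) as H.
  replace (n - 1 + 1)%nat with n in H by lia. replace (n - 1 + 2)%nat with (n + 1)%nat in H by lia.
  replace (n - 1 + 3)%nat with (n + 2)%nat in H by lia. apply H; lia.
Qed.

(** * Counting overpartitions *)

Close Scope Z_scope.

Close Scope R_scope.

From mathcomp Require Import all_boot all_order all_algebra zify.

Set Implicit Arguments.
Unset Strict Implicit.
Unset Printing Implicit Defensive.

Definition bounded_regular (k n M : nat) (s : seq (nat * bool)) : bool :=
  is_regular_overpartition k n s && all (fun x => x.1 <= M) s.

Definition unmarked (m : nat) (s : seq (nat * bool)) : bool :=
  all (fun x => (m == x.1) ==> ~~ x.2) s.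

(** The head is a largest part and bounds the tail: this is the recursion that the enumeration below
    follows. *)
Lemma is_regular_overpartition_cons k n x s :
  is_regular_overpartition k n (x :: s) =
  [&& 0 < x.1, ~~ (k %| x.1), x.1 <= n, unmarked x.1 s
    & bounded_regular k (n - x.1) x.1 s].
Proof.
have geq_trans : transitive geq by move=> a b c ba cb; apply: leq_trans cb ba.
rewrite /bounded_regular /is_regular_overpartition /is_overpartition /=.
rewrite !(sorted_pairwise geq_trans) !(path_sortedE geq_trans).
rewrite !(sorted_pairwise geq_trans) all_map.
have -> : (x.1 + sumn [seq y.1 | y <- s] == n) =
          (x.1 <= n) && (sumn [seq y.1 | y <- s] == n - x.1) by lia.
have -> : all (preim [eta fst] (geq x.1)) s = all (fun y => y.1 <= x.1) s by [].
rewrite /unmarked.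
move: (0 < x.1) (all (fun y => y.1 <= x.1) s) (all _ s) (pairwise geq _) (all (fun y => _ ==> _) s) (pairwise _ s) (x.1 <= n) (_ == _) (k %| x.1) (all (fun y => ~~ _) s).
by do 10 case.
Qed.

Lemma bounded_regular_parts k n s :
  is_regular_overpartition k n s -> bounded_regular k n n s.
Proof.
move=> reg_s; rewrite /bounded_regular reg_s /=.
case: s reg_s => // x s; rewrite is_regular_overpartition_cons /=.
case/and5P=> _ _ le_xn _ /andP[_ le_sx]; rewrite le_xn /=.
by apply: sub_all le_sx => y /leq_trans; apply.
Qed.

(** What may follow an occurrence of m: the parts are at most m, and no further copy of m is
    overlined, since the first occurrence has passed. *)
Definition continuation (k n m : nat) (s : seq (nat * bool)) : bool :=
  unmarked m s && bounded_regular k n m s.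

Lemma bounded_regular_cons k n M x s :
  bounded_regular k n M (x :: s) =
  [&& 0 < x.1 <= M, ~~ (k %| x.1), x.1 <= n & continuation k (n - x.1) x.1 s].
Proof.
rewrite {1}/bounded_regular is_regular_overpartition_cons /continuation /=.
case: (boolP (x.1 <= M)) => [le_xM|_]; rewrite ?andbT ?andbF //=.
apply: andb_idr => /and5P[_ _ _ _ /andP[_]].
by apply: sub_all => y /leq_trans; apply.
Qed.

Lemma continuation_cons k n m x s :
  continuation k n m (x :: s) =
  [&& 0 < x.1 <= m, (m == x.1) ==> ~~ x.2, ~~ (k %| x.1), x.1 <= n
    & continuation k (n - x.1) x.1 s].
Proof.
rewrite {1}/continuation bounded_regular_cons /=.
(* The condition on later copies of [m] is implied: for a head equal to [m] the tail already
   satisfies it, and below [m] no copy can follow. *)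
case: (_ ==> _); rewrite ?andbF //=; apply: andb_idl => /and4P[/andP[_ le_xm] _ _].
case/andP=> um /andP[_ le_s].
move: le_xm; rewrite leq_eqVlt => /predU1P[<- //|lt_xm].
apply: sub_all le_s => y le_y; case: eqP => // eq_my.
by move: le_y; rewrite -eq_my leqNgt lt_xm.
Qed.

(** Together with [prepend] and [bounded_enum] this mirrors [cont], [add_part] and [cpart], with
    lists in place of their lengths. The sizes then agree by construction, and membership and
    absence of duplicates remain. *)
Fixpoint continuations (m : nat) (prev : nat -> seq (seq (nat * bool)))
    (fuel n : nat) : seq (seq (nat * bool)) :=
  prev n ++
  if fuel is f.+1 then
    if m <= n then [seq (m, false) :: s | s <- continuations m prev f (n - m)]
    else [::]
  else [::].

Definition prepend (m : nat) (prev : nat -> seq (seq (nat * bool))) (n : nat) :=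
  prev n ++
  if m <= n then
    [seq (m, b) :: s | b <- [:: false; true],
                       s <- continuations m prev (n - m) (n - m)]
  else [::].

Fixpoint bounded_enum (k M : nat) : nat -> seq (seq (nat * bool)) :=
  if M is m.+1 then
    if k %| m.+1 then bounded_enum k m else prepend m.+1 (bounded_enum k m)
  else fun n => if n == 0 then [:: [::]] else [::].

Lemma mem_map_cons (T : eqType) (x y : T) (s : seq T) (l : seq (seq T)) :
  (x :: s \in [seq y :: t | t <- l]) = (x == y) && (s \in l).
Proof.
apply/mapP/andP=> [[t t_l [-> ->]]|[/eqP-> s_l]]; first by rewrite eqxx.
by exists s.
Qed.

Lemma nil_notin_map_cons (T : eqType) (y : T) (l : seq (seq T)) :
  ([::] \in [seq y :: t | t <- l]) = false.
Proof. by apply/mapP=> -[]. Qed.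

Section Continuations.

Variables (k m : nat) (prev : nat -> seq (seq (nat * bool))).

Hypothesis k_ndvd : ~~ (k %| m.+1).

Hypothesis mem_prev : forall n (s : seq (nat * bool)), (s \in prev n) = bounded_regular k n m s.

Hypothesis uniq_prev : forall n, uniq (prev n).

Lemma prev_head n b s : (m.+1, b) :: s \notin prev n.
Proof. by rewrite mem_prev bounded_regular_cons /= ltnn. Qed.

Lemma mem_continuations f n (s : seq (nat * bool)) : n <= f ->
  (s \in continuations m.+1 prev f n) = continuation k n m.+1 s.
Proof.
elim: f n s => [|f IHf] n [|[i b] s] le_nf; rewrite /= ?cats0 ?mem_cat mem_prev //.
- by rewrite continuation_cons bounded_regular_cons /=; lia.
- by case: ifP => _; rewrite ?nil_notin_map_cons ?orbF.
rewrite continuation_cons bounded_regular_cons /=.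
have -> : ((i, b) :: s \in if m < n then
            [seq (m.+1, false) :: t | t <- continuations m.+1 prev f (n - m.+1)]
          else [::]) =
    [&& i == m.+1, ~~ b, m < n & continuation k (n - m.+1) m.+1 s].
  case: ltnP => [lt_mn|_]; last by rewrite /= !andbF.
  rewrite mem_map_cons IHf; last by lia.
  by rewrite xpair_eqE -andbA; case: b.
rewrite (eq_sym i); case: (m.+1 =P i) => [<-|ne_mi].
  by rewrite ltnn leqnn k_ndvd.
rewrite orbF /=; congr (_ && _); lia.
Qed.

Lemma uniq_continuations f n : uniq (continuations m.+1 prev f n).
Proof.
elim: f n => [|f IHf] n /=; rewrite ?cats0 // cat_uniq uniq_prev /=.
case: ifP => // lt_mn; rewrite map_inj_uniq ?IHf; last by move=> s t [].
rewrite andbT; apply/hasPn => _ /mapP[t _ ->]; exact: prev_head.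
Qed.

Lemma mem_prepend n (s : seq (nat * bool)) : (s \in prepend m.+1 prev n) = bounded_regular k n m.+1 s.
Proof.
rewrite /prepend mem_cat mem_prev.
case: s => [|[i b] s].
  case: ifP => _; rewrite ?orbF //=; rewrite /bounded_regular /=.
  by rewrite cats0 mem_cat !nil_notin_map_cons !orbF.
rewrite !bounded_regular_cons /=.
have -> : ((i, b) :: s \in if m < n then
            [seq (m.+1, c) :: t | c <- [:: false; true],
                      t <- continuations m.+1 prev (n - m.+1) (n - m.+1)]
          else [::]) =
    [&& i == m.+1, m < n & continuation k (n - m.+1) m.+1 s].
  case: ltnP => [lt_mn|_]; last by rewrite /= !andbF.
  rewrite /= cats0 mem_cat !mem_map_cons mem_continuations // !xpair_eqE.
  by case: b; case: (_ == _); rewrite ?orbF.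
rewrite (eq_sym i); case: (m.+1 =P i) => [<-|ne_mi].
  by rewrite ltnn leqnn k_ndvd.
rewrite orbF /=; congr (_ && _); lia.
Qed.

Lemma uniq_prepend n : uniq (prepend m.+1 prev n).
Proof.
rewrite /prepend cat_uniq uniq_prev; case: ifP => //= lt_mn; rewrite cats0.
rewrite cat_uniq !map_inj_uniq ?uniq_continuations; try by move=> s t [].
rewrite andbT /=; apply/andP; split; apply/hasPn => s.
  by rewrite mem_cat => /orP[] /mapP[t _ ->]; apply: prev_head.
by move=> /mapP[t _ ->]; rewrite mem_map_cons xpair_eqE andbF.
Qed.

End Continuations.

Lemma bounded_enum_spec k M :
  (forall n (s : seq (nat * bool)), (s \in bounded_enum k M n) = bounded_regular k n M s) /\
  (forall n, uniq (bounded_enum k M n)).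
Proof.
elim: M => [|m [IHmem IHuniq]] /=.
  split=> n; last by case: eqP.
  case=> [|x s]; last first.
    have /negPf le0x : ~~ (0 < x.1 <= 0) by lia.
    by rewrite bounded_regular_cons le0x; case: eqP.
  by rewrite /bounded_regular /is_regular_overpartition /is_overpartition /= !andbT eq_sym; case: eqP.
case: ifPn => [k_dvd|k_ndvd].
  split=> // n [|x s]; rewrite IHmem // !bounded_regular_cons.
  have [-> //=|ne_x] := eqVneq x.1 m.+1; first by rewrite k_dvd !andbF.
  by congr (_ && _); lia.
split=> [n s|n]; [exact: mem_prepend|exact: uniq_prepend].
Qed.

Lemma leb_leq m n : Nat.leb m n = (m <= n).
Proof. by apply/idP/idP => [/PeanoNat.Nat.leb_le /leP|/leP /PeanoNat.Nat.leb_le]. Qed.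

Lemma mod_dvdn k n : PeanoNat.Nat.eqb (PeanoNat.Nat.modulo n k) 0 = (k %| n).
Proof.
apply/idP/idP => [/PeanoNat.Nat.eqb_eq n_mod|/dvdnP[q ->]]; last first.
  by apply/PeanoNat.Nat.eqb_eq/PeanoNat.Nat.Div0.mod_mul.
rewrite (PeanoNat.Nat.div_mod_eq n k) n_mod; apply/dvdnP.
by exists (PeanoNat.Nat.div n k); lia.
Qed.

Lemma size_continuations m prev c f n :
  (forall i, size (prev i) = c i) -> size (continuations m prev f n) = cont m c f n.
Proof.
move=> prevE; elim: f n => [|f IHf] n /=; rewrite size_cat prevE // leb_leq.
by case: leqP => // _; rewrite size_map IHf.
Qed.

Lemma size_bounded_enum k M n : 0 < k -> size (bounded_enum k M n) = cpart k M n.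
Proof.
move=> k_gt0; elim: M n => [|m IHm] n.
  by rewrite /=; case: n.
rewrite [cpart _ _]/= [bounded_enum _ _]/=.
have -> : PeanoNat.Nat.eqb (PeanoNat.Nat.modulo m.+1 k) 0 = (k %| m.+1) by apply: mod_dvdn.
case: ifP => // _; rewrite /prepend /add_part size_cat IHm leb_leq; congr addn.
case: leqP => // _.
by rewrite /= cats0 size_cat !size_map (size_continuations _ _ _ IHm) plusE minusE addn0.
Qed.

(** Two duplicate-free lists with the same members have equal length: the enumeration of the finite
    set, read through [bounded_parts], and [bounded_enum k n n]. *)
Lemma pbar_eq_pk k n : 0 < k -> pbar k n = pk k n.
Proof.
move=> k_gt0; rewrite /pk -size_bounded_enum // /pbar cardE -(size_map (@bounded_parts n)).
have [memE uniqE] := bounded_enum_spec k n.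
apply/perm_size/uniq_perm => //.
  by rewrite map_inj_uniq ?enum_uniq //; apply: bounded_parts_inj.
move=> s; rewrite memE; apply/mapP/idP => [[t]|].
  by rewrite mem_enum inE => reg_t ->; apply: bounded_regular_parts.
case/andP=> reg_s _; have /andP[/bounded_parts_surj[t tE] _] := reg_s.
by exists t; rewrite // mem_enum inE tE.
Qed.

Theorem theorem3p7 (k n : nat) :
  (2 <= k <= 9)%N -> (Nbar k <= n)%N ->
  ((pbar k (n + 1))%:Z * (pbar k n)%:Z ^+ 2
   - 2%:Z * (pbar k (n - 1))%:Z * (pbar k (n + 1))%:Z ^+ 2
   + (pbar k (n - 1))%:Z * (pbar k n)%:Z * (pbar k (n + 2))%:Z > 0)%R.
Proof.
move=> /andP[k_ge2 k_le9] le_Nn; rewrite !pbar_eq_pk ?(ltnW k_ge2) //.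
have := @pk_gap k n (conj (elimT leP k_ge2) (elimT leP k_le9)) (elimT leP le_Nn).
rewrite /gap plusE minusE.
move: (pk k (n - 1)) (pk k n) (pk k (n + 1)) (pk k (n + 2)) => a b c d.
lia.
Qed.
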